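(* Let $\mathbb{K}$ be any field, let $S=\mathbb{K}[x_1,\ldots,x_n]$ with the standard grading, and let $I\subseteq S$ be a nonzero proper square-free monomial ideal. Then $r_I\le \dim(S/I)$. Moreover, if $I$ is shellable (i.e. $I=I_\Delta$ is the Stanley–Reisner ideal of a shellable simplicial complex $\Delta$) or Gorenstein (i.e. $S/I$ is a Gorenstein ring), then $r_I\le \mathrm{reg}(S/I)$.
   Context: Multiplicity: for a proper homogeneous ideal $J\subseteq S$ with $d=\dim(S/J)$ (Krull dimension), put $H_J(t)=\dim_{\mathbb{K}}(S_{\le t}/J_{\le t})$, where $S_{\le t}$ is the space of polynomials of degree at most $t$ and $J_{\le t}=J\cap S_{\le t}$. The Hilbert–Samuel multiplicity is $\mathrm{e}(S/J)=d!\,\lim_{t\to\infty} H_J(t)/t^{d}$. Minimum distance function: for an integer $t\ge 1$ let $\mathcal{F}_t=\{f\in S_t \mid f\notin I,\ (I:f)\neq I\}$, where $S_t$ is the degree-$t$ homogeneous component of $S$. The minimum distance function $\delta_I\colon\mathbb{N}_+\to\mathbb{Z}$ is defined by $\delta_I(t)=\mathrm{e}(S/I)-\max\{\mathrm{e}(S/(I,f))\mid f\in\mathcal{F}_t\}$ if $\mathcal{F}_t\neq\emptyset$, and $\delta_I(t)=\mathrm{e}(S/I)$ if $\mathcal{F}_t=\emptyset$. Regularity index: for a radical homogeneous ideal $I$, $r_I=\min\{s\in\mathbb{N}\mid \delta_I(s)=\lim_{t\to\infty}\delta_I(t)\}$. Castelnuovo–Mumford regularity: if $0\to\bigoplus_j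 S(-j)^{\beta_{gj}}\to\cdots\to\bigoplus_j S(-j)^{\beta_{1j}}\to S\to S/I\to 0$ is the minimal graded free resolution of $S/I$ over $S$, then $\mathrm{reg}(S/I)=\max\{j-i\mid \beta_{ij}\ne 0\}$. Simplicial complexes: a simplicial complex $\Delta$ on the vertex set $[n]=\{1,\ldots,n\}$ is a collection of subsets (faces) of $[n]$, closed under taking subsets and with $\{i\}\in\Delta$ for all $i$; facets are the maximal faces; a face $\sigma$ has dimension $|\sigma|-1$, and $\dim\Delta$ is the maximal dimension of a face. $\Delta$ is pure if all its facets have the same dimension. The Stanley–Reisner ideal $I_\Delta\subseteq S$ is generated by the monomials $\prod_{i\in\sigma}x_i$ with $\sigma\subseteq[n]$, $\sigma\notin\Delta$. A pure simplicial complex $\Delta$ of dimension $d$ is shellable if its facets can be ordered $\sigma_1,\ldots,\sigma_s$ such that $\bar\sigma_i\cap\bigl(\bigcup_{j=1}^{i-1}\bar\sigma_j\bigr)$ is pure of dimension $d-1$ for all $i\ge2$, where $\bar\sigma_i=\{\sigma\in\Delta\mid\sigma\subseteq\sigma_i\}$.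
   Formalization: For non-unmixed I (e.g. (xy,xz)) δ_I tends to −∞ and r_I is undefined, so r_I ≤ dim(S/I) is stated whenever r_I exists, with existence proved for unmixed, shellable or Gorenstein I; δ_I(0) is set to e(S/I), as with s ≥ 1 the claim fails for (x_1,…,x_n). *)

(* Defs.v *)
From HB Require Import structures.
From mathcomp Require Import all_boot all_order all_algebra.
From mathcomp Require Import boolp classical_sets mpoly.

Set Implicit Arguments.
Unset Strict Implicit.
Unset Printing Implicit Defensive.

Import Order.TTheory GRing.Theory Num.Theory.

Local Open Scope classical_set_scope.
Local Open Scope ring_scope.

Section Ideals.
Variable A : comNzRingType.
Implicit Types I J P : set A.

Definition is_ideal I : Prop :=
  [/\ I 0, forall a b, I a -> I b -> I (a + b) & forall c a, I a -> I (c * a)].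

Definition ideal_gen (G : set A) : set A :=
  [set a | forall J, is_ideal J -> G `<=` J -> J a].

Definition colon I (f : A) : set A := [set g | I (g * f)].

Definition prime_ideal P : Prop :=
  [/\ is_ideal P, ~ P 1 & forall a b, P (a * b) -> P a \/ P b].

Definition maximal_ideal P : Prop :=
  [/\ is_ideal P, ~ P 1 & forall J, is_ideal J -> ~ J 1 -> P `<=` J -> J = P].

Definition minimal_prime I P : Prop :=
  [/\ prime_ideal P, I `<=` P &
      forall Q, prime_ideal Q -> I `<=` Q -> Q `<=` P -> Q = P].

Definition noetherian : Prop :=
  forall I, is_ideal I -> exists s : seq A, I = ideal_gen [set` s].

(* A chain of [k.+1] primes of the quotient of A by J, written as primes of A
   containing J. *)
Definition prime_chain J (k : nat) : Prop :=
  exists p : nat -> set A,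
    (forall i, (i <= k)%N -> prime_ideal (p i) /\ J `<=` p i) /\
    (forall i, (i < k)%N -> p i `<` p i.+1).

End Ideals.

(* [xget 0] picks the element of a nonempty set, and is 0 on the empty set. *)
Definition nat_max (X : set nat) : nat :=
  xget 0%N [set m | X m /\ forall k, X k -> (k <= m)%N].

(* Krull dimension of the quotient of A by J, for J proper. *)
Definition krull_dim (A : comNzRingType) (J : set A) : nat :=
  nat_max (prime_chain J).

Definition unmixed (A : comNzRingType) (I : set A) : Prop :=
  forall P, minimal_prime I P -> krull_dim P = krull_dim I.

Definition converges (u : nat -> rat) (l : rat) : Prop :=
  forall eps : rat, 0 < eps ->
    exists N : nat, forall t : nat, (N <= t)%N -> `|u t - l| < eps.

Section Polynomials.
Variables (K : fieldType) (n : nat).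
Local Notation S := {mpoly K[n]}.
Implicit Types I J : set S.

(* [msize p] is 1 + deg p, and 0 for p = 0. *)
Definition deg_le (t : nat) : set S := [set p | (msize p <= t.+1)%N].

(* dim_K (V / V :&: W) = k: the classes of b_0, ..., b_{k-1} are a K-basis. *)
Definition dim_mod (V W : set S) (k : nat) : Prop :=
  exists b : 'I_k -> S, (forall i, V (b i)) /\
    forall v, V v ->
      exists! c : {ffun 'I_k -> K}, W (v - \sum_(i < k) c i *: b i).

Definition hilbert_fun J (t : nat) : nat :=
  xget 0%N [set k | dim_mod (deg_le t) J k].

(* The multiplicity of a standard graded algebra is a positive integer. *)
Definition multiplicity J : nat :=
  let d := krull_dim J in
  xget 0%N [set e | converges
    (fun t => (d`!)%:R * ((hilbert_fun J t)%:R / t%:R ^+ d)) e%:R].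

Definition zero_div_forms I (t : nat) : set S :=
  [set f | [/\ f \is t.-homog, ~ I f & colon I f <> I]].

(* At t = 0 the set of forms is empty for a proper ideal I, so this extends the
   usual function on positive integers by min_dist I 0 = multiplicity I. *)
Definition min_dist I (t : nat) : int :=
  if `[< zero_div_forms I t !=set0 >] then
    (multiplicity I)%:Z -
      (nat_max [set multiplicity (ideal_gen (I `|` [set f]))
                 | f in zero_div_forms I t])%:Z
  else (multiplicity I)%:Z.

(* r is the least s with min_dist I s = lim min_dist I; in particular the limit
   exists. *)
Definition regularity_index I (r : nat) : Prop :=
  exists l : int,
    [/\ converges (fun t => (min_dist I t)%:~R) l%:~R,
        min_dist I r = l &
        forall s, min_dist I s = l -> (r <= s)%N].

Definition sqfree_monomial (sigma : {set 'I_n}) : S := \prod_(i in sigma) 'X_i.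

Definition sqfree_monomial_ideal I : Prop :=
  exists M : {set {set 'I_n}}, I = ideal_gen [set sqfree_monomial s | s in [set` M]].

(* A graded complex  ... -> F_2 -> F_1 -> F_0 = S  with
   F_i = \bigoplus_k S(-(shift i k)), 0 <= k < frank i; elements are row vectors
   and diff i : F_{i+1} -> F_i acts by right multiplication. *)
Definition rank_seq (r : nat -> nat) (i : nat) : nat :=
  if i is j.+1 then r j else 1%N.

Record free_complex := FreeComplex {
  pos_rank : nat -> nat;
  shift : forall i, 'I_(rank_seq pos_rank i) -> nat;
  diff : forall i, 'M[S]_(rank_seq pos_rank i.+1, rank_seq pos_rank i)
}.

Definition frank (F : free_complex) : nat -> nat := rank_seq (pos_rank F).

Definition graded_complex (F : free_complex) : Prop :=
  (forall k, shift (f := F) (i := 0%N) k = 0%N) /\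
  forall i (k : 'I_(frank F i.+1)) (l : 'I_(frank F i)),
    if (shift l <= shift k)%N
    then diff F i k l \is (shift k - shift l).-homog
    else diff F i k l == 0.

Definition minimal_graded_free_resolution I (F : free_complex) : Prop :=
  [/\ graded_complex F,
      exists g, forall i, (g < i)%N -> frank F i = 0%N,
      forall p, I p <-> exists u : 'rV[S]_(frank F 1), u *m diff F 0 = const_mx p,
      forall i (u : 'rV[S]_(frank F i.+1)),
        u *m diff F i = 0 <->
        exists v : 'rV[S]_(frank F i.+2), u = v *m diff F i.+1 &
      forall i (k : 'I_(frank F i.+1)) (l : 'I_(frank F i)),
        (diff F i k l)@_0%MM = 0].

Definition betti (F : free_complex) (i j : nat) : nat :=
  #|[pred k : 'I_(frank F i) | shift k == j]|.

(* rho is the Castelnuovo-Mumford regularity of S/I. *)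
Definition cm_regularity I (rho : int) : Prop :=
  exists F, minimal_graded_free_resolution I F /\
    (exists i j, betti F i j <> 0%N /\ rho = j%:Z - i%:Z) /\
    (forall i j, betti F i j <> 0%N -> j%:Z - i%:Z <= rho).

End Polynomials.

Section SimplicialComplexes.
Variable n : nat.
Implicit Types D : {set {set 'I_n}}.

Definition simplicial_complex D : Prop :=
  (forall s t : {set 'I_n}, s \in D -> t \subset s -> t \in D) /\
  (forall i : 'I_n, [set i]%SET \in D).

Definition facets D : {set {set 'I_n}} :=
  [set s in D | maxset (fun t => t \in D) s]%SET.

Definition face_dim (s : {set 'I_n}) : int := #|s|%:Z - 1.

Definition pure_of_dim D (d : int) : Prop :=
  D <> finset.set0 /\ forall s, s \in facets D -> face_dim s = d.

Definition face_closure D (s : {set 'I_n}) : {set {set 'I_n}} :=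
  [set t in D | t \subset s]%SET.

Definition shellable_complex D : Prop :=
  exists d : int, pure_of_dim D d /\
  exists s : seq {set 'I_n}, [/\ uniq s, s =i facets D &
    forall i, (0 < i < size s)%N ->
      pure_of_dim
        (face_closure D (nth finset.set0 s i) :&:
         \bigcup_(j < i) face_closure D (nth finset.set0 s j))%SET (d - 1)].

Definition stanley_reisner (K : fieldType) D : set {mpoly K[n]} :=
  ideal_gen [set sqfree_monomial K s | s in [set` (~: D)%SET]].

End SimplicialComplexes.

Definition shellable_ideal (K : fieldType) (n : nat) (I : set {mpoly K[n]}) :=
  exists D : {set {set 'I_n}}, [/\ simplicial_complex D, shellable_complex D &
    I = stanley_reisner (K := K) D].

Section Gorenstein.

Definition injective_module (A : comNzRingType) (E : lmodType A) : Prop :=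
  forall (M N : lmodType A) (i : {linear M -> N}) (f : {linear M -> E}),
    injective i -> exists g : {linear N -> E}, forall x, g (i x) = f x.

(* A finite injective resolution 0 -> A -> E_0 -> ... -> E_d -> 0. *)
Definition finite_injective_dim (A : comNzRingType) : Prop :=
  exists (E : nat -> lmodType A) (aug : {linear A^o -> E 0%N})
         (del : forall i, {linear E i -> E i.+1}),
  [/\ forall i, injective_module (E i),
      injective aug,
      forall x, del 0%N x = 0 <-> exists a, x = aug a,
      forall i x, del i.+1 x = 0 <-> exists y, x = del i y &
      exists d, forall i (x : E i), (d < i)%N -> x = 0].

(* h exhibits B as the localization of A at the prime P. *)
Definition localization_at (A : comNzRingType) (P : set A)
    (B : comNzRingType) (h : {rmorphism A -> B}) : Prop :=
  [/\ forall s, ~ P s -> exists b, h s * b = 1,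
      forall b, exists a s, ~ P s /\ b * h s = h a &
      forall a, h a = 0 <-> exists s, ~ P s /\ s * a = 0].

(* Noetherian, and the local rings at maximal ideals have finite injective
   dimension over themselves. *)
Definition gorenstein_ring (A : comNzRingType) : Prop :=
  noetherian A /\
  forall P : set A, maximal_ideal P ->
    exists (B : comNzRingType) (h : {rmorphism A -> B}),
      localization_at P h /\ finite_injective_dim B.

(* The quotient ring A/I is given by a surjection with kernel I. *)
Definition gorenstein_ideal (A : comNzRingType) (I : set A) : Prop :=
  exists (Q : comNzRingType) (q : {rmorphism A -> Q}),
    [/\ forall y, exists x, q x = y,
        forall x, q x = 0 <-> I x &
        gorenstein_ring Q].

End Gorenstein.

(* Main.v *)
Require Import Defs.
From HB Require Import structures.
From mathcomp Require Import all_boot all_order all_algebra.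
From mathcomp Require Import boolp classical_sets mpoly.
From mathcomp Require Import ring zify.

Set Implicit Arguments.
Unset Strict Implicit.
Unset Printing Implicit Defensive.

Import Order.TTheory GRing.Theory Num.Theory.

Local Open Scope classical_set_scope.
Local Open Scope ring_scope.

(* Write I as the intersection of the primes P_F generated by the variables
   outside F, for F a facet of the complex D of I. For a form f of degree e,
   I : f is the ideal of the complex D' generated by the facets F with f not in
   P_F, so S/(I, f) has Hilbert function H_D(t) - H_D'(t - e). Hence, if f lies
   in P_F for some F of maximal size, e(S/(I, f)) is the number of such F;
   otherwise it grows linearly with e. If D is not pure, this makes delta_I tend
   to minus infinity, so that r_I is not defined. If D is pure and the facet F
   is the only one containing some R, then delta_I(t) = 1 for t >= #|R|, as seen
   from f = x_R x_v^(t - #|R|) with v in R; taking R = F gives r_I <= dim(S/I).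

   For the regularity, take R = F \ A such that every face containing R lies in
   F, and suppose that some cycle z on the faces containing A has z_F <> 0. It
   witnesses that x_R e_(V \ F) is not a boundary in the Koszul complex of S/I,
   and lifting this class along a minimal resolution gives a Betti number
   beta_(i, j) <> 0 with j - i = #|R|. For a shelling, such a z exists for the
   last facet and its restriction, since the complex of the earlier facets is
   acyclic relative to A. In the Gorenstein case, let B be the local ring of S/I
   at the origin and m its maximal ideal. Ext^i(B/m, B) is one-dimensional
   and concentrated in one degree, so Ext^i(B/P_s, B) vanishes unless i + #|s|
   is that degree. This forces purity, and the connecting maps down to
   Ext(B/m, B) evaluate each Hom(B/P_F, B) at a minimal separator of F; the
   values obtained along ridges cancel in pairs, which is the required cycle. *)

(** The Gorenstein hypothesis only says that the local rings have finite injective dimension, so no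
    self-duality of the resolution of S/I and no description of Gorenstein complexes is at hand. All
    Ext modules are therefore read off one finite injective resolution E of B: Hom(B/J, E_i) is the
    set of elements of E_i killed by J. The engine is the exact sequence 0 -> B/P_s -> B/P_s ->
    B/P_(s \ v) -> 0 given by x_v: where the next Ext of B/P_(s \ v) vanishes, x_v acts surjectively
    on that of B/P_s, and Nakayama's lemma kills this finitely generated module. Shellable and
    Gorenstein complexes meet in one notion, [separating_cycle]: the same R makes F the only facet
    containing it, which bounds r_I above, and supports the Koszul class that bounds the regularity
    below. There i = #|V \ F| is the exterior degree of e_(V \ F), and x_R adds #|R| to j. Krull
    dimension is defined by chains of arbitrary primes, homogeneous or not, so it is bounded by the
    growth of the Hilbert function of the filtration by degree. *)

Section Restriction.
Variables (K : fieldType) (n : nat).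
Local Notation S := {mpoly K[n]}.
Implicit Types (p q : S) (m : 'X_{1..n}) (P : pred 'X_{1..n}).

Definition mrestr P p : S := \sum_(m <- msupp p | P m) p@_m *: 'X_[m].

Lemma mcoeff_mrestr P p m : (mrestr P p)@_m = if P m then p@_m else 0.
Proof.
rewrite /mrestr raddf_sum /=.
have E i : (p@_i *: 'X_[i] : S)@_m = if i == m then p@_m else 0.
  by rewrite mcoeffZ mcoeffX; case: eqP => [->|_]; rewrite ?mulr1 ?mulr0.
under eq_bigr do rewrite E.
have [mp|mp] := boolP (m \in msupp p); last first.
  rewrite (memN_msupp_eq0 mp) big1 => [|i _]; last by case: ifP.
  by case: ifP.
rewrite big_mkcond (bigD1_seq m) //= eqxx big1 ?addr0 // => i /negbTE ->.
by case: ifP.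
Qed.

Lemma mcoeffMU p (v : 'I_n) m :
  ('X_v * p)@_m = if m v == 0%N then 0 else p@_(m - U_(v)).
Proof.
case: eqP => [mv|/eqP mv]; last first.
  by rewrite mulrC -{1}(@submK _ U_(v) m) ?lep1mP // addmC mcoeffMX.
apply: (memN_msupp_eq0 (p := _ * p)); apply/negP => /msuppM_le /allpairsP [[a b]] /=.
by rewrite msuppX inE => -[/eqP -> _ mE]; rewrite mE mnmDE mnm1E eqxx in mv.
Qed.

End Restriction.

(** * Squarefree monomial ideals as ideals of complexes *)

Section FaceIdeals.
Variables (K : fieldType) (n : nat).
Local Notation S := {mpoly K[n]}.
Implicit Types (p q f : S) (m : 'X_{1..n}) (s t F G : {set 'I_n}).
Implicit Types (D E : {set {set 'I_n}}).

Definition mvars m : {set 'I_n} := [set i | m i != 0%N]%SET.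

Lemma mvars0 : mvars 0%MM = finset.set0.
Proof. by apply/setP=> i; rewrite !inE mnm0E eqxx. Qed.

Lemma mvarsD m1 m2 : mvars (m1 + m2)%MM = (mvars m1 :|: mvars m2)%SET.
Proof. by apply/setP=> i; rewrite !inE mnmDE addn_eq0 negb_and. Qed.

Lemma mvars1 i : mvars U_(i)%MM = [set i]%SET.
Proof. by apply/setP=> j; rewrite !inE mnm1E [i == j]eq_sym; case: (j == i). Qed.

Definition smon s : 'X_{1..n} := [multinom (i \in s : nat) | i < n].

Lemma smonE s i : smon s i = (i \in s).
Proof. by rewrite mnmE. Qed.

Lemma mvars_smon s : mvars (smon s) = s.
Proof. by apply/setP=> i; rewrite inE smonE; case: (i \in s). Qed.

Lemma mdeg_smon s : mdeg (smon s) = #|s|.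
Proof.
by rewrite mdegE (eq_bigr _ (fun i _ => smonE s i)) -sum1_card [RHS]big_mkcond.
Qed.

Lemma sqfree_monomialE s : sqfree_monomial K s = 'X_[smon s].
Proof.
rewrite /sqfree_monomial mprodXE; congr mpolyX; apply/mnmP => i.
rewrite mnm_sumE smonE (eq_bigr (fun j => (j == i) : nat)) => [|j _]; last first.
  by rewrite mnm1E.
case: (boolP (i \in s)) => is_.
  by rewrite (bigD1 i) //= eqxx big1 // => j /andP[_ /negbTE ->].
by rewrite big1 // => j js; case: eqP => // E; rewrite -E js in is_.
Qed.

Lemma smonU s v : v \notin s -> smon (v |: s)%SET = (U_(v) + smon s)%MM.
Proof.
move=> vs; apply/mnmP=> i; rewrite mnmDE !smonE mnm1E in_setU1 eq_sym.
by case: eqP => [<-|] //=; rewrite (negbTE vs).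
Qed.

Lemma smonD1 s v : v \in s -> smon s = (U_(v) + smon (s :\ v)%SET)%MM.
Proof. by move=> vs; rewrite -smonU ?finset.setD1K ?finset.setD11. Qed.

Lemma lem_smon m : (smon (mvars m) <= m)%MM.
Proof. by apply/mnm_lepP => i; rewrite smonE inE; case: (m i). Qed.

Definition down_closed D := forall s t, s \in D -> t \subset s -> t \in D.

(** Membership is a condition on coefficients, so it can be checked monomial by monomial. For D
    closed under subsets this is the Stanley-Reisner ideal of D, where single vertices may fail to
    be faces. *)
Definition face_ideal D : set S := [set p | forall m, mvars m \in D -> p@_m = 0].

(* The prime ideal generated by the variables outside F. *)
Definition face_prime F : set S := face_ideal (powerset F).

Lemma face_idealP D p :
  reflect (forall m, m \in msupp p -> mvars m \notin D) `[< face_ideal D p >].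
Proof.
apply: (iffP (asboolP _)) => pD m.
  by rewrite mcoeff_msupp; apply: contra_neqN => /pD.
by move=> mD; apply: memN_msupp_eq0; apply/negP => /pD; rewrite mD.
Qed.

Lemma face_ideal_ideal D : down_closed D -> is_ideal (face_ideal D).
Proof.
move=> dD; split=> [m _|p q pD qD m mD|p q /asboolP/face_idealP qD].
- by rewrite mcoeff0.
- by rewrite mcoeffD pD // qD // addr0.
apply/asboolP/face_idealP => m /msuppM_le/allpairsP[[a b]] /= [_ /qD bD ->].
by apply: contra bD => /dD; apply; rewrite mvarsD finset.subsetUr.
Qed.

Lemma face_idealX D m : face_ideal D 'X_[m] <-> mvars m \notin D.
Proof.
split=> [mD|mD].
  apply/negP => /mD; rewrite mcoeffX eqxx => /eqP; exact/negP/oner_neq0.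
move=> m' m'D; rewrite mcoeffX; case: eqP => // E.
by rewrite E m'D in mD.
Qed.

Lemma powerset_down F : down_closed (powerset F).
Proof. by move=> s t; rewrite !powersetE => sF /fintype.subset_trans; apply. Qed.

Lemma face_idealS D E : D \subset E -> face_ideal E `<=` face_ideal D.
Proof. by move=> /fintype.subsetP DE p pE m /DE/pE. Qed.

(* Reduction modulo the variables outside F. *)
Definition face_eval F : n.-tuple S :=
  [tuple if i \in F then 'X_i else 0 | i < n].

Lemma face_evalX F m :
  'X_[m] \mPo face_eval F = if mvars m \subset F then 'X_[m] else 0.
Proof.
rewrite comp_mpolyX; case: (boolP (mvars m \subset F)) => [/fintype.subsetP mF|].
  rewrite [in RHS]mpolyXE_id; apply: eq_bigr => i _; rewrite tnth_mktuple.
  case: (m i =P 0%N) => [->|/eqP mi]; first by rewrite !expr0.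
  by rewrite mF // inE.
case/fintype.subsetPn => i; rewrite inE => mi iF.
by rewrite (bigD1 i) //= tnth_mktuple (negbTE iF) expr0n (negbTE mi) mul0r.
Qed.

Lemma mcoeff_face_eval F p m :
  (p \mPo face_eval F)@_m = if mvars m \subset F then p@_m else 0.
Proof.
have -> : p \mPo face_eval F = mrestr (fun m => mvars m \subset F) p.
  rewrite /mrestr [in LHS](mpolyE p) !raddf_sum /= [RHS]big_mkcond /=.
  by apply: eq_bigr => m' _; rewrite linearZ /= face_evalX; case: ifP => // _; rewrite scaler0.
by rewrite mcoeff_mrestr.
Qed.

Lemma face_primeE F p : face_prime F p <-> p \mPo face_eval F = 0.
Proof.
split=> [pF|pF m]; last first.
  by rewrite powersetE => mF; have := mcoeff_face_eval F p m; rewrite mF pF mcoeff0.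
by apply/mpolyP=> m; rewrite mcoeff_face_eval mcoeff0; case: ifP => // mF; rewrite pF // powersetE.
Qed.

(** It is the kernel of the substitution by [face_eval F], an endomorphism of the domain S. *)
Lemma face_prime_prime F : prime_ideal (face_prime F).
Proof.
split; first exact/face_ideal_ideal/powerset_down.
  move/face_primeE; rewrite rmorph1; exact/eqP/oner_neq0.
move=> p q /face_primeE; rewrite rmorphM /= => /eqP; rewrite mulf_eq0.
by case/orP => /eqP /face_primeE; [left|right].
Qed.

Lemma face_primeM F p q : face_prime F (p * q) <-> face_prime F p \/ face_prime F q.
Proof.
have [pI _ pM] := face_prime_prime F; split; first exact: pM.
by case: pI => _ _ cI [/cI h|/cI h]; [rewrite mulrC|]; apply: h.
Qed.

Lemma face_primeX F m : face_prime F 'X_[m] <-> ~~ (mvars m \subset F).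
Proof. by rewrite -powersetE; exact: face_idealX. Qed.

Lemma face_prime_subset F G : face_prime G `<=` face_prime F <-> F \subset G.
Proof.
split=> [h|FG]; last first.
  apply: face_idealS; apply/fintype.subsetP => s; rewrite !powersetE => /fintype.subset_trans; exact.
apply/fintype.subsetP => i iF; apply/negPn/negP => iG.
have /h/face_primeX : face_prime G 'X_i by apply/face_primeX; rewrite mvars1 finset.sub1set.
by rewrite mvars1 finset.sub1set iF.
Qed.

Lemma mem_facets D s :
  s \in facets D <-> s \in D /\ forall t, t \in D -> s \subset t -> t = s.
Proof.
rewrite !inE; split=> [/andP[sD /maxsetP[_ sm]]|[sD sm]]; first by split.
by rewrite sD; apply/maxsetP; split.
Qed.

Lemma ex_facet D s : s \in D -> exists2 F, F \in facets D & s \subset F.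
Proof.
move=> sD; have [F Fm sF] := maxset_exists (P := fun t => t \in D) sD.
by exists F => //; rewrite !inE Fm andbT; case/maxsetP: Fm.
Qed.

Lemma face_ideal_facets D p : down_closed D ->
  face_ideal D p <-> forall F, F \in facets D -> face_prime F p.
Proof.
move=> dD; split=> [pD F /mem_facets[FD _] m|pF m mD].
  by rewrite powersetE => mF; apply: pD; apply: dD mF.
have [F /pF Fp mF] := ex_facet mD; apply: Fp; by rewrite powersetE.
Qed.

Definition faces_of (I : set S) : {set {set 'I_n}} :=
  [set s | `[< ~ I (sqfree_monomial K s) >]]%SET.

Lemma mem_faces_of I s : s \in faces_of I <-> ~ I 'X_[smon s].
Proof. by rewrite inE -sqfree_monomialE; split=> /asboolP. Qed.

Lemma ideal_gen_ideal (A : comNzRingType) (X : set A) : is_ideal (ideal_gen X).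
Proof.
split=> [J [] //|a b aI bI J JI XJ|c a aI J JI XJ].
  by case: (JI) => _ /(_ a b) h _; apply: h; [apply: aI|apply: bI].
by case: (JI) => _ _ /(_ c a) h; apply: h; apply: aI.
Qed.

Lemma sub_ideal_gen (A : comNzRingType) (X : set A) : X `<=` ideal_gen X.
Proof. by move=> a aX J _; apply. Qed.

Lemma ideal_sum (A : comNzRingType) (I : set A) (T : Type) (r : seq T)
    (P : pred T) (f : T -> A) :
  is_ideal I -> (forall i, P i -> I (f i)) -> I (\sum_(i <- r | P i) f i).
Proof. by case=> I0 ID _ h; elim/big_ind: _ => // a b; exact: ID. Qed.

Lemma ideal_mulr (A : comNzRingType) (I : set A) a c :
  is_ideal I -> I a -> I (a * c).
Proof. by case=> _ _ h /h; rewrite mulrC; exact. Qed.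

Lemma idealN (A : comNzRingType) (I : set A) a : is_ideal I -> I a -> I (- a).
Proof. by case=> _ _ h /h => /(_ (-1)); rewrite mulN1r. Qed.

Lemma idealB (A : comNzRingType) (I : set A) a b :
  is_ideal I -> I a -> I b -> I (a - b).
Proof. by move=> iI Ia Ib; case: (iI) => _ h _; apply: h => //; exact: idealN. Qed.

(** Every monomial is a multiple of the squarefree monomial on its own support, so squarefree
    monomials suffice. *)
Lemma ideal_sub_face D (I : set S) : down_closed D -> is_ideal I ->
  (forall s, s \notin D -> I 'X_[smon s]) -> face_ideal D `<=` I.
Proof.
move=> dD iI h p /asboolP/face_idealP pD; rewrite (mpolyE p).
rewrite big_seq_cond; apply: ideal_sum => // m /andP[/pD/h mI _].
rewrite -mul_mpolyC; case: (iI) => _ _ iM; apply: (iM).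
by rewrite -(submK (lem_smon m)) mpolyXD; apply: iM.
Qed.

Lemma sqfree_face_ideal (I : set S) : sqfree_monomial_ideal I ->
  down_closed (faces_of I) /\ I = face_ideal (faces_of I).
Proof.
case=> M IE; have iI : is_ideal I by rewrite IE; exact: ideal_gen_ideal.
have dD : down_closed (faces_of I).
  move=> s t /mem_faces_of sI ts; apply/mem_faces_of => tI; apply: sI.
  rewrite -(finset.setID s t) (finset.setIidPr ts).
  suff -> : smon (t :|: s :\: t)%SET = (smon (s :\: t)%SET + smon t)%MM.
    by rewrite mpolyXD; case: iI => _ _; apply.
  by apply/mnmP => i; rewrite mnmDE !smonE finset.in_setU finset.in_setD; case: (i \in t); case: (i \in s).
split=> //; apply/seteqP; split; last first.
  apply: ideal_sub_face => // s sD; apply: contrapT => sI.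
  by case/negP: sD; apply/mem_faces_of.
rewrite {1}IE => p; apply; first exact: face_ideal_ideal.
move=> _ [s sM <-]; rewrite sqfree_monomialE; apply/face_idealX.
rewrite mvars_smon; apply/negP => /mem_faces_of; apply.
rewrite -sqfree_monomialE IE; apply: sub_ideal_gen; by exists s.
Qed.

Lemma faces_of_face_ideal D : faces_of (face_ideal D) = D.
Proof.
apply/setP => s; apply/idP/idP => [/mem_faces_of|sD].
  by apply: contra_notT => sD; apply/face_idealX; rewrite mvars_smon.
by apply/mem_faces_of => /face_idealX; rewrite mvars_smon sD.
Qed.

End FaceIdeals.

(** * Incidence signs and the square of a boundary map *)

Section Signs.
Variables (K : fieldType) (n : nat).
Implicit Types (s : {set 'I_n}) (u v : 'I_n).

(** The sign of moving v past the smaller elements of s. The simplicial boundary, the Koszul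
    differential and the iterated connecting maps all use it. *)
Definition sgn (v : 'I_n) (s : {set 'I_n}) : K := (-1) ^+ #|[set u in s | (u < v)%N]%SET|.

Lemma sgn_neq0 v s : sgn v s != 0.
Proof. by rewrite signr_eq0. Qed.

Lemma sgn_sqr v s : sgn v s * sgn v s = 1.
Proof. by rewrite -expr2 sqrr_sign. Qed.

Lemma sgnU1 v u s : u \notin s ->
  sgn v (u |: s)%SET = if (u < v)%N then - sgn v s else sgn v s.
Proof.
move=> us; rewrite /sgn; case: ifP => uv.
  rewrite (_ : [set x in u |: s | (x < v)%N]%SET = (u |: [set x in s | (x < v)%N])%SET).
    by rewrite cardsU1 inE (negbTE us) /= exprS mulN1r.
  by apply/setP => x; rewrite !inE; case: eqP => // ->; rewrite uv.
congr (_ ^+ _); apply: eq_card => x; rewrite !inE.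
by case: eqP => //= ->; rewrite uv andbF.
Qed.

Lemma sgnD1 v s : sgn v (s :\ v)%SET = sgn v s.
Proof.
congr (_ ^+ _); apply: eq_card => x; rewrite !inE.
by case: eqP => //= ->; rewrite ltnn andbF.
Qed.

Lemma sgn_min v s : (forall u, u \in s -> (v <= u)%N) -> sgn v s = 1.
Proof.
move=> h; rewrite /sgn eq_card0 // => x; rewrite !inE.
by apply/negP => /andP[/h]; rewrite leqNgt => /negbTE ->.
Qed.

Lemma sgn_anti u v s : u \notin s -> v \notin s -> u != v ->
  sgn u s * sgn v (u |: s)%SET = - (sgn v s * sgn u (v |: s)%SET).
Proof.
move=> us vs uv; rewrite !sgnU1 //; case: (ltngtP u v) => [lt|lt|/val_inj e].
- by rewrite mulrN mulrC.
- by rewrite mulrN opprK mulrC.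
- by rewrite e eqxx in uv.
Qed.

End Signs.

(** Adding u and v in either order gives the same set with opposite coefficients. The coefficients
    are left arbitrary so that the simplicial boundary and the Koszul differential are both
    instances. *)
Lemma bd_bd (n : nat) (R : comNzRingType) (V : lmodType R)
    (c : 'I_n -> {set 'I_n} -> R) (om : {set 'I_n} -> V) (U : {set 'I_n}) :
  (forall (U : {set 'I_n}) u v, u \notin U -> v \notin U -> u != v ->
    c u U * c v (u |: U)%SET = - (c v U * c u (v |: U)%SET)) ->
  \sum_(u | u \notin U) c u U *:
    (\sum_(v | v \notin (u |: U)%SET) c v (u |: U)%SET *: om (v |: (u |: U))%SET) = 0.
Proof.
move=> anti; pose f u v := (c u U * c v (u |: U)%SET) *: om (v |: (u |: U))%SET.
transitivity (\sum_(u | u \notin U) \sum_(v | (v \notin U) && (v != u)) f u v).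
  apply: eq_bigr => u uU; rewrite scaler_sumr; apply: eq_big => v.
    by rewrite !inE negb_or andbC.
  by move=> _; rewrite scalerA.
have fN u v : u \notin U -> v \notin U -> u != v -> f u v = - f v u.
  by move=> uU vU uv; rewrite /f -scaleNr finset.setUCA anti.
have -> : \sum_(u | u \notin U) \sum_(v | (v \notin U) && (v != u)) f u v =
    \sum_(u | u \notin U) \sum_(v | (v \notin U) && (u < v)%N) f u v +
    \sum_(u | u \notin U) \sum_(v | (v \notin U) && (v < u)%N) f u v.
  rewrite -big_split; apply: eq_bigr => u uU.
  rewrite (bigID (fun v : 'I_n => (u < v)%N)) /=; congr (_ + _); apply: eq_bigl => v.
    by rewrite -andbA; congr (_ && _); rewrite -val_eqE /= neq_ltn; case: ltngtP.
  by rewrite -andbA; congr (_ && _); rewrite -val_eqE /= neq_ltn; case: ltngtP.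
rewrite [X in X + _](exchange_big_dep (fun v => v \notin U)) /=; last by move=> u v _ /andP[].
rewrite -big_split big1 //= => v vU; apply/eqP; rewrite addr_eq0 -sumrN; apply/eqP.
apply: eq_big => u; first by rewrite vU.
move=> /andP[uU /andP[_ uv]]; apply: fN => //.
by rewrite -val_eqE /= neq_ltn uv.
Qed.

(** * Injective modules and Ext over a Noetherian ring *)

Section Submodule.
Variables (A : comNzRingType) (V : lmodType A).

Definition is_submod (W : set V) :=
  W 0 /\ forall a u v, W u -> W v -> W (a *: u + v).

Definition submod_pred (W : set V) (hW : is_submod W) : {pred V} :=
  fun v => `[< W v >].

Lemma submod_pred_closed W (hW : is_submod W) : submod_closed (submod_pred hW).
Proof.
case: (hW) => W0 WD; split; first exact/asboolP.
by move=> a u v /asboolP Wu /asboolP Wv; apply/asboolP; exact: WD.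
Qed.

HB.instance Definition _ W (hW : is_submod W) :=
  GRing.isSubmodClosed.Build A V (submod_pred hW) (submod_pred_closed hW).

(** Makes an arbitrary submodule an [lmodType], the form in which [injective_module] can be applied
    to its inclusion. *)
Definition submod W (hW : is_submod W) := {v : V | submod_pred hW v}.

HB.instance Definition _ W (hW : is_submod W) := SubType.on (submod hW).
HB.instance Definition _ W (hW : is_submod W) := [Choice of submod hW by <:].
HB.instance Definition _ W (hW : is_submod W) :=
  [SubChoice_isSubLmodule of submod hW by <:].

(** The map f is a total function, linear on W only, so that it may be defined by choice. *)
Lemma inj_extend (E : lmodType A) (W : set V) (f : V -> E) :
  injective_module E -> is_submod W ->
  (forall a u v, W u -> W v -> f (a *: u + v) = a *: f u + f v) ->
  exists g : {linear V -> E}, forall w, W w -> g w = f w.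
Proof.
move=> Einj hW fL.
pose h (u : submod hW) : E := f (val u).
have hL : linear h.
  by move=> a u v; rewrite /h linearP /= fL //; apply/asboolP; [exact: (valP u)|exact: (valP v)].
pose hM := GRing.isLinear.Build A (submod hW) E _ h hL.
pose hl : {linear submod hW -> E} := HB.pack h hM.
have [g gE] := @Einj _ _ (val : {linear submod hW -> V}) hl val_inj.
exists g => w /asboolP ww.
exact: (gE (Sub w ww)).
Qed.
End Submodule.

Section InjectiveSystems.
Variables (A : comNzRingType) (E : lmodType A).

(** A linear system over an injective module is solvable once its right-hand side y respects the
    relations between the rows of G modulo bb. Sending a vector congruent to a G modulo bb to the
    combination of y with coefficients a is then well defined; an extension to all of A^r sends the
    unit vectors to a solution killed by bb. *)
Lemma inj_solve r k (G : 'M[A]_(k, r)) (bb : set A) (y : 'I_k -> E) :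
  injective_module E -> is_ideal bb ->
  (forall a : 'rV[A]_k, (forall j, bb ((a *m G) 0 j)) -> \sum_i a 0 i *: y i = 0) ->
  exists e : 'I_r -> E, (forall j b, bb b -> b *: e j = 0) /\
    forall i, \sum_j G i j *: e j = y i.
Proof.
move=> Einj bI yG; have [b0 bD bM] := bI.
pose L (a : 'rV[A]_k) := \sum_i a 0 i *: y i.
have LP c a a' : L (c *: a + a') = c *: L a + L a'.
  rewrite /L scaler_sumr -big_split /=; apply: eq_bigr => i _.
  by rewrite !mxE scalerDl scalerA.
pose R (w : 'rV[A]_r) a := forall j, bb ((w - a *m G) 0 j).
have RP c w w' a a' : R w a -> R w' a' -> R (c *: w + w') (c *: a + a').
  move=> wa wa' j; have := bD _ _ (bM c _ (wa j)) (wa' j).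
  congr bb; rewrite mulmxDl -scalemxAl !mxE; ring.
pose f w := xget 0 [set x | exists2 a, R w a & x = L a].
have fE w a : R w a -> f w = L a.
  move=> wa; rewrite /f; case: xgetP => [x -> [a' wa' ->]|/(_ (L a))[]]; last by exists a.
  suff: L (a' - a) = 0 by rewrite addrC -scaleN1r LP scaleN1r addrC => /subr0_eq.
  apply: yG => j; have := RP (-1) _ _ _ _ wa' wa j.
  by rewrite !scaleN1r addNr sub0r -mulNmx opprD opprK.
pose W := [set w | exists a, R w a].
have [||] := inj_extend (W := W) (f := f) Einj.
- split; first by exists 0 => j; rewrite mul0mx subr0 mxE.
  by move=> c u v [a ua] [b vb]; exists (c *: a + b); exact: RP.
move=> c u v [a ua] [b vb].
  by rewrite (fE _ _ (RP c _ _ _ _ ua vb)) (fE _ _ ua) (fE _ _ vb) LP.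
move=> g gf; exists (fun j => g (delta_mx 0 j)); split=> [j b bb_b|i].
  rewrite -linearZ gf; last first.
    by exists 0 => j'; rewrite mul0mx subr0 !mxE mulrC; exact: bM.
  rewrite (fE _ 0); first by rewrite /L big1 // => i _; rewrite mxE scale0r.
  by move=> j'; rewrite mul0mx subr0 !mxE mulrC; exact: bM.
have Ri : R (row i G) (delta_mx 0 i) by move=> j; rewrite -rowE subrr mxE.
transitivity (g (row i G)); last first.
  rewrite gf; last by exists (delta_mx 0 i).
  rewrite (fE _ _ Ri) /L (bigD1 i) //= !mxE !eqxx scale1r big1 ?addr0 // => j /negbTE ij.
  by rewrite !mxE ij andbF scale0r.
rewrite [row i G]row_sum_delta linear_sum; apply: eq_bigr => j _.
by rewrite linearZ mxE.
Qed.
End InjectiveSystems.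

Section Noetherian.
Variable A : comNzRingType.

Lemma ideal_gen_seq (s : seq A) c : ideal_gen [set` s] c ->
  exists a : 'I_(size s) -> A, c = \sum_i a i * s`_i.
Proof.
move=> /(_ [set c | exists a : 'I_(size s) -> A, c = \sum_i a i * s`_i]); apply.
  split.
  - by exists (fun=> 0); rewrite big1 // => i _; rewrite mul0r.
  - move=> _ _ [a ->] [b ->]; exists (fun i => a i + b i).
    by rewrite -big_split; apply: eq_bigr => i _; rewrite mulrDl.
  - move=> x _ [a ->]; exists (fun i => x * a i).
    by rewrite mulr_sumr; apply: eq_bigr => i _; rewrite mulrA.
move=> x /= xs; have xi : (index x s < size s)%N by rewrite index_mem.
exists (fun i => (i == Ordinal xi)%:R); rewrite (bigD1 (Ordinal xi)) //= eqxx mul1r.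
by rewrite nth_index // big1 ?addr0 // => i /negbTE ->; rewrite mul0r.
Qed.

(** Induction on the rank: the first coordinates of N form a finitely generated ideal, and after
    subtracting lifts of its generators the first coordinate is 0, so the other coordinates lie in a
    submodule of smaller rank. *)
Lemma noetherian_submod_gen (hA : noetherian A) r (N : set 'rV[A]_r) :
  is_submod N -> exists k (g : 'I_k -> 'rV[A]_r), (forall l, N (g l)) /\
    forall w, N w -> exists a, w = \sum_l a l *: g l.
Proof.
elim: r N => [|r IH] N [N0 ND].
  exists 0%N, (fun=> 0); split=> // w _; exists (fun=> 0).
  by rewrite (thinmx0 w) [RHS]thinmx0.
have NS k (g : 'I_k -> 'rV[A]_r.+1) a : (forall l, N (g l)) -> N (\sum_l a l *: g l).
  move=> gN; apply: big_ind => // [u v Nu Nv|l _].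
    by rewrite -[u]scale1r; exact: ND.
  by rewrite -[_ *: _]addr0; exact: ND.
pose I1 : set A := [set c | exists2 w, N w & w 0 0 = c].
have [s sE] : exists s : seq A, I1 = ideal_gen [set` s].
  apply: hA; split; first by exists 0; rewrite ?mxE.
  - move=> _ _ [u Nu <-] [v Nv <-]; exists (1 *: u + v); first exact: ND.
    by rewrite scale1r mxE.
  - move=> a _ [u Nu <-]; exists (a *: u + 0); first exact: ND.
    by rewrite addr0 mxE.
pose drp (w : 'rV[A]_r.+1) : 'rV[A]_r := \row_j w 0 (lift 0 j).
have [|k0 [g0 [g0N g0E]]] := IH [set u | exists w, [/\ N w, w 0 0 = 0 & drp w = u]].
  split; first by exists 0; split; rewrite ?mxE //; apply/rowP=> j; rewrite !mxE.
  move=> a u v [w [Nw w0 <-]] [w' [Nw' w'0 <-]]; exists (a *: w + w'); split.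
  - exact: ND.
  - by rewrite !mxE w0 w'0 mulr0 addr0.
  - by apply/rowP=> j; rewrite !mxE.
have /choice[f fE] l : exists w, [/\ N w, w 0 0 = 0 & drp w = g0 l] by exact: g0N.
have /choice[u uE] (i : 'I_(size s)) : exists w, N w /\ w 0 0 = s`_i.
  suff [w] : I1 s`_i by exists w.
  by rewrite sE; apply: sub_ideal_gen; exact: mem_nth.
exists (size s + k0)%N, (fun l => match split l with inl i => u i | inr j => f j end).
split=> [l|w Nw].
  by case: split => [i|j]; [case: (uE i)|case: (fE j)].
have [a aE] : exists a : 'I_(size s) -> A, w 0 0 = \sum_i a i * s`_i.
  by apply: ideal_gen_seq; rewrite -sE; exists w.
pose w' := w - \sum_i a i *: u i.
have Nw' : N w'.
  rewrite /w' addrC -scaleN1r; apply: ND => //; apply: NS => i; by case: (uE i).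
have w'0 : w' 0 0 = 0.
  rewrite !mxE summxE aE -sumrB big1 // => i _.
  by rewrite mxE (proj2 (uE i)) subrr.
have [b bE] : exists b, drp w' = \sum_l b l *: g0 l by apply: g0E; exists w'.
have {bE} bE : w' = \sum_l b l *: f l.
  apply/rowP => j; case: (unliftP 0 j) => [j' ->|->].
    have := congr1 (fun x : 'rV_r => x 0 j') bE; rewrite mxE => ->.
    rewrite !summxE; apply: eq_bigr => l _; rewrite !mxE.
    by case: (fE l) => _ _ <-; rewrite !mxE.
  rewrite w'0 summxE big1 // => l _; rewrite mxE.
  by case: (fE l) => _ -> _; rewrite mulr0.
exists (fun l => match split l with inl i => a i | inr j => b j end).
rewrite big_split_ord /= -[w](subrK (\sum_i a i *: u i)) -/w' bE addrC.
congr (_ + _); apply: eq_bigr => i _.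
  by rewrite -[rshift _ _]/(unsplit (inr i)) unsplitK.
by rewrite -[lshift _ _]/(unsplit (inl i)) unsplitK.
Qed.

Lemma noetherian_submod (hA : noetherian A) r (N : set 'rV[A]_r) :
  is_submod N -> exists k (G : 'M[A]_(k, r)), forall w, N w <-> exists a, w = a *m G.
Proof.
move=> hN; have [k [g [gN gE]]] := noetherian_submod_gen hA hN.
have E (a : 'rV_k) : a *m \matrix_l g l = \sum_l a 0 l *: g l.
  by rewrite mulmx_sum_row; apply: eq_bigr => l _; rewrite rowK.
exists k, (\matrix_l g l) => w; split=> [/gE[a ->]|[a ->]].
  by exists (\row_l a l); rewrite E; apply: eq_bigr => l _; rewrite mxE.
rewrite E; case: hN => N0 ND.
apply: big_ind => // [u v Nu Nv|l _].
  by rewrite -[u]scale1r; exact: ND.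
by rewrite -[_ *: _]addr0; exact: ND.
Qed.
End Noetherian.

Section Resolution.
Variables (A : comNzRingType) (E : nat -> lmodType A) (aug : {linear A^o -> E 0%N})
  (del : forall i, {linear E i -> E i.+1}).
Hypotheses (Einj : forall i, injective_module (E i)) (aug_inj : injective aug)
  (ex0 : forall x, del 0%N x = 0 <-> exists a, x = aug a)
  (exS : forall i x, del i.+1 x = 0 <-> exists y, x = del i y).

Lemma augM c b : aug (c * b) = c *: aug b.
Proof. by rewrite -[c * b]/(c *: (b : A^o)) linearZ. Qed.

Lemma deldel i x : del i.+1 (del i x) = 0.
Proof. by apply/exS; exists x. Qed.

Definition lact k r (G : 'M[A]_(k, r)) i (e : 'I_r -> E i) : 'I_k -> E i :=
  fun a => \sum_j G a j *: e j.

Lemma lact_mul l k r (H : 'M[A]_(l, k)) (G : 'M[A]_(k, r)) i (e : 'I_r -> E i) :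
  lact (H *m G) e =1 lact H (lact G e).
Proof.
move=> a; rewrite /lact; under [RHS]eq_bigr do rewrite scaler_sumr.
rewrite exchange_big; apply: eq_bigr => j _; rewrite mxE scaler_suml.
by apply: eq_bigr => b _; rewrite scalerA.
Qed.

Lemma lact_del k r (G : 'M[A]_(k, r)) i (e : 'I_r -> E i) a :
  del i (lact G e a) = lact G (fun j => del i (e j)) a.
Proof. by rewrite linear_sum; apply: eq_bigr => j _; rewrite linearZ. Qed.

Lemma lactB k r (G : 'M[A]_(k, r)) i (e f : 'I_r -> E i) a :
  lact G (fun j => e j - f j) a = lact G e a - lact G f a.
Proof. by rewrite /lact -sumrB; apply: eq_bigr => j _; rewrite scalerBr. Qed.

Lemma lact_sum k r (G : 'M[A]_(k, r)) i m (c : 'I_m -> A) (f : 'I_m -> 'I_r -> E i) a :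
  lact G (fun j => \sum_l c l *: f l j) a = \sum_l c l *: lact G (f l) a.
Proof.
rewrite /lact; under eq_bigr do rewrite scaler_sumr; rewrite exchange_big.
apply: eq_bigr => l _; rewrite scaler_sumr; apply: eq_bigr => j _.
by rewrite !scalerA mulrC.
Qed.

Section Vectors.
Variable bb : set A.

(* [killed G e]: e is a homomorphism from the quotient of A^r by the rows of G
   and by bb A^r. *)
Definition killed k r (G : 'M[A]_(k, r)) i (e : 'I_r -> E i) :=
  (forall j b, bb b -> b *: e j = 0) /\ forall a, lact G e a = 0.

Definition cocycle k r (G : 'M[A]_(k, r)) i (e : 'I_r -> E i) :=
  killed G e /\ forall j, del i (e j) = 0.

(** The complex Hom(M, E), M the cokernel of G modulo bb, starts in degree 0, where only 0 is a
    coboundary; above, the primitive must itself be a homomorphism from M. *)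
Definition cobound k r (G : 'M[A]_(k, r)) i : ('I_r -> E i) -> Prop :=
  match i with
  | 0 => fun e => forall j, e j = 0
  | i'.+1 => fun e => exists2 y : 'I_r -> E i', killed G y & forall j, e j = del i' (y j)
  end.

End Vectors.

Hypothesis noeth : noetherian A.

(* Syzygies modulo bb: y extends along G iff it is killed by them. *)
Lemma syzygies bb k r (G : 'M[A]_(k, r)) : is_ideal bb ->
  exists k' (G' : 'M[A]_(k', k)),
    (forall a j, bb ((G' *m G) a j)) /\
    forall i (y : 'I_k -> E i), killed bb G' y ->
      exists2 e : 'I_r -> E i, (forall j b, bb b -> b *: e j = 0) & lact G e =1 y.
Proof.
move=> bI; have [b0 bD bM] := bI.
have [|k' [G' G'E]] := noetherian_submod noeth (N := [set a : 'rV_k | forall j, bb ((a *m G) 0 j)]).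
  split=> [j|c u v ub vb j]; first by rewrite mul0mx mxE.
  rewrite mulmxDl -scalemxAl !mxE; apply: bD; last by have := vb j; rewrite mxE.
  by apply: bM; have := ub j; rewrite mxE.
exists k', G'; split=> [a j|i y [yb yG']].
  have /G'E : exists x, row a G' = x *m G' by exists (delta_mx 0 a); rewrite rowE.
  by move=> /(_ j); rewrite -row_mul mxE.
have [|e [eb eG]] := inj_solve (G := G) (y := y) (@Einj i) bI; last by exists e.
move=> a /G'E[c ->]; have := lact_mul (c : 'M_(1, k')) G' y 0.
rewrite {1}/lact => ->; rewrite /lact big1 // => j _; rewrite -/(lact _ _ _).
by rewrite yG' scaler0.
Qed.

Lemma killed_lact bb k' k r (G' : 'M[A]_(k', k)) (G : 'M[A]_(k, r)) i (e : 'I_r -> E i) :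
  (forall a j, bb ((G' *m G) a j)) -> (forall j b, bb b -> b *: e j = 0) ->
  killed bb G' (lact G e).
Proof.
move=> G'G eb; split=> [j b bb_b|a].
  by rewrite /lact scaler_sumr big1 // => l _; rewrite scalerA mulrC -scalerA eb // scaler0.
by rewrite -lact_mul /lact big1 // => j _; rewrite eb.
Qed.

(** Dimension shift from the row module of G to its cokernel: a primitive of the restriction extends
    along G, and subtracting the differential of the extension from e gives a primitive killed by G.
    In degree 0, e itself is one. *)
Lemma cobound_lift bb k' k r (G' : 'M[A]_(k', k)) (G : 'M[A]_(k, r)) i
    (e : 'I_r -> E i) :
  (forall i (y : 'I_k -> E i), killed bb G' y ->
      exists2 e : 'I_r -> E i, (forall j b, bb b -> b *: e j = 0) & lact G e =1 y) ->
  (forall j b, bb b -> b *: e j = 0) ->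
  cobound bb G' (lact G e) -> cobound bb G (fun j => del i (e j)).
Proof.
case: i e => [|i] e lft eb /=; first by exists e.
case=> w /lft[y yb yG] wE; exists (fun j => e j - del i (y j)).
  split=> [j b bb_b|a]; first by rewrite scalerBr eb // -linearZ /= yb // linear0 subrr.
  rewrite lactB wE -lact_del yG subrr //.
by move=> j; rewrite linearB /= deldel subr0.
Qed.

(** Finite generation of Ext^i(M, A), needed for Nakayama: Hom(M, A) is a submodule of A^r, and
    Ext^(i + 1) of M is an image of Ext^i of its syzygy module. *)
Lemma cohomology_fg k r (G : 'M[A]_(k, r)) i :
  exists m (g : 'I_m -> 'I_r -> E i),
    (forall l, cocycle [set 0] G (g l)) /\
    forall e, cocycle [set 0] G e ->
      exists c : 'I_m -> A, cobound [set 0] G (fun j => e j - \sum_l c l *: g l j).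
Proof.
have zI : is_ideal ([set 0] : set A).
  by split=> // [a b -> ->|c a ->]; rewrite ?addr0 ?mulr0.
have z0 i' r' (e : 'I_r' -> E i') : forall j b, [set 0] b -> b *: e j = 0.
  by move=> j _ ->; rewrite scale0r.
elim: i r k G => [|i IH] r k G.
  have [|m [M ME]] := noetherian_submod noeth (N := [set b : 'rV_r | G *m b^T = 0]).
    split=> [|c u v /= ub vb]; first by rewrite /= trmx0 mulmx0.
    by rewrite linearD linearZ /= mulmxDr -scalemxAr ub vb scaler0 addr0.
  have augK (b : 'rV_r) a : lact G (fun j => aug (b 0 j)) a = aug ((G *m b^T) a 0).
    rewrite mxE linear_sum; apply: eq_bigr => j _.
    by rewrite mxE augM.
  exists m, (fun l j => aug (M l j)); split=> [l|e [[_ eG] ed]].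
    split; last by move=> j; apply/ex0; exists (M l j).
    split=> [|a]; first exact: z0.
    have /ME : exists x, row l M = x *m M by exists (delta_mx 0 l); rewrite rowE.
    move=> /= Ml; have := augK (row l M) a; rewrite Ml mxE linear0 => <-.
    by apply: eq_bigr => j _; rewrite mxE.
  have /choice[b bE] j : exists b, e j = aug b by apply/ex0.
  have /ME[c cE] : G *m (\row_j b j)^T = 0.
    apply/matrixP => a j; rewrite ord1; apply: aug_inj; rewrite -augK [in RHS]mxE linear0.
    by rewrite -[RHS](eG a); apply: eq_bigr => j' _; rewrite mxE bE.
  exists (fun l => c 0 l) => j; have := congr1 (fun x : 'rV_r => x 0 j) cE.
  rewrite /= bE mxE => ->; rewrite mxE linear_sum -sumrB big1 // => l _.
  by rewrite augM subrr.
have [k' [G' [G'G lft]]] := syzygies G zI.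
have [m [u [uC uE]]] := IH _ _ G'.
have /choice[y yE] l : exists e : 'I_r -> E i, lact G e =1 u l.
  by case: (uC l) => /lft[e _ eE] _; exists e.
exists m, (fun l j => del i (y l j)); split=> [l|e [[_ eG] ed]].
  split; last by move=> j; exact: deldel.
  split=> [|a]; first exact: z0.
  by rewrite -lact_del yE; case: (uC l) => _ ->.
have /choice[x xE] j : exists x, e j = del i x by apply/exS.
have [|c cE] := uE (lact G x).
  split; first by apply: killed_lact => //; exact: z0.
  move=> j; rewrite lact_del -[RHS](eG j); apply: eq_bigr => j' _; by rewrite xE.
exists c; pose e' j := x j - \sum_l c l *: y l j.
suff -> : (fun j => e j - \sum_l c l *: del i (y l j)) = (fun j => del i (e' j)).
  apply: (cobound_lift (e := e') lft); first exact: z0.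
  suff -> : lact G e' = fun j => lact G x j - \sum_l c l *: u l j by [].
  apply: funext => a; rewrite lactB lact_sum; congr (_ - _).
  by apply: eq_bigr => l _; rewrite yE.
apply: funext => j; rewrite /e' linearB -xE [X in _ = _ - X]linear_sum; congr (_ - _).
by apply: eq_bigr => l _; rewrite linearZ.
Qed.

(** Vanishing below degree t passes from A/bb to all finitely generated A/bb-modules: such a module
    is a quotient of a free one, and the dimension shift trades it for the kernel in a lower
    degree. *)
Lemma cohomology_vanish bb t k r (G : 'M[A]_(k, r)) i (e : 'I_r -> E i) :
  is_ideal bb ->
  (forall i, (i < t)%N -> forall e : 'I_1 -> E i, cocycle bb (0 : 'M_(0, 1)) e ->
     cobound bb (0 : 'M_(0, 1)) e) ->
  (i < t)%N -> cocycle bb G e -> cobound bb G e.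
Proof.
move=> bI bbH; elim: i r k G e => [|i IH] r k G e it [[eb eG] ed] /=.
  move=> j; apply: (bbH _ it (fun=> e j)) ord0.
  by split=> //; split=> [_|[]//]; exact: eb.
have [k' [G' [G'G lft]]] := syzygies G bI.
have /choice[x xE] j : exists x, (forall b, bb b -> b *: x = 0) /\ e j = del i x.
  have [|x [xb _] xE] := bbH _ it (fun=> e j).
    by split=> //; split=> [_|[]//]; exact: eb.
  by exists (x ord0); split; [exact: xb|exact: xE].
have -> : e = fun j => del i (x j) by apply: funext => j; case: (xE j).
have xb j b : bb b -> b *: x j = 0 by case: (xE j) => h _; exact: h.
apply: (cobound_lift lft) => //; apply: IH; first exact: ltnW.
split; first exact: killed_lact.
move=> a; rewrite lact_del -[RHS](eG a); apply: eq_bigr => j _.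
by case: (xE j) => _ <-.
Qed.
End Resolution.

(** * Maximal condition, prime avoidance and socles *)

Section IdealTheory.
Variable A : comNzRingType.
Implicit Types (I J : set A).

(** Without a maximal member, choice builds a strictly increasing chain in P; its union is generated
    by finitely many elements, which already lie in one term. *)
Lemma noetherian_max (hA : noetherian A) (P : set (set A)) J0 :
  (forall J, P J -> is_ideal J) -> P J0 ->
  exists2 J, P J & forall J', P J' -> J `<=` J' -> J' = J.
Proof.
move=> PI PJ0; apply: contrapT => noM.
have step (J : {J | P J}) : exists J' : {J | P J}, sval J `<=` sval J' /\ sval J' <> sval J.
  apply: contrapT => h; apply: noM; exists (sval J); first exact: svalP.
  move=> J' PJ' JJ'; apply: contrapT => ne; apply: h; by exists (exist _ J' PJ').
have [f fE] := choice step.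
pose c k := iter k f (exist _ J0 PJ0).
have cS k l : (k <= l)%N -> sval (c k) `<=` sval (c l).
  elim: l => [|l IH]; first by rewrite leqn0 => /eqP ->.
  rewrite leq_eqVlt => /orP[/eqP -> //|/IH h].
  by apply: subset_trans h _; case: (fE (c l)).
pose U : set A := [set a | exists k, sval (c k) a].
have cI k : is_ideal (sval (c k)) by apply: PI; exact: svalP.
have UI : is_ideal U.
  split; first by exists 0%N; case: (cI 0%N).
  - move=> a b [k ka] [l lb]; exists (maxn k l).
    have [_ h _] := cI (maxn k l); apply: h.
      by apply: cS ka; exact: leq_maxl.
    by apply: cS lb; exact: leq_maxr.
  - by move=> x a [k ka]; exists k; have [_ _ h] := cI k; exact: h.
have [s sU] := hA U UI.
have [k ks] : exists k, forall a, a \in s -> sval (c k) a.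
  have : forall a, a \in s -> U a by move=> a as_; rewrite sU; exact: sub_ideal_gen.
  elim: s {sU} => [|a s IH] h; first by exists 0%N.
  have [|k kE] := IH; first by move=> b bs; apply: h; rewrite inE bs orbT.
  have [l la] : U a by apply: h; rewrite mem_head.
  exists (maxn k l) => b; rewrite inE => /orP[/eqP ->|/kE].
    by apply: cS la; exact: leq_maxr.
  by apply: cS; exact: leq_maxl.
have Uk : U `<=` sval (c k) by rewrite sU => a; apply => // b /= /ks.
have [_] := fE (c k); apply; apply/seteqP; split; last exact: (cS k k.+1).
by move=> a ha; apply: Uk; exists k.+1.
Qed.

Definition colon_ideal I x : set A := [set b | I (b * x)].

Lemma colon_is_ideal I x : is_ideal I -> is_ideal (colon_ideal I x).
Proof.
case=> I0 ID IM; split=> [|a b|c a]; rewrite /colon_ideal /=; first by rewrite mul0r.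
  by rewrite mulrDl; exact: ID.
by rewrite -mulrA; exact: IM.
Qed.

Lemma sub_colon I x : is_ideal I -> I `<=` colon_ideal I x.
Proof. by move=> hI a Ia; exact: (ideal_mulr x hI Ia). Qed.

Definition ideal_addr I x : set A := [set c | exists a b, I a /\ c = a + b * x].

Lemma ideal_addr_ideal I x : is_ideal I -> is_ideal (ideal_addr I x).
Proof.
case=> I0 ID IM; split.
- by exists 0, 0; rewrite mul0r addr0.
- move=> _ _ [a [b [Ia ->]]] [a' [b' [Ia' ->]]]; exists (a + a'), (b + b').
  by split; [exact: ID|rewrite mulrDl addrACA].
- move=> c _ [a [b [Ia ->]]]; exists (c * a), (c * b).
  by split; [exact: IM|rewrite mulrDr mulrA].
Qed.

Lemma sub_ideal_addr I x : I `<=` ideal_addr I x.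
Proof. by move=> a Ia; exists a, 0; rewrite mul0r addr0. Qed.

Lemma mem_ideal_addr I x : is_ideal I -> ideal_addr I x x.
Proof. by case=> I0 _ _; exists 0, 1; rewrite mul1r add0r. Qed.

Definition prop_prime I := ~ I 1 /\ forall a b, I (a * b) -> I a \/ I b.

Lemma prime_avoidance k (p : 'I_k -> set A) I :
  is_ideal I -> (forall i, is_ideal (p i) /\ prop_prime (p i)) ->
  (forall x, I x -> exists i, p i x) -> exists i, I `<=` p i.
Proof.
elim: k p => [|k IH] p hI hp; first by case: (hI) => I0 _ _ /(_ 0 I0)[[]].
move=> cov; apply: contrapT => noi.
have wE (i : 'I_k.+1) : exists x, [/\ I x, p i x & forall j, j != i -> ~ p j x].
  apply: contrapT => h.
  have [||j jE] := IH (fun j => p (lift i j)) hI; last by apply: noi; exists (lift i j).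
    by move=> j; exact: hp.
  move=> x Ix; apply: contrapT => nj; apply: h; exists x; split=> //.
    have [j pj] := cov x Ix; case: (unliftP i j) => [j' jj'|<- //].
    by case: nj; exists j'; rewrite -jj'.
  by move=> j; case: (unliftP i j) => [j' -> _ pj|-> /eqP //]; apply: nj; exists j'.
have [w wP] := choice wE.
case: k => [|k] in p hp cov noi w wP {wE IH} *.
  apply: noi; exists ord0 => x /cov[i]; by rewrite (ord1 i).
(* Each [w i] lies in [p i] and in no other of the primes, so exactly one of the two summands lies
   in any given [p i]: the first for [ord0], the product for the others. *)
pose x := w ord0 + \prod_(i : 'I_k.+1) w (lift ord0 i).
have Iw i : I (w i) by case: (wP i).
have Ix : I x.
  case: (hI) => _ ID IM; apply: ID => //.
  by rewrite big_ord_recl; apply: ideal_mulr.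
have [i pix] := cov x Ix; have [pI [p1 pM]] := hp i.
have prodp (r : seq 'I_k.+1) (f : 'I_k.+1 -> A) : p i (\prod_(j <- r) f j) -> exists j, p i (f j).
  elim: r => [|j r IH]; first by rewrite big_nil.
  by rewrite big_cons => /pM[pj|/IH]; first by exists j.
case: (unliftP ord0 i) => [i' ii'|i0].
  have : p i (w ord0).
    rewrite -[w ord0](addrK (\prod_(i : 'I_k.+1) w (lift ord0 i))) -/x.
    apply: idealB => //; rewrite (bigD1 i') //=; apply: ideal_mulr => //.
    by rewrite -ii'; case: (wP i).
  by case: (wP ord0) => _ _; apply; rewrite ii'.
have [j] : exists j, p i (w (lift ord0 j)).
  apply: (@prodp (index_enum _)); rewrite -[\prod_(_ <- _) _](addKr (w ord0)) -/x addrC.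
  by apply: idealB => //; rewrite i0; case: (wP ord0).
by case: (wP (lift ord0 j)) => _ _; apply; rewrite i0.
Qed.

(* If every element of mm is a zero divisor modulo I, then mm kills a nonzero
   class: the maximal annihilators are finitely many primes. *)
Lemma socle_element (hA : noetherian A) I mm :
  is_ideal I -> is_ideal mm -> ~ I 1 ->
  (forall x, mm x -> exists2 b, ~ I b & I (x * b)) ->
  exists2 s, ~ I s & forall x, mm x -> I (x * s).
Proof.
move=> hI hmm I1 zd; pose P : set (set A) := [set J | exists2 s, ~ I s & J = colon_ideal I s].
have PI J : P J -> is_ideal J by move=> [s _ ->]; exact: colon_is_ideal.
pose mxl J := P J /\ forall J', P J' -> J `<=` J' -> J' = J.
have mxlE s : ~ I s -> exists2 g, mxl (colon_ideal I g) /\ ~ I g & colon_ideal I s `<=` colon_ideal I g.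
  move=> Is; have [||J [[g Ig JE] sJ] Jm] := @noetherian_max hA [set J | P J /\ colon_ideal I s `<=` J] (colon_ideal I s).
  - by move=> J [/PI].
  - by split=> //; exists s.
  exists g; last by rewrite -JE.
  split=> //; split; first by exists g.
  rewrite -JE => J' PJ' JJ'; apply: Jm => //; split=> //; exact: subset_trans JJ'.
have mxl_prime J : mxl J -> prop_prime J.
  move=> [[s Is ->] Jm]; split; first by rewrite /colon_ideal /= mul1r.
  move=> a b; rewrite /colon_ideal /= => Iabs; case: (pselect (I (b * s))) => [|Ibs]; [by right|left].
  rewrite -[_ (a * s)]/(colon_ideal I s a) -(Jm (colon_ideal I (b * s))).
  - by rewrite /colon_ideal /= mulrA.
  - by exists (b * s).
  - move=> c; rewrite /colon_ideal /= => Ics; rewrite mulrCA; by case: hI => _ _; exact.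
(* Finitely many such g generate the ideal spanned by all of them; their colon ideals turn out to be
   all the maximal annihilators. *)
pose G : set A := [set g | mxl (colon_ideal I g) /\ ~ I g].
have [sG sGE] := hA _ (@ideal_gen_ideal A G).
have span_G c : ideal_gen G c -> exists s : seq A, (forall g, g \in s -> G g) /\ ideal_gen [set` s] c.
  move=> /(_ [set c | exists s : seq A, (forall g, g \in s -> G g) /\ ideal_gen [set` s] c]); apply.
    have mono (s s' : seq A) : {subset s <= s'} -> ideal_gen [set` s] `<=` ideal_gen [set` s'].
      by move=> ss' a aS J hJ sJ; apply: aS => // b /= /ss' bs'; exact: sJ.
    split; first by exists [::]; split=> //; case: (@ideal_gen_ideal A [set` [::]]).
    - move=> a b [s [sG' sa]] [s' [s'G sb]]; exists (s ++ s'); split.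
        by move=> g; rewrite mem_cat => /orP[/sG'|/s'G].
      case: (@ideal_gen_ideal A [set` s ++ s']) => _ h _; apply: h.
        by apply: mono sa => g; rewrite mem_cat => ->.
      by apply: mono sb => g; rewrite mem_cat => ->; rewrite orbT.
    - move=> a b [s [sG' sb]]; exists s; split=> //.
      by case: (@ideal_gen_ideal A [set` s]) => _ _; apply.
  move=> g Gg; exists [:: g]; split; first by move=> h; rewrite inE => /eqP ->.
  by apply: sub_ideal_gen; rewrite /= mem_head.
have [s [sP sE]] : exists s : seq A, (forall g, g \in s -> G g) /\ ideal_gen G `<=` ideal_gen [set` s].
  have : forall c, c \in sG -> exists s : seq A, (forall g, g \in s -> G g) /\ ideal_gen [set` s] c.
    by move=> c cs; apply: span_G; rewrite sGE; exact: sub_ideal_gen.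
  rewrite sGE; elim: sG {sGE} => [|c sG IH] h.
    by exists [::]; split=> // a; exact.
  have [|s [sG' sE]] := IH; first by move=> d ds; apply: h; rewrite inE ds orbT.
  have [s' [s'G s'c]] := h c (mem_head _ _); exists (s ++ s'); split.
    by move=> g; rewrite mem_cat => /orP[/sG'|/s'G].
  move=> a; apply; first exact: ideal_gen_ideal.
  have mono (u u' : seq A) : {subset u <= u'} -> ideal_gen [set` u] `<=` ideal_gen [set` u'].
    by move=> uu' a' aS J hJ sJ; apply: aS => // b /= /uu' bs'; exact: sJ.
  move=> b; rewrite /= inE => /orP[/eqP ->|bs].
    by apply: mono s'c => g; rewrite mem_cat => ->; rewrite orbT.
  apply: mono (sE _ _); first by move=> g; rewrite mem_cat => ->.
  exact: sub_ideal_gen.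
have [||i mi] := @prime_avoidance (size s) (fun i => colon_ideal I s`_i) mm hmm; last first.
- exists s`_i => [|x /mi //]; by case: (sP s`_i (mem_nth _ (ltn_ord i))).
- move=> x /zd[b Ib Ixb]; have [g [gm Ig] bg] := mxlE b Ib.
  have [|a gE] := @ideal_gen_seq A s g; first by apply: sE; exact: sub_ideal_gen.
  (* Otherwise pick [c i] in I : s_i outside I : g. As g is a combination of the s_i, the product of
     the [c i] lies in I : g, against primality. Maximality of I : s_i then turns the inclusion into
     an equality. *)
  suff [i iE] : exists i : 'I_(size s), colon_ideal I s`_i `<=` colon_ideal I g.
    exists i; have [_ h] : G s`_i by apply: sP; exact: mem_nth.
    have [[_ im] _] : G s`_i by apply: sP; exact: mem_nth.
    rewrite /= -(im (colon_ideal I g)) //; first exact: bg.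
    by exists g.
  apply: contrapT => nos.
  have cE (i : 'I_(size s)) : exists c, I (c * s`_i) /\ ~ I (c * g).
    apply: contrapT => h; apply: nos; exists i => c; rewrite /colon_ideal /= => Ics.
    by apply: contrapT => Icg; apply: h; exists c.
  have [c cP] := choice cE; have [g1 gM] := mxl_prime _ gm.
  have : ~ colon_ideal I g (\prod_i c i).
    elim/big_ind: _ => // [u v nu nv /gM[]//|i _].
    by case: (cP i).
  apply; rewrite /colon_ideal /= {1}gE mulr_sumr; apply: ideal_sum => // i _.
  rewrite (bigD1 i) //= mulrCA mulrAC mulrA -mulrA.
  case: (hI) => _ _ IM; by apply: IM; apply: ideal_mulr => //; case: (cP i).
- move=> i; split; first exact: colon_is_ideal.
  by apply: mxl_prime; case: (sP s`_i (mem_nth _ (ltn_ord i))).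
Qed.
End IdealTheory.

(** * Ext over a Noetherian local ring of finite injective dimension *)

Section LocalRing.
Variables (A : comNzRingType) (E : nat -> lmodType A) (aug : {linear A^o -> E 0%N})
  (del : forall i, {linear E i -> E i.+1}).
Hypotheses (Einj : forall i, injective_module (E i)) (aug_inj : injective aug)
  (ex0 : forall x, del 0%N x = 0 <-> exists a, x = aug a)
  (exS : forall i x, del i.+1 x = 0 <-> exists y, x = del i y).
Hypothesis noeth : noetherian A.
Variable mm : set A.
Hypotheses (mmI : is_ideal mm) (mm1 : ~ mm 1)
  (mmU : forall a, ~ mm a -> exists b, a * b = 1).
Implicit Types (X I J : set A).

(** A homomorphism from A/X, for an ideal X, is determined by the image of 1, which is an element
    killed by X. *)
Definition ann X i (e : E i) := forall b, X b -> b *: e = 0.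

Definition coc X i (e : E i) := ann X e /\ del i e = 0.

Definition cob X i : E i -> Prop :=
  match i with
  | 0 => fun e => e = 0
  | i'.+1 => fun e => exists2 y : E i', ann X y & e = del i' y
  end.

(* The vanishing of Ext^i(A/I, A). *)
Definition acyc I i := forall e : E i, coc I e -> cob I e.

Lemma ann0 X i : ann X (0 : E i). Proof. by move=> b _; rewrite scaler0. Qed.

Lemma annB X i (e f : E i) : ann X e -> ann X f -> ann X (e - f).
Proof. by move=> h g b Xb; rewrite scalerBr h // g // subrr. Qed.

Lemma annD X i (e f : E i) : ann X e -> ann X f -> ann X (e + f).
Proof. by move=> h g b Xb; rewrite scalerDr h // g // addr0. Qed.

Lemma annZ X i c (e : E i) : ann X e -> ann X (c *: e).
Proof. by move=> h b Xb; rewrite scalerA mulrC -scalerA h // scaler0. Qed.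

Lemma ann_del X i (e : E i) : ann X e -> ann X (del i e).
Proof. by move=> h b Xb; rewrite -linearZ /= h // linear0. Qed.

Lemma annS X Y i (e : E i) : X `<=` Y -> ann Y e -> ann X e.
Proof. by move=> XY h b /XY; exact: h. Qed.

Lemma ann_addr I x i (e : E i) : is_ideal I ->
  ann (ideal_addr I x) e <-> ann I e /\ x *: e = 0.
Proof.
move=> hI; split=> [h|[h xe] _ [a [b [Ia ->]]]].
  split; first by apply: annS h; exact: sub_ideal_addr.
  by apply: h; exact: mem_ideal_addr.
by rewrite scalerDl h // add0r -scalerA xe scaler0.
Qed.

Lemma cob0 X i : cob X (0 : E i).
Proof. by case: i => //= i; exists 0; [exact: ann0|rewrite linear0]. Qed.

Lemma cobD X i (e f : E i) : cob X e -> cob X f -> cob X (e + f).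
Proof.
case: i e f => [|i] e f /=; first by move=> -> ->; rewrite addr0.
by move=> [y hy ->] [z hz ->]; exists (y + z); [exact: annD|rewrite linearD].
Qed.

Lemma cobZ X i c (e : E i) : cob X e -> cob X (c *: e).
Proof.
case: i e => [|i] e /=; first by move=> ->; rewrite scaler0.
by move=> [y hy ->]; exists (c *: y); [exact: annZ|rewrite linearZ].
Qed.

Lemma cobB X i (e f : E i) : cob X e -> cob X f -> cob X (e - f).
Proof. by move=> he hf; apply: cobD => //; rewrite -scaleN1r; exact: cobZ. Qed.

Lemma cob_coc X i (e : E i) : cob X e -> coc X e.
Proof.
case: i e => [|i] e /=; first by move=> ->; split; [exact: ann0|rewrite linear0].
move=> [y hy ->]; split; first exact: ann_del.
exact: (deldel exS).
Qed.

Lemma cobS X Y i (e : E i) : X `<=` Y -> cob Y e -> cob X e.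
Proof. by case: i e => //= i e XY [y hy ->]; exists y => //; exact: annS hy. Qed.

Lemma cocZ X i c (e : E i) : coc X e -> coc X (c *: e).
Proof. by move=> [he de]; split; [exact: annZ|rewrite linearZ /= de scaler0]. Qed.

Lemma cobX0 i (e : E i.+1) : cob [set 0] e <-> exists y, e = del i y.
Proof.
split=> /= [[y _ ->]|[y ->]]; first by exists y.
by exists y => // b ->; rewrite scale0r.
Qed.

(** Multiplication by x embeds A/(I : x) into A/I, and homomorphisms into an injective module extend
    along it. *)
Lemma divide I x i (e : E i) : is_ideal I -> ann (colon_ideal I x) e ->
  exists2 y, ann I y & x *: y = e.
Proof.
move=> hI he.
have [|y [yI yE]] := inj_solve (k := 1) (r := 1) (G := x%:M) (y := fun=> e) (@Einj i) hI.
  move=> a aI; rewrite big_ord1; apply: he; have := aI 0.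
  by rewrite mul_mx_scalar mxE mulrC.
exists (y 0); first exact: yI.
by rewrite -(yE 0) big_ord1 mxE.
Qed.

Lemma ann_mulx I x i (e : E i) : ann I e -> ann (colon_ideal I x) (x *: e).
Proof. by move=> h b Ib; rewrite scalerA h. Qed.

(* The connecting map H^i(A/(I : x)) -> H^(i+1)(A/(I + x)). *)
Lemma cob_connect I x i (y : E i) : is_ideal I -> ann I y ->
  cob (colon_ideal I x) (x *: y) -> cob (ideal_addr I x) (del i y).
Proof.
move=> hI yI h; suff [z zI /= <-] : exists2 z : E i, ann (ideal_addr I x) z & del i z = del i y.
  by exists z.
case: i y yI h => [|i] y yI /=.
  by move=> xy; exists y => //; apply/ann_addr.
move=> [w /(divide hI)[w' w'I <-] wE]; exists (y - del i w'); last first.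
  by rewrite linearB /= (deldel exS) subr0.
apply/ann_addr => //; split; first exact/annB/ann_del.
by rewrite scalerBr wE linearZ subrr.
Qed.

Lemma cohomology_gen I i : is_ideal I -> exists m (g : 'I_m -> E i),
  (forall l, coc I (g l)) /\
  forall e, coc I e -> exists c : 'I_m -> A, cob I (e - \sum_l c l *: g l).
Proof.
move=> hI; have [s sE] := noeth hI.
pose G : 'M[A]_(size s, 1) := \col_l s`_l.
have kE j (e : 'I_1 -> E j) : killed [set 0] G e <-> ann I (e 0).
  split=> [[_ eG] b|h].
    rewrite sE => /ideal_gen_seq[a ->]; rewrite scaler_suml big1 // => l _.
    by have := eG l; rewrite /lact big_ord1 mxE -scalerA => ->; rewrite scaler0.
  split=> [l b ->|l]; first by rewrite scale0r.
  rewrite /lact big_ord1 mxE h // sE; apply: sub_ideal_gen; exact: mem_nth.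
have bE j (e : 'I_1 -> E j) : cobound del [set 0] G e <-> cob I (e 0).
  case: j e => [|j] e /=; first by split=> [->|e0 l] //; rewrite (ord1 l).
  split=> [[y /kE yI yE]|[y yI yE]]; first by exists (y 0).
  by exists (fun=> y) => [|l]; [exact/kE|rewrite (ord1 l)].
have cE j (e : 'I_1 -> E j) : cocycle del [set 0] G e <-> coc I (e 0).
  split=> [[/kE eI ed]|[eI ed]]; first by split.
  by split; [exact/kE|move=> l; rewrite (ord1 l)].
have [m [g [gC gE]]] := cohomology_fg Einj aug_inj ex0 exS noeth G i.
exists m, (fun l => g l 0); split=> [l|e eC]; first exact/cE.
have [c /bE cob_c] := gE (fun=> e) (proj2 (cE _ (fun=> e)) eC).
by exists c.
Qed.

(** The generators of Ext^i(A/I, A) are eliminated one at a time: the last is x times a combination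
    of all of them, and 1 - x c is a unit. *)
Lemma nakayama I i x : is_ideal I -> mm x ->
  (forall e : E i, coc I e -> exists2 e', coc I e' & cob I (e - x *: e')) -> acyc I i.
Proof.
move=> hI mx div_x; have [m [g [gC gE]]] := cohomology_gen i hI.
elim: m g gC gE => [|m IH] g gC gE.
  by move=> e /gE[c]; rewrite big_ord0 subr0.
have [e' /gE[c cE] cob_e] := div_x _ (gC ord_max).
pose u := 1 - x * c ord_max.
have [v uv] : exists v, u * v = 1.
  apply: mmU => mu; apply: mm1; rewrite -[1](subrK (x * c ord_max)) -/u.
  by case: mmI => _ h hM; apply: h => //; rewrite mulrC; exact: hM.
pose widen := widen_ord (leqnSn m).
have gl : cob I (g ord_max - \sum_(l < m) (v * (x * c (widen l))) *: g (widen l)).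
  rewrite [X in cob I X](_ : _ = v *: (g ord_max - x *: e' + x *: (e' - \sum_l c l *: g l))).
    by apply: cobZ; apply: cobD => //; apply: cobZ.
  rewrite big_ord_recr /= -/widen [x *: (e' - _)]scalerBr addrA subrK [x *: (_ + _)]scalerDr.
  rewrite scalerA [_ + (x * _) *: _]addrC opprD addrA.
  rewrite -{2}(scale1r (g ord_max)) -scalerBl -/u scalerBr scalerA mulrC uv scale1r; congr (_ - _).
  by rewrite scalerA scaler_sumr; apply: eq_bigr => l _; rewrite scalerA mulrA.
apply: (IH (fun l => g (widen l))) => [l|e /gE[b bE]]; first exact: gC.
exists (fun l => b (widen l) + b ord_max * (v * (x * c (widen l)))).
rewrite [X in cob I X](_ : _ = (e - \sum_l b l *: g l) +
   b ord_max *: (g ord_max - \sum_(l < m) (v * (x * c (widen l))) *: g (widen l))).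
  by apply: cobD => //; exact: cobZ.
rewrite big_ord_recr /= -/widen scalerBr opprD !addrA subrK scaler_sumr.
rewrite -addrA -opprD -big_split /=.
by congr (_ - _); apply: eq_bigr => l _; rewrite scalerA -scalerDl.
Qed.

Inductive reg_ideal : nat -> set A -> Prop :=
| RegNil : reg_ideal 0 [set 0]
| RegCons t I x : reg_ideal t I -> mm x -> (forall b, I (b * x) -> I b) ->
    reg_ideal t.+1 (ideal_addr I x).

Lemma reg_ideal_ideal t I : reg_ideal t I -> is_ideal I /\ I `<=` mm.
Proof.
have [m0 mD mM] := mmI.
elim=> [|t' J x _ [JI Jm] mx _].
  by split=> [|a ->] //; split=> // [a b -> ->|c a ->]; rewrite ?addr0 ?mulr0.
split; first exact: ideal_addr_ideal.
by move=> _ [a [b [Ja ->]]]; apply: mD; [exact: Jm|exact: mM].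
Qed.

(** A regular element x shifts Ext by one degree: the connecting map sends the generator g to
    [del y], where x y = g. The start is A itself, generated by [aug 1] in degree 0. *)
Lemma reg_cohomology t I : reg_ideal t I ->
  (forall i, i <> t -> acyc I i) /\
  exists g : E t, [/\ coc I g, forall e, coc I e -> exists b, cob I (e - b *: g) &
    forall b, cob I (b *: g) -> I b].
Proof.
elim=> [|t' J x reg_J [Jac [g [gC gG gI]]] mx xJ].
  split=> [[|i] // _ e [_ /exS]|]; first by move=> h; apply/cobX0.
  exists (aug 1); split.
  - by split; [move=> b ->; rewrite scale0r|apply/ex0; exists 1].
  - by move=> e [_ /ex0[b ->]]; exists b; rewrite -(augM aug) mulr1 subrr.
  - by move=> b; rewrite -(augM aug) mulr1 /= -[X in _ = X](linear0 aug) => /aug_inj.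
have [JI Jm] := reg_ideal_ideal reg_J.
have colJ : colon_ideal J x = J.
  by apply/seteqP; split; [exact: xJ|exact: sub_colon].
have torsion b : cob J (x *: (b *: g)) -> b *: g = 0.
  rewrite scalerA => /gI; rewrite mulrC => /xJ; by case: gC => h _; exact: h.
(* A cocycle over J killed by x is a coboundary, as x is regular on H^t(A/J). *)
have lift_d i (e : E i.+1) : coc (ideal_addr J x) e -> exists2 y, ann J y & e = del i y.
  move=> [/(ann_addr _ _ JI)[eJ xe] de].
  case: (i.+1 =P t') => [it|/Jac h]; last by apply: h.
  subst t'; have [b [y yJ yE]] := gG e (conj eJ de).
  exists y => //; apply/eqP; rewrite -subr_eq0 -yE opprB addrCA subrr addr0; apply/eqP.
  apply: torsion; rewrite (_ : x *: (b *: g) = - (x *: (e - b *: g))); last first.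
    by rewrite scalerBr xe sub0r opprK.
  by rewrite yE -scalerN -scaleN1r; do 2 apply: cobZ; exists y.
have xcoc i (e : E i.+1) y : coc (ideal_addr J x) e -> ann J y -> e = del i y -> coc J (x *: y).
  move=> [/(ann_addr _ _ JI)[eJ xe] de] yJ ey; split; first exact: annZ.
  by rewrite linearZ /= -ey.
split=> [[_|i it]|].
- move=> e [/(ann_addr _ _ JI)[eJ xe] de]; case: (0%N =P t') => [t0|/Jac h]; last by apply: h.
  subst t'; have [b /eqP] := gG e (conj eJ de); rewrite subr_eq0 => /eqP eE.
  by rewrite /= eE; apply: torsion; rewrite -eE xe; exact: cob0.
- move=> e eC; have [y yJ ey] := lift_d i e eC.
  rewrite ey; apply: cob_connect => //; rewrite colJ; apply: Jac.
    by move=> h; apply: it; rewrite h.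
  exact: xcoc ey.
have [y yJ yg] : exists2 y, ann J y & x *: y = g.
  by apply: divide => //; rewrite colJ; case: gC.
have xdy : coc (ideal_addr J x) (del t' y).
  split; last exact: (deldel exS).
  apply/ann_addr => //; split; first exact: ann_del.
  by rewrite -linearZ /= yg; case: gC.
exists (del t' y); split=> // [e eC|b].
  have [z zJ ez] := lift_d _ e eC.
  have [b bE] := gG _ (xcoc _ _ _ eC zJ ez); exists b.
  rewrite ez -linearZ -linearB /=; apply: cob_connect => //.
    by apply: annB => //; exact: annZ.
  by rewrite colJ scalerBr scalerA mulrC -scalerA yg.
move=> [v /(ann_addr _ _ JI)[vJ xv] vE].
have [|c cE] := gG (b *: y - v).
  split; first by apply: annB => //; exact: annZ.
  by rewrite linearB linearZ /= vE subrr.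
exists (b - x * c), c; split; last by rewrite mulrC subrK.
apply: gI; have := cobZ x cE.
rewrite !scalerBr xv subr0 scalerA mulrC -scalerA yg scalerBl !scalerA.
by [].
Qed.

Hypothesis Efin : exists d, forall i (x : E i), (d < i)%N -> x = 0.

(** D is the last degree in which some A/I has nonzero Ext; among such I take a maximal one and
    suppose that x in [mm] is outside I. If x is regular on A/I, vanishing in degree D + 1 makes x
    surjective on Ext^D and [nakayama] applies. If not, I : x and I + x are both larger than I, and
    A/I is an extension of their quotients, whose Ext^D vanish. So I is [mm]. *)
Lemma top_degree : exists D, ~ acyc mm D /\
  forall I i, is_ideal I -> (D < i)%N -> acyc I i.
Proof.
have [d dE] := Efin; have [m0 mD mM] := mmI.
have acyc_hi I i : (d < i)%N -> acyc I i.
  by move=> di e _; rewrite (dE _ e di); exact: cob0.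
have [D [[I0 I0I I0D] Dm]] : exists D, (exists2 I, is_ideal I & ~ acyc I D) /\
    forall I i, is_ideal I -> (D < i)%N -> acyc I i.
  have [zI _] := reg_ideal_ideal RegNil.
  pose P i := `[< exists2 I, is_ideal I & ~ acyc I i >].
  have P0 : exists i, P i.
    exists 0%N; apply/asboolP; exists [set 0] => //.
    have [_ [g [gC _ gI]]] := reg_cohomology RegNil.
    move=> /(_ g gC) gb; apply: mm1.
    have : ([set 0] : set A) 1 by apply: gI; rewrite scale1r.
    by move=> /= ->.
  have Pd i : P i -> (i <= d)%N.
    move=> /asboolP[I _ Ii]; rewrite leqNgt; apply/negP => di; apply: Ii.
    exact: acyc_hi.
  have [D PD Dm] := ex_maxnP P0 Pd.
  exists D; split; first exact/asboolP.
  move=> I i hI Di; apply: contrapT => h.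
  by have := Dm i (introT (asboolP _) (ex_intro2 _ _ I hI h)); rewrite leqNgt Di.
exists D; split=> //.
have [|I [hI Iac] Im] := @noetherian_max A noeth [set I | is_ideal I /\ ~ acyc I D] I0 _ (conj I0I I0D).
  by move=> J [].
have I1 : ~ I 1.
  move=> I1; apply: Iac => e [eI _]; rewrite -[e]scale1r eI //; exact: cob0.
have Imm : I `<=` mm.
  move=> a Ia; apply: contrapT => /mmU[b ab]; apply: I1; rewrite -ab; exact: ideal_mulr.
case: (pselect (mm `<=` I)) => [mI|/existsNP[x /not_implyP[mx Ix]]].
  suff -> : mm = I by [].
  by apply/seteqP; split.
case: Iac; have acI' : acyc (ideal_addr I x) D.
  apply: contrapT => h; apply: Ix.
  rewrite -(Im (ideal_addr I x)); first exact: mem_ideal_addr.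
    by split=> //; exact: ideal_addr_ideal.
  exact: sub_ideal_addr.
case: (pselect (colon_ideal I x `<=` I)) => [colI|ncol].
  have colE : colon_ideal I x = I by apply/seteqP; split=> //; exact: sub_colon.
  apply: (nakayama hI mx) => e [eI de].
  have [|z zI ze] := divide (x := x) (e := e) hI; first by rewrite colE.
  have [|z' /(ann_addr _ _ hI)[z'I xz'] zz'] := Dm (ideal_addr I x) D.+1 (ideal_addr_ideal x hI) (ltnSn D) (del D z).
    split; last exact: (deldel exS).
    apply/ann_addr => //; split; first exact: ann_del.
    by rewrite -linearZ /= ze.
  exists (z - z').
    split; first exact: annB.
    by rewrite linearB /= zz' subrr.
  by rewrite scalerBr xz' subr0 ze subrr; exact: cob0.
have accol : acyc (colon_ideal I x) D.
  apply: contrapT => h; apply: ncol; rewrite (Im (colon_ideal I x)) //.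
    by split=> //; exact: colon_is_ideal.
  exact: sub_colon.
move=> e [eI de].
have : cob (colon_ideal I x) (x *: e).
  by apply: accol; split; [exact: ann_mulx|rewrite linearZ /= de scaler0].
case: D e eI de {Dm I0D Im accol} acI' => [|D] e eI de acI' /=.
  by move=> xe; apply: acI'; split=> //; exact/ann_addr.
move=> [w /(divide hI)[w' w'I <-] wE].
have := @cobS I (ideal_addr I x) _ (e - del D w') (sub_ideal_addr _).
case.
  apply: acI'; split; last by rewrite linearB /= de (deldel exS) subr0.
  apply/ann_addr => //; split; first exact/annB/ann_del.
  by rewrite scalerBr wE linearZ subrr.
move=> y yI yE; exists (y + w'); first exact: annD.
by rewrite linearD /= -yE subrK.
Qed.

(* Ext^i(A/mm, A) is concentrated in one degree, where it is cyclic. *)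
Theorem residue_cohomology : exists D (g : E D),
  [/\ forall i, i <> D -> acyc mm i, coc mm g, ~ cob mm g &
      forall e, coc mm e -> exists b, cob mm (e - b *: g)].
Proof.
have [D [mD Dm]] := top_degree.
have [|I [t regI] Im] := @noetherian_max A noeth [set I | exists t, reg_ideal t I] [set 0] _ (ex_intro _ 0%N RegNil).
  by move=> J [t /reg_ideal_ideal[]].
have [hI Imm] := reg_ideal_ideal regI; have I1 : ~ I 1 by move=> /Imm.
(* I is maximal among the ideals of regular sequences, so [mm] consists of zero divisors modulo I.
   Multiplication by the socle element s embeds A/mm into A/I. *)
have [|s Is sE] := socle_element noeth hI mmI I1.
  move=> x mx; apply: contrapT => h.
  have xI b : I (b * x) -> I b.
    by move=> Ib; apply: contrapT => nb; apply: h; exists b => //; rewrite mulrC.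
  have IE : ideal_addr I x = I.
    apply: Im; last exact: sub_ideal_addr.
    by exists t.+1; apply: RegCons.
  by apply: I1; apply: xI; rewrite mul1r -IE; exact: mem_ideal_addr.
have colE : colon_ideal I s = mm.
  apply/seteqP; split=> [b Ibs|b /sE //]; apply: contrapT => /mmU[c bc].
  apply: Is; rewrite -[s]mul1r -bc mulrAC; exact: ideal_mulr.
have [Iac [g [gC gG gI]]] := reg_cohomology regI.
(* Restriction along this embedding is onto in degree D, since the obstruction lies in Ext^(D +
   1)(A/(I + s), A) = 0. *)
have lft (e : E D) : coc mm e -> exists2 z, coc I z & s *: z = e.
  move=> [em de]; have [|z zI ze] := divide (x := s) (e := e) hI; first by rewrite colE.
  have [|z' /(ann_addr _ _ hI)[z'I xz'] zz'] := Dm (ideal_addr I s) D.+1 (ideal_addr_ideal s hI) (ltnSn D) (del D z).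
    split; last exact: (deldel exS).
    apply/ann_addr => //; split; first exact: ann_del.
    by rewrite -linearZ /= ze.
  exists (z - z'); last by rewrite scalerBr xz' subr0.
  by split; [exact: annB|rewrite linearB /= zz' subrr].
have scob i (e : E i) : cob I e -> cob mm (s *: e).
  case: i e => [|i] e /=; first by move=> ->; rewrite scaler0.
  move=> [y yI ->]; exists (s *: y); last by rewrite linearZ.
  by rewrite -colE; exact: ann_mulx.
(* A nonzero class of A/mm in degree D comes from A/I, whose Ext vanishes outside degree t. *)
have tD : t = D.
  apply: contrapT => tD; apply: mD => e /lft[z zC <-]; apply: scob.
  by apply: Iac zC => Dt; apply: tD.
subst t; exists D, (s *: g).
have gen e : coc mm e -> exists b, cob mm (e - b *: (s *: g)).
  move=> /lft[z /gG[b bE] <-]; exists b.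
  by rewrite scalerA mulrC -scalerA -scalerBr; exact: scob.
split=> //.
(* Above D every Ext vanishes. Below D = t the Ext of A/I vanishes, and A/mm is a finitely generated
   A/I-module. *)
- move=> i iD; have [Di|Di] := ltnP D i; first exact: Dm.
  have {Di}iD : (i < D)%N by rewrite ltn_neqAle Di andbT; apply/eqP.
  have [s' sE'] := noeth mmI; pose G : 'M[A]_(size s', 1) := \col_l s'`_l.
  move=> e [em de].
  have kE j (y : 'I_1 -> E j) : killed I G y <-> ann mm (y 0).
    split=> [[_ yG] b|h].
      rewrite sE' => /ideal_gen_seq[a ->]; rewrite scaler_suml big1 // => l _.
      by have := yG l; rewrite /lact big_ord1 mxE -scalerA => ->; rewrite scaler0.
    split=> [l b /Imm|l]; first by rewrite (ord1 l); exact: h.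
    rewrite /lact big_ord1 mxE h // sE'; apply: sub_ideal_gen; exact: mem_nth.
  have kE0 j (y : 'I_1 -> E j) : killed I (0 : 'M_(0, 1)) y <-> ann I (y 0).
    split=> [[yI _]|h]; first exact: yI.
    by split=> [l b|[]//]; rewrite (ord1 l); exact: h.
  have : cobound del I G (fun=> e).
    apply: (cohomology_vanish Einj exS noeth (t := D) hI) => // [j jD y [/kE0 yI yd]|].
      have := Iac j _ (y 0) (conj yI (yd 0)).
      case: j jD y yI yd => [|j] jD y yI yd /=.
        by move=> h l; rewrite (ord1 l); apply: h => jD'; rewrite -jD' in jD.
      move=> [|z zI zE]; first by move=> jD'; rewrite -jD' ltnn in jD.
      by exists (fun=> z) => [|l]; [exact/kE0|rewrite (ord1 l)].
    by split=> //; exact/kE.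
  case: i e em de {iD} => [|i] e em de /=; first by move/(_ 0).
  by move=> [y /kE ym yE]; exists (y 0).
- by split; [rewrite -colE; apply: ann_mulx; case: gC|rewrite linearZ /=; case: gC => _ ->; rewrite scaler0].
- move=> gcob; apply: mD => e /gen[b bE]; rewrite -[e](subrK (b *: (s *: g))).
  by apply: cobD => //; exact: cobZ.
Qed.
End LocalRing.

(** * Gorenstein complexes *)

Section OriginRing.
Variables (K : fieldType) (n : nat).
Local Notation S := {mpoly K[n]}.
Variables (D : {set {set 'I_n}}) (A : comNzRingType) (phi : {rmorphism S -> A}).
Implicit Types (p q a f s : S) (b : A) (t F G : {set 'I_n}) (u v w : 'I_n).

(* phi exhibits A as the local ring at the origin of the quotient of S by
   [face_ideal D]. *)
Hypotheses (dD : down_closed D) (D0 : finset.set0 \in D)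
  (phi_unit : forall s, s@_0%MM != 0 -> exists b, phi s * b = 1)
  (phi_frac : forall b, exists a s, s@_0%MM != 0 /\ b * phi s = phi a)
  (phi_ker : forall a, phi a = 0 <-> face_ideal D a).

Definition loc_prime t : set A :=
  [set b | exists a s, [/\ s@_0%MM != 0, face_prime t a & b * phi s = phi a]].

Lemma face_prime_const t s : face_prime t s -> s@_0%MM = 0.
Proof. by apply; rewrite powersetE mvars0 finset.sub0set. Qed.

Lemma phi_eq p q : phi p = phi q <-> face_ideal D (p - q).
Proof.
rewrite -phi_ker rmorphB /=; split=> [->|/eqP]; first by rewrite subrr.
by rewrite subr_eq0 => /eqP.
Qed.

Lemma face_ideal_prime t : t \in D -> face_ideal (K := K) D `<=` face_prime t.
Proof.
move=> tD; apply: face_idealS; apply/fintype.subsetP => t'; rewrite powersetE.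
exact: dD.
Qed.

Lemma mcoeff0M p q : (p * q)@_0%MM = p@_0%MM * q@_0%MM.
Proof. exact: rmorphM. Qed.

Lemma one_const : (1 : S)@_0%MM != 0.
Proof. by rewrite mcoeff1 eqxx oner_neq0. Qed.

Lemma loc_prime_ideal t : is_ideal (loc_prime t).
Proof.
have [[I0 ID IM] _ _] := face_prime_prime K t; split.
- by exists 0, 1; split; [exact: one_const|exact: I0|by rewrite rmorph0 mul0r].
- move=> b b' [a [s [s0 at_ bE]]] [a' [s' [s'0 a't b'E]]].
  exists (a * s' + a' * s), (s * s'); split.
  + by rewrite mcoeff0M mulf_neq0.
  + by apply: ID; rewrite mulrC; exact: IM.
  + by rewrite rmorphD !rmorphM /= -bE -b'E; ring.
- move=> c b [a [s [s0 at_ bE]]]; have [a' [s' [s'0 cE]]] := phi_frac c.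
  exists (a' * a), (s' * s); split; first by rewrite mcoeff0M mulf_neq0.
    exact: IM.
  by rewrite !rmorphM /= -cE -bE; ring.
Qed.

Lemma phi_loc_prime t a : face_prime t a -> loc_prime t (phi a).
Proof. by move=> at_; exists a, 1; split; [exact: one_const| |rewrite rmorph1 mulr1]. Qed.

Lemma loc_primeE t p : t \in D -> loc_prime t (phi p) -> face_prime t p.
Proof.
move=> tD [a [s [s0 at_]]]; rewrite -rmorphM => /phi_eq /(face_ideal_prime tD) h.
have [[_ ID _] _ pM] := face_prime_prime K t.
have : face_prime t (p * s) by rewrite -[p * s](subrK a); exact: ID.
by case/pM => // /face_prime_const /eqP; rewrite (negbTE s0).
Qed.

Definition mm := loc_prime finset.set0.

Lemma mm1 : ~ mm 1.
Proof.
rewrite -(rmorph1 phi) => /(loc_primeE D0)/face_prime_const/eqP.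
exact/negP/one_const.
Qed.

Lemma const_face_prime a : a@_0%MM = 0 -> face_prime finset.set0 a.
Proof.
move=> a0 m; rewrite powersetE finset.subset0 => /eqP m0.
suff -> : m = 0%MM by [].
apply/mnmP => i; rewrite mnm0E; apply/eqP/negPn/negP => mi.
have : i \in mvars m by rewrite inE.
by rewrite m0 finset.in_set0.
Qed.

Lemma mmU b : ~ mm b -> exists c, b * c = 1.
Proof.
move=> bm; have [a [s [s0 bE]]] := phi_frac b.
have [/eqP a0|a0] := boolP (a@_0%MM == 0).
  by case: bm; exists a, s; split=> //; exact: const_face_prime.
have [c cE] := phi_unit a0; exists (phi s * c); by rewrite mulrA bE.
Qed.

Lemma phiX_mm v : mm (phi 'X_v).
Proof.
apply: phi_loc_prime; apply: const_face_prime.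
by rewrite mcoeffX mnm1_eq0.
Qed.

(** x_v is regular modulo the prime of a face containing v. With [loc_prime_addr] this is the exact
    sequence that links t to t \ v. *)
Lemma loc_prime_colon t v : t \in D -> v \in t ->
  colon_ideal (loc_prime t) (phi 'X_v) = loc_prime t.
Proof.
move=> tD vt; apply/seteqP; split; last by apply: sub_colon; exact: loc_prime_ideal.
move=> b [a [s [s0 at_ bE]]]; have [a' [s' [s'0 b'E]]] := phi_frac b.
exists a', s'; split=> //.
have [[_ ID IM] _ pM] := face_prime_prime K t.
have : face_prime t (a' * ('X_v * s)).
  rewrite -[_ * _](subrK (a * s')); apply: ID; last by rewrite mulrC; exact: IM.
  apply: (face_ideal_prime tD); apply/phi_eq.
  by rewrite !rmorphM /= -b'E -bE; ring.
case/pM => // /pM[/face_primeX|/face_prime_const /eqP]; last by rewrite (negbTE s0).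
by rewrite mvars1 finset.sub1set vt.
Qed.

Lemma loc_prime_addr t v : v \in t ->
  ideal_addr (loc_prime t) (phi 'X_v) = loc_prime (t :\ v)%SET.
Proof.
move=> vt; have hI := loc_prime_ideal (t :\ v)%SET; apply/seteqP; split.
  move=> _ [a [b [[c [s [s0 ct aE]]] ->]]]; case: (hI) => _ ID IM; apply: ID.
    exists c, s; split=> //; move: c ct {aE}; apply: (iffRL (face_prime_subset _ _ _)).
    exact: finset.subsetDl.
  apply: IM; apply: phi_loc_prime; apply/face_primeX.
  by rewrite mvars1 finset.sub1set !inE eqxx.
move=> b [a [s [s0 at_ bE]]]; have [c cE] := phi_unit s0.
have [a1 [a2 [a1t aE]]] : ideal_addr (face_prime t) ('X_v : S) a.
  apply: (ideal_sub_face (I := ideal_addr (face_prime t) ('X_v : S)) (@powerset_down n (t :\ v)%SET) _ _ at_).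
    by apply: ideal_addr_ideal; case: (face_prime_prime K t).
  move=> t'; rewrite powersetE => t't; case: (boolP (v \in t')) => vt'.
    rewrite (smonD1 vt') mpolyXD mulrC; exists 0, 'X_[smon (t' :\ v)%SET].
    by rewrite add0r; split=> //; case: (face_prime_prime K t) => -[].
  apply: sub_ideal_addr; apply/face_primeX; rewrite mvars_smon.
  apply: contra t't => t't; apply/fintype.subsetP => x xt'; rewrite !inE.
  rewrite (fintype.subsetP t't _ xt') andbT; by apply: contraNneq vt' => <-.
exists (phi a1 * c), (phi a2 * c); split.
  by apply: ideal_mulr; [exact: loc_prime_ideal|exact: phi_loc_prime].
rewrite -[b]mulr1 -cE mulrA bE aE rmorphD rmorphM /=; ring.
Qed.

Lemma ann_loc_prime (E : nat -> lmodType A) t i (e : E i) :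
  ann (loc_prime t) e <-> forall u, u \notin t -> phi 'X_u *: e = 0.
Proof.
split=> [h u ut|h b [a [s [s0 at_ bE]]]].
  by apply: h; apply: phi_loc_prime; apply/face_primeX; rewrite mvars1 finset.sub1set.
have [c cE] := phi_unit s0.
suff /= ae : phi a *: e = 0.
  by rewrite -[b]mulr1 -cE mulrA bE mulrC -scalerA ae scaler0.
apply: (ideal_sub_face (I := [set a | phi a *: e = 0]) (@powerset_down n t) _ _ at_).
  split=> [|x y /= xe ye|x y /= ye]; first by rewrite /= rmorph0 scale0r.
    by rewrite rmorphD scalerDl xe ye addr0.
  by rewrite rmorphM -scalerA ye scaler0.
move=> t'; rewrite powersetE => /fintype.subsetPn[u ut' ut] /=.
by rewrite (smonD1 ut') mpolyXD mulrC rmorphM -scalerA h // scaler0.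
Qed.

End OriginRing.

(** * Connecting maps between the Ext modules of the face primes *)

Section Residue.
Variables (K : fieldType) (n : nat).
Local Notation S := {mpoly K[n]}.
Variables (D : {set {set 'I_n}}) (A : comNzRingType) (phi : {rmorphism S -> A}).
Hypotheses (dD : down_closed D) (D0 : finset.set0 \in D)
  (phi_unit : forall s, s@_0%MM != 0 -> exists b, phi s * b = 1)
  (phi_frac : forall b, exists a s, s@_0%MM != 0 /\ b * phi s = phi a)
  (phi_ker : forall a, phi a = 0 <-> face_ideal D a).
Variables (E : nat -> lmodType A) (aug : {linear A^o -> E 0%N})
  (del : forall i, {linear E i -> E i.+1}).
Hypotheses (Einj : forall i, injective_module (E i)) (aug_inj : injective aug)
  (ex0 : forall x, del 0%N x = 0 <-> exists a, x = aug a)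
  (exS : forall i x, del i.+1 x = 0 <-> exists y, x = del i y).
Hypothesis noeth : noetherian A.
Local Notation Q := (loc_prime phi).
Local Notation mm := (loc_prime phi finset.set0).
Local Notation xv v := (phi 'X_v).
Variables (dp : nat) (g : forall i, E i).
Hypotheses (mac : forall i, i <> dp -> acyc del mm i)
  (gC : coc del mm (g dp)) (gN : ~ cob del mm (g dp))
  (gG : forall e : E dp, coc del mm e -> exists b, cob del mm (e - b *: g dp)).
Implicit Types (t : {set 'I_n}) (v : 'I_n) (s : seq 'I_n) (p : S).

Lemma deldel0 i (x : E i) : del i.+1 (del i x) = 0.
Proof. exact: (deldel exS). Qed.

Lemma Q_ideal t : is_ideal (Q t).
Proof. exact: loc_prime_ideal. Qed.

Lemma ann_set t i (e : E i) : ann (Q t) e <-> forall u, u \notin t -> xv u *: e = 0.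
Proof. exact: ann_loc_prime. Qed.

Lemma ann_sub t t' i (e : E i) : t' \subset t -> ann (Q t') e -> ann (Q t) e.
Proof.
move=> /fintype.subsetP tt' /ann_set h; apply/ann_set => u ut; apply: h.
by apply: contra ut; exact: tt'.
Qed.

Lemma coc_sub t t' i (e : E i) : t' \subset t -> coc del (Q t') e -> coc del (Q t) e.
Proof. by move=> tt' [et ed]; split=> //; exact: ann_sub et. Qed.

Lemma ann_setD1 t v i (e : E i) : v \in t ->
  ann (Q (t :\ v)%SET) e <-> ann (Q t) e /\ xv v *: e = 0.
Proof.
move=> vt; rewrite -(loc_prime_addr phi_unit phi_frac vt).
exact/ann_addr/Q_ideal.
Qed.

Lemma Xdiv t v i (e : E i) : t \in D -> v \in t -> ann (Q t) e ->
  exists2 y, ann (Q t) y & xv v *: y = e.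
Proof.
move=> tD vt et; apply: (divide Einj (Q_ideal t)).
by rewrite (loc_prime_colon dD phi_frac phi_ker tD vt).
Qed.

Lemma coc_del t v i (y : E i) : v \in t -> ann (Q t) y -> del i (xv v *: y) = 0 ->
  coc del (Q (t :\ v)%SET) (del i y).
Proof.
move=> vt yt dy; split; last exact: deldel0.
by apply/ann_setD1 => //; split; [exact: ann_del|rewrite -linearZ].
Qed.

(** Induction on #|t|: degree i + 1 for t \ v has the same sum, so its Ext vanishes, x_v acts
    surjectively on Ext^i(A/Q_t, A), and [nakayama] applies. *)
Lemma face_acyc t i : t \in D -> (i + #|t|)%N <> dp -> acyc del (Q t) i.
Proof.
elim: {t}_.+1 {-2}t i (ltnSn #|t|) => // k IH t i; rewrite ltnS => tk tD idp.
have [t0|[v vt]] := set_0Vmem t.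
  by rewrite t0; apply: mac; rewrite -[i]addn0 -(cards0 'I_n) -t0.
have := nakayama Einj aug_inj ex0 exS noeth (loc_prime_ideal phi_frac finset.set0) (mm1 dD D0 phi_ker)
  (mmU phi_unit phi_frac) (Q_ideal t) (phiX_mm phi v).
apply=> e [et ed]; have [y yt ye] := Xdiv tD vt et.
have ct : #|t| = #|(t :\ v)%SET|.+1 by rewrite (cardsD1 v) vt.
have [||||z zt zE] := IH (t :\ v)%SET i.+1 _ _ _ (del i y).
- by rewrite -ltnS -ct.
- by apply: dD tD _; exact: finset.subsetDl.
- by rewrite addSn -addnS -ct.
- by apply: coc_del => //; rewrite ye.
move/(ann_setD1 _ vt): zt => [zt Xz]; exists (y - z).
  by split; [exact: annB|rewrite linearB /= zE subrr].
by rewrite scalerBr ye Xz subr0 subrr; exact: cob0.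
Qed.

(** The coordinate of a class of Ext^dp(A/mm, A) along g; constants of S serve as scalars because
    A/mm is K. *)
Definition lam i (e : E i) : K := xget 0 [set k | cob del mm (e - phi k%:MP *: g i)].

Lemma lam_eq (e : E dp) k : cob del mm (e - phi k%:MP *: g dp) -> lam e = k.
Proof.
move=> ek; rewrite /lam; case: xgetP => [k' _ /= ek'|/(_ k)//].
apply/eqP/negPn/negP => kk'; apply: gN.
have [|c cE] := phi_unit (s := (k' - k)%:MP).
  by rewrite mcoeffC eqxx mulr1 subr_eq0.
rewrite -[g dp]scale1r -cE mulrC -scalerA; apply: cobZ.
rewrite [X in cob _ _ X](_ : _ = (e - phi k%:MP *: g dp) - (e - phi k'%:MP *: g dp)).
  exact: cobB.
by rewrite mpolyCB rmorphB scalerBl opprB [RHS]addrC addrA subrK.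
Qed.

Lemma lam_ex (e : E dp) : coc del mm e -> cob del mm (e - phi (lam e)%:MP *: g dp).
Proof.
move=> /gG[b bE]; have [a [s [s0 baE]]] := phi_frac b.
pose k := a@_0%MM / s@_0%MM.
suff ek : cob del mm (e - phi k%:MP *: g dp) by rewrite (lam_eq ek).
rewrite [X in cob _ _ X](_ : _ = (e - b *: g dp) + (b - phi k%:MP) *: g dp); last first.
  by rewrite scalerBl addrA subrK.
apply: cobD => //; case: gC => gm _; rewrite gm; first exact: cob0.
exists (a - k%:MP * s), s; split=> //.
  apply: const_face_prime; rewrite mcoeffB mcoeffCM /k -mulrA mulVf ?mulr1 ?subrr //.
by rewrite mulrBl baE [RHS]rmorphB (rmorphM phi _ s).
Qed.

Lemma phiC_mm p : mm (phi p - phi (p@_0%MM)%:MP).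
Proof.
rewrite -rmorphB; apply: phi_loc_prime; apply: const_face_prime.
by rewrite mcoeffB mcoeffC eqxx mulr1 subrr.
Qed.

(* The iterated connecting map Ext^i(A/Q_s, A) -> Ext^dp(A/mm, A) = K that
   removes the vertices of s one after the other. *)
Fixpoint kap s i (e : E i) {struct s} : K :=
  match s with
  | [::] => lam e
  | v :: s' => kap s' (del i (xget 0 [set y | ann (Q [set x in v :: s']%SET) y /\ xv v *: y = e]))
  end.

Local Notation st s := [set x in s]%SET.

Lemma st_cons v s : uniq (v :: s) -> (st (v :: s) :\ v)%SET = st s.
Proof.
move=> /= /andP[vs _]; apply/setP => x; rewrite !inE.
by case: eqP => //= ->; rewrite (negbTE vs).
Qed.

Lemma card_st s : uniq s -> #|st s| = size s.
Proof. by move=> us; rewrite cardsE; apply/card_uniqP. Qed.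

Definition kap_linear s i := [/\
  forall e e' : E i, coc del (Q (st s)) e -> coc del (Q (st s)) e' -> kap s (e + e') = kap s e + kap s e',
  forall p (e : E i), coc del (Q (st s)) e -> kap s (phi p *: e) = p@_0%MM * kap s e &
  forall e : E i, cob del (Q (st s)) e -> kap s e = 0].

(** The choice of quotient by x_v made in [kap] does not matter: two of them differ by an element
    killed by x_v, whose differential is a coboundary for the smaller face. *)
Lemma kap_linear_indep v s i (y y' : E i) : uniq (v :: s) -> kap_linear s i.+1 ->
  ann (Q (st (v :: s))) y -> ann (Q (st (v :: s))) y' ->
  del i (xv v *: y) = 0 -> xv v *: y = xv v *: y' -> kap s (del i y) = kap s (del i y').
Proof.
move=> us [ka kb kc] yt y't dy yy'.
have vs : v \in st (v :: s) by rewrite !inE eqxx.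
have yC : coc del (Q (st s)) (del i y') by rewrite -(st_cons us); apply: coc_del => //; rewrite -yy'.
have dC : cob del (Q (st s)) (del i y - del i y').
  exists (y - y'); last by rewrite linearB.
  rewrite -(st_cons us); apply/ann_setD1 => //; split; first exact: annB.
  by rewrite scalerBr yy' subrr.
rewrite -[del i y](subrK (del i y')) ka //; first by rewrite (kc _ dC) add0r.
exact: (cob_coc exS).
Qed.

Lemma kap_consE v s i (y : E i) : uniq (v :: s) -> kap_linear s i.+1 ->
  ann (Q (st (v :: s))) y -> del i (xv v *: y) = 0 ->
  kap (v :: s) (xv v *: y) = kap s (del i y).
Proof.
move=> us ks yt dy /=; case: xgetP => [z _ [zt zy]|/(_ y)/= h]; last by case: h.
by apply: (kap_linear_indep us ks zt yt _ zy); rewrite zy.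
Qed.

Lemma kap_lin s i : uniq s -> st s \in D -> (i + size s)%N = dp -> kap_linear s i.
Proof.
elim: s i => [|v s IH] i us sD ip.
  have E0 : st ([::] : seq 'I_n) = finset.set0 by apply/setP => x; rewrite !inE.
  move: ip; rewrite addn0 => ip; subst i; rewrite /kap_linear E0; split=> /=.
  - move=> e e' eC e'C; apply: lam_eq.
    rewrite mpolyCD rmorphD scalerDl opprD addrACA.
    by apply: cobD; exact: lam_ex.
  - move=> p e eC; apply: lam_eq; rewrite mpolyCM rmorphM -scalerA.
    rewrite [X in cob _ _ X](_ : _ = phi p *: (e - phi (lam e)%:MP *: g dp) +
       (phi p - phi (p@_0%MM)%:MP) *: (phi (lam e)%:MP *: g dp)); last first.
      by rewrite scalerBr scalerBl addrA subrK.
    apply: cobD; first by apply: cobZ; exact: lam_ex.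
    rewrite (annZ (phi (lam e)%:MP) (proj1 gC)); first exact: cob0.
    exact: phiC_mm.
  - by move=> e eC; apply: lam_eq; rewrite mpolyC0 rmorph0 scale0r subr0.
have vs : v \in st (v :: s) by rewrite !inE eqxx.
have us' : uniq s by case/andP: us.
have sD' : st s \in D by apply: dD sD _; rewrite -(st_cons us) finset.subsetDl.
have ks : kap_linear s i.+1 by apply: IH => //; rewrite addSnnS.
have [ka kb kc] := ks.
have lft (e : E i) : coc del (Q (st (v :: s))) e -> exists y, [/\ ann (Q (st (v :: s))) y, xv v *: y = e,
    coc del (Q (st s)) (del i y) & kap (v :: s) e = kap s (del i y)].
  move=> [et ed]; have [y yt ye] := Xdiv sD vs et; exists y; split=> //.
    by rewrite -(st_cons us); apply: coc_del => //; rewrite ye.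
  by rewrite -ye kap_consE // ye.
split.
- move=> e e' eC e'C; have [y [yt ye yC ->]] := lft e eC; have [y' [y't y'e y'C ->]] := lft e' e'C.
  rewrite -ka // -linearD -ye -y'e -scalerDr kap_consE //; first exact: annD.
  by rewrite scalerDr ye y'e linearD /= (proj2 eC) (proj2 e'C) addr0.
- move=> p e eC; have [y [yt ye yC ->]] := lft e eC.
  rewrite -kb // -linearZ -ye scalerA mulrC -scalerA kap_consE //; first exact: annZ.
  by rewrite scalerA mulrC -scalerA ye linearZ /= (proj2 eC) scaler0.
- case: i ks ka kb kc lft {ip} => [|i] ks ka kb kc lft e; rewrite [cob _ _ _]/=.
    move=> ->; have k0 : kap (v :: s) (xv v *: (0 : E 0%N)) = kap s (del 0%N 0).
      by apply: kap_consE => //; [exact: ann0|rewrite scaler0 linear0].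
    by rewrite scaler0 linear0 in k0; rewrite k0; apply: kc; exact: cob0.
  move=> [y yt ->]; have [q qt <-] := Xdiv sD vs yt.
  have dq : del i (xv v *: q) = xv v *: del i q by rewrite linearZ.
  rewrite dq kap_consE //.
  + by rewrite deldel0; apply: kc; exact: cob0.
  + exact: ann_del.
  + by rewrite -dq deldel0.
Qed.

Lemma st_sub v s : uniq (v :: s) -> st s \subset st (v :: s).
Proof. by move=> us; rewrite -(st_cons us) finset.subsetDl. Qed.

Lemma acyc_up s v i : uniq (v :: s) -> st (v :: s) \in D -> (i + size (v :: s))%N = dp ->
  acyc del (Q (st (v :: s))) i.+1.
Proof.
move=> us sD ip; apply: face_acyc => //; rewrite card_st // addSn -ip => /esym.
exact: n_Sn.
Qed.

(** With [kap_surj], this makes [kap] the coordinate on Ext^i(A/Q_s, A) modulo the maximal ideal. A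
    relation found for the smaller face lifts, because its classes become coboundaries over the
    larger one, whose next Ext vanishes. *)
Lemma kap_ker s i (e : E i) : uniq s -> st s \in D -> (i + size s)%N = dp ->
  coc del (Q (st s)) e -> kap s e = 0 ->
  exists y : 'I_n -> E i, (forall v, coc del (Q (st s)) (y v)) /\
    cob del (Q (st s)) (e - \sum_(v in st s) xv v *: y v).
Proof.
elim: s i e => [|v s IH] i e us sD ip eC.
  have E0 : st ([::] : seq 'I_n) = finset.set0 by apply/setP => x; rewrite !inE.
  rewrite E0 in eC *; rewrite addn0 in ip; subst i => /= e0.
  exists (fun=> 0); rewrite big_set0 subr0; split; first by move=> v; apply: (cob_coc exS); exact: cob0.
  by have := lam_ex eC; rewrite e0 mpolyC0 rmorph0 scale0r subr0.
have vs : v \in st (v :: s) by rewrite !inE eqxx.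
have us' : uniq s by case/andP: us.
have sD' : st s \in D by apply: dD sD _; exact: st_sub.
have ip' : (i.+1 + size s)%N = dp by rewrite addSnnS.
have ks := kap_lin us' sD' ip'.
case: (eC) => et ed; have [z zt ze] := Xdiv sD vs et.
rewrite -ze kap_consE ?ze // => kz.
have [|y' [y'C [w wt wE]]] := IH _ (del i z) us' sD' ip' _ kz.
  by rewrite -(st_cons us); apply: coc_del => //; rewrite ze.
have /choice[u uE] x : exists u, ann (Q (st (v :: s))) u /\ y' x = del i u.
  have [|u] := acyc_up us sD ip (e := y' x); last by exists u.
  by apply: coc_sub (y'C x); exact: st_sub.
have xu x : xv v *: y' x = 0.
  by move: (y'C x) => [+ _]; rewrite -(st_cons us) => /(ann_setD1 _ vs)[].
have xw : ann (Q (st (v :: s))) w /\ xv v *: w = 0.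
  by move: wt; rewrite -(st_cons us) => /(ann_setD1 _ vs).
pose y0 := z - \sum_(x in st s) xv x *: u x - w.
have y0C : coc del (Q (st (v :: s))) y0.
  split.
    apply: annB; last by case: xw.
    apply: annB => //; apply: big_ind => [|a b|x _]; [exact: ann0|exact: annD|].
    by apply: annZ; case: (uE x).
  rewrite !linearB /= linear_sum /= -wE; apply/eqP; rewrite subr_eq0; apply/eqP; congr (_ - _).
  by apply: eq_bigr => x _; rewrite linearZ /=; case: (uE x) => _ ->.
exists (fun x => if x == v then y0 else xv v *: u x); split=> [x|].
  case: eqP => // _; split; first by apply: annZ; case: (uE x).
  by rewrite linearZ /=; case: (uE x) => _ <-.
rewrite (bigD1 v) //= eqxx.
have -> : \sum_(x in st (v :: s) | x != v) xv x *: (if x == v then y0 else xv v *: u x) =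
          xv v *: \sum_(x in st s) xv x *: u x.
  rewrite scaler_sumr; apply: eq_big => x.
    rewrite !inE; case: eqP => [->|]; last by rewrite orFb andbT.
    by case/andP: us => /negbTE ->; rewrite andbF.
  by move=> /andP[_ /negbTE ->]; rewrite !scalerA mulrC.
rewrite -scalerDr /y0 addrAC subrK scalerBr (proj2 xw) subr0 ze subrr; exact: cob0.
Qed.

(** Each connecting map involved is onto, since the next Ext of the larger face vanishes by
    [face_acyc]. *)
Lemma kap_surj s i : uniq s -> st s \in D -> (i + size s)%N = dp ->
  exists e : E i, coc del (Q (st s)) e /\ kap s e != 0.
Proof.
elim: s i => [|v s IH] i us sD ip.
  have E0 : st ([::] : seq 'I_n) = finset.set0 by apply/setP => x; rewrite !inE.
  rewrite E0; rewrite addn0 in ip; subst i => /=; exists (g dp); split=> //.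
  rewrite (_ : lam (g dp) = 1) ?oner_neq0 //; apply: lam_eq.
  by rewrite mpolyC1 rmorph1 scale1r subrr; exact: cob0.
have vs : v \in st (v :: s) by rewrite !inE eqxx.
have us' : uniq s by case/andP: us.
have sD' : st s \in D by apply: dD sD _; exact: st_sub.
have ip' : (i.+1 + size s)%N = dp by rewrite addSnnS.
have [e [eC ke]] := IH _ us' sD' ip'.
have [|y yt ey] := acyc_up us sD ip (e := e).
  by apply: coc_sub eC; exact: st_sub.
have xe : xv v *: e = 0.
  by move: eC => [+ _]; rewrite -(st_cons us) => /(ann_setD1 _ vs)[].
have dxy : del i (xv v *: y) = 0 by rewrite linearZ /= -ey.
exists (xv v *: y); split; first by split; [exact: annZ|].
by rewrite kap_consE // -?ey //; exact: kap_lin.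
Qed.

Local Notation ltord := (fun u w : 'I_n => (u < w)%N).

(** The connecting maps of two vertices anticommute, so removing v first costs one sign for every
    smaller vertex of s. *)
Lemma kap_sign s v i (y : E i) : sorted ltord s -> st s \in D -> (i + size s)%N = dp ->
  v \in s -> ann (Q (st s)) y -> del i (xv v *: y) = 0 ->
  kap s (xv v *: y) = sgn K v (st s) * kap (rem v s) (del i y).
Proof.
elim: s v i y => // v0 s IH v i y ss sD ip vs0 yt dy.
have us : uniq (v0 :: s).
  apply: sorted_uniq ss => [a b c|a]; [exact: ltn_trans|exact: ltnn].
have v0s : v0 \in st (v0 :: s) by rewrite !inE eqxx.
have us' : uniq s by case/andP: us.
have ss' : sorted ltord s by apply: path_sorted ss.
have v0m u : u \in s -> (v0 < u)%N.
  move: ss; rewrite /= path_sortedE; last by move=> a b c; exact: ltn_trans.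
  by case/andP => /allP h _; exact: h.
have sD' : st s \in D by apply: dD sD _; exact: st_sub.
have ip' : (i.+1 + size s)%N = dp by rewrite addSnnS.
have ks := kap_lin us' sD' ip'.
have [vv0|vv0] := eqVneq v v0.
  rewrite vv0 in dy *; rewrite kap_consE // sgn_min ?mul1r ?[rem _ _]/= ?eqxx //.
  by move=> u; rewrite !inE => /orP[/eqP -> //|/v0m/ltnW].
have vs : v \in s by move: vs0; rewrite inE (negbTE vv0).
have vst : v \in st (v0 :: s) by rewrite !inE vs orbT.
have [q qt qy] := Xdiv sD v0s yt.
(* Both routes start from e = x_v0 x_v q. *)
have dxq : del i (xv v0 *: (xv v *: q)) = 0 by rewrite scalerA mulrC -scalerA qy.
have -> : kap (v0 :: s) (xv v *: y) = kap s (xv v *: del i q).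
  by rewrite -qy scalerA mulrC -scalerA kap_consE //; [rewrite linearZ|exact: annZ].
have -> : sgn K v (st (v0 :: s)) = - sgn K v (st s).
  rewrite (_ : st (v0 :: s) = (v0 |: st s)%SET); last by apply/setP => x; rewrite !inE.
  by rewrite sgnU1 ?v0m //; case/andP: us; rewrite inE.
have -> : rem v (v0 :: s) = v0 :: rem v s by rewrite /= eq_sym (negbTE vv0).
have remE : st (rem v s) = (st s :\ v)%SET.
  by apply/setP => x; rewrite !inE mem_rem_uniq // !inE.
have usr : uniq (v0 :: rem v s).
  rewrite /= rem_uniq // andbT mem_rem_uniq // inE negb_and.
  by case/andP: us => ->; rewrite orbT.
have remE0 : st (v0 :: rem v s) = (st (v0 :: s) :\ v)%SET.
  apply/setP => x; rewrite !inE mem_rem_uniq // !inE.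
  by case: eqP => [->|]; rewrite ?(negbTE vv0) //= eq_sym (negbTE vv0).
have srD : st (rem v s) \in D by rewrite remE; apply: dD sD' _; exact: finset.subsetDl.
have s0D : st (v0 :: rem v s) \in D by rewrite remE0; apply: dD sD _; exact: finset.subsetDl.
have szr : size s = (size (rem v s)).+1 by rewrite size_rem // prednK //; case: (s) vs.
have ipr : (i.+2 + size (rem v s))%N = dp by rewrite addSn -addnS -szr.
have kr := kap_lin (rem_uniq v us') srD ipr.
have cq0 : coc del (Q (st s)) (xv v *: del i q).
  rewrite -(st_cons us) -linearZ; apply: coc_del => //; exact: annZ.
have vss : v \in st s by rewrite inE.
have [w wt wE] := Xdiv sD' vss (proj1 cq0).
have cq1 : coc del (Q (st (v0 :: rem v s))) (xv v0 *: del i q).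
  rewrite remE0 -linearZ /= qy; exact: coc_del.
have [w' w't w'E] : exists2 w', ann (Q (st (v0 :: rem v s))) w' & xv v0 *: w' = xv v0 *: del i q.
  by apply: Xdiv => //; [rewrite !inE eqxx|case: cq1].
rewrite -wE IH //; last by rewrite linearZ /= -[X in X = 0]linearZ wE; case: cq0.
have dw' : del i.+1 (xv v0 *: w') = 0 by rewrite w'E; case: cq1.
have -> : del i y = xv v0 *: w' by rewrite w'E -qy linearZ.
rewrite kap_consE // mulNr -mulrN; congr (_ * _).
have dwC : coc del (Q (st (rem v s))) (del i.+1 w).
  rewrite remE; apply: coc_del => //.
  by rewrite wE; case: cq0.
have dw'C : coc del (Q (st (rem v s))) (del i.+1 w').
  rewrite -(st_cons usr); apply: coc_del => //; by rewrite !inE eqxx.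
(* The primitive w + w' - del q is killed by both variables: x_v w = x_v del q and x_v0 w' = x_v0
   del q, while x_v w' = 0 and x_v0 w = 0. *)
case: kr => ka _ kc; apply/eqP; rewrite -addr_eq0 -ka //; apply/eqP/kc.
exists (w + w' - del i q); last by rewrite linearB linearD /= deldel0 subr0.
rewrite -(st_cons usr); apply/ann_setD1; first by rewrite !inE eqxx.
have at1 : ann (Q (st (v0 :: s))) (w + w' - del i q).
  apply: annB; last exact: ann_del.
  apply: annD; first by apply: ann_sub wt; exact: st_sub.
  by apply: ann_sub w't; rewrite remE0; exact: finset.subsetDl.
split.
  rewrite remE0; apply/ann_setD1 => //; split=> //.
  rewrite scalerBr scalerDr wE.
  by move: w't; rewrite remE0 => /(ann_setD1 _ vst)[_ ->]; rewrite addr0 subrr.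
rewrite scalerBr scalerDr w'E.
by move: wt; rewrite -(st_cons us) => /(ann_setD1 _ v0s)[_ ->]; rewrite add0r subrr.
Qed.

Lemma sorted_enum t : sorted ltord (enum t).
Proof.
rewrite /enum_mem; apply: sorted_filter => [a b c|]; first exact: ltn_trans.
by rewrite -enumT; have := iota_ltn_sorted 0 n; rewrite -val_enum_ord sorted_map.
Qed.

Lemma rem_enum t v : rem v (enum t) = enum (t :\ v)%SET.
Proof.
rewrite rem_filter ?enum_uniq // /enum_mem -filter_predI; apply: eq_filter => x.
by rewrite /= !inE.
Qed.

(** * Homomorphisms from the quotients by facet primes *)

Implicit Types (F : {set 'I_n}).

(** For such t, x_t is a nonzero element of A killed by P_F, that is, a nonzero homomorphism A/P_F
    -> A. [kills] is the annihilation condition for arbitrary polynomials. *)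
Definition separates F t := t \in D /\ forall u, u \notin F -> (u |: t)%SET \notin D.

Definition kills F p := forall u, u \notin F -> face_ideal D ('X_u * p).

(** The iterated connecting map on Hom(A/P_F, A) = Ext^0; for a facet F it ends in degree #|F| =
    dp. *)
Definition kf (F : {set 'I_n}) p : K := kap (enum F) (aug (phi p)).

Let DI : is_ideal (face_ideal (K := K) D).
Proof. exact: face_ideal_ideal. Qed.

Lemma aug_eq0 b : aug b = 0 -> b = 0.
Proof. by rewrite -(linear0 aug) => /aug_inj. Qed.

Let phiM p q : phi (p * q) = phi p * phi q. Proof. exact: rmorphM. Qed.

Lemma aug_phiM p q : aug (phi (p * q)) = phi p *: aug (phi q).
Proof. by rewrite rmorphM -[_ * _]/(phi p *: (phi q : A^o)) linearZ. Qed.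

Lemma kills_coc F p : kills F p -> coc del (Q F) (aug (phi p)).
Proof.
move=> Fp; split; last by apply/ex0; exists (phi p).
apply/ann_set => u /Fp /phi_ker Xp; rewrite -aug_phiM Xp; exact: linear0.
Qed.

Lemma kills_ideal F p : face_ideal D p -> kills F p.
Proof. by move=> pI u _; case: DI => _ _; exact. Qed.

Lemma killsM F p q : kills F q -> kills F (p * q).
Proof. by move=> Fq u /Fq; rewrite mulrCA; case: DI => _ _; exact. Qed.

Lemma killsD F p q : kills F p -> kills F q -> kills F (p + q).
Proof. by move=> Fp Fq u uF; rewrite mulrDr; case: DI => _ h _; apply: h; auto. Qed.

Lemma kills_sep F p m : kills F p -> p@_m != 0 -> mvars m \in D -> separates F (mvars m).
Proof.
move=> Fp pm mD; split=> // u uF; apply: contra pm => umD; apply/eqP.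
have := Fp u uF (U_(u) + m)%MM; rewrite mvarsD mvars1 => /(_ umD).
by rewrite mcoeffMU mnmDE mnm1E eqxx /= addmC addmK.
Qed.

Lemma sep_kills F m : separates F (mvars m) -> kills F 'X_[m].
Proof.
move=> [_ h] u uF; rewrite -mpolyXD; apply/face_idealX.
by rewrite mvarsD mvars1; exact: h.
Qed.

(** x_F is a nonzero element of Hom(A/P_F, A) = Ext^0(A/P_F, A), which [face_acyc] allows only if 0
    + #|F| = dp. *)
Lemma facet_card F : F \in facets D -> #|F| = dp.
Proof.
move=> /mem_facets[FD Fm]; apply/eqP/negPn/negP => /eqP Fdp.
have FC : coc del (Q F) (aug (phi 'X_[smon F])).
  apply: kills_coc; apply: sep_kills; rewrite mvars_smon; split=> // u uF.
  apply: contra uF => uD; rewrite -(Fm _ uD (finset.subsetUr _ _)).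
  by rewrite !inE eqxx.
have /aug_eq0/phi_ker/face_idealX := face_acyc (i := 0) FD Fdp FC.
by rewrite mvars_smon FD.
Qed.

Section Facet.
Variable F : {set 'I_n}.
Hypothesis FD : F \in facets D.

Let FD' : F \in D. Proof. by have /mem_facets[] := FD. Qed.

Let kF : kap_linear (enum F) 0.
Proof.
apply: kap_lin; rewrite ?enum_uniq ?finset.set_enum // add0n -cardE.
exact: facet_card.
Qed.

Lemma kfD p q : kills F p -> kills F q -> kf F (p + q) = kf F p + kf F q.
Proof.
move=> Fp Fq; case: kF; rewrite finset.set_enum => ka _ _.
by rewrite /kf !rmorphD linearD /= ka //; exact: kills_coc.
Qed.

Lemma kfM p q : kills F q -> kf F (p * q) = p@_0%MM * kf F q.
Proof.
move=> Fq; case: kF; rewrite finset.set_enum => _ kb _.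
by rewrite /kf aug_phiM kb //; exact: kills_coc.
Qed.

Lemma kfI p : face_ideal D p -> kf F p = 0.
Proof.
move=> /phi_ker p0; case: kF; rewrite finset.set_enum => _ _ kc.
by rewrite /kf p0 linear0; apply: kc.
Qed.

Lemma kf_expand p (x : K) m0 : kills F p ->
  (forall m, p@_m != 0 -> kf F 'X_[m] = if m == m0 then x else 0) ->
  kf F p = p@_m0 * x.
Proof.
move=> Fp hm.
have FX m : p@_m != 0 -> kills F 'X_[m].
  move=> pm; case: (boolP (mvars m \in D)) => mD.
    by apply: sep_kills; exact: kills_sep pm mD.
  by apply: kills_ideal; exact/face_idealX.
have : forall r : seq 'X_{1..n}, {subset r <= msupp p} ->
    kills F (\sum_(m <- r) p@_m *: 'X_[m]) /\
    kf F (\sum_(m <- r) p@_m *: 'X_[m]) = \sum_(m <- r) p@_m * kf F 'X_[m].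
  elim=> [|m r IH] rp.
    rewrite !big_nil; have z0 : face_ideal D (0 : S) by case: DI.
    by split; [exact: kills_ideal|exact: kfI].
  have [|kr kE] := IH; first by move=> m' m'r; apply: rp; rewrite inE m'r orbT.
  have pm : p@_m != 0 by rewrite -mcoeff_msupp rp // mem_head.
  have km : kills F (p@_m *: 'X_[m]) by rewrite -mul_mpolyC; apply: killsM; exact: FX.
  rewrite !big_cons; split; first exact: killsD.
  rewrite kfD // kE -mul_mpolyC kfM ?mcoeffC ?eqxx ?mulr1 //; exact: FX.
move=> /(_ _ (fun _ h => h))[_]; rewrite -mpolyE => ->.
have [m0p|m0p] := boolP (m0 \in msupp p); last first.
  rewrite (memN_msupp_eq0 m0p) mul0r big_seq big1 // => m mp.
  rewrite hm -?mcoeff_msupp //; case: eqP => [mm0|]; last by rewrite mulr0.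
  by rewrite mm0 (negbTE m0p) in mp.
rewrite (bigD1_seq m0) //= hm -?mcoeff_msupp // eqxx big_seq_cond big1 ?addr0 //.
by move=> m /andP[mp /negbTE mm0]; rewrite hm -?mcoeff_msupp // mm0 mulr0.
Qed.

Lemma kf_smon m : kills F 'X_[smon (mvars m)] -> kf F 'X_[m] != 0 -> m = smon (mvars m).
Proof.
move=> km; rewrite -{1}(submK (lem_smon m)) mpolyXD kfM // mcoeffX.
case: ((m - smon (mvars m))%MM =P 0%MM) => [m0 _|_]; last by rewrite mul0r eqxx.
by rewrite -[LHS](submK (lem_smon m)) m0 add0m.
Qed.

(** As [kap] is onto, some fraction has a nonzero value, hence so does a monomial of its numerator.
    That monomial is squarefree, because variables act as 0 on values. *)
Lemma ex_generator : exists2 t, separates F t & kf F 'X_[smon t] != 0.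
Proof.
have [|||e [eC ke]] := @kap_surj (enum F) 0; rewrite ?enum_uniq ?finset.set_enum //.
  by rewrite add0n -cardE; exact: facet_card.
rewrite finset.set_enum in eC; case: (eC) => et /ex0[b eb].
have [a [s [s0 bE]]] := phi_frac b.
have ea : aug (phi a) = phi s *: e by rewrite -bE mulrC -[_ * _]/(phi s *: (b : A^o)) linearZ eb.
have Fa : kills F a.
  move=> u uF; apply/phi_ker; apply: aug_eq0; rewrite aug_phiM ea scalerA mulrC -scalerA.
  by move/ann_set: et => /(_ u uF) ->; rewrite scaler0.
have ka : kf F a != 0.
  case: kF; rewrite finset.set_enum => _ kb _.
  by rewrite /kf ea kb // mulf_neq0.
have [m pm km] : exists2 m, a@_m != 0 & kf F 'X_[m] != 0.
  apply: contrapT => h; case/negP: ka; apply/eqP.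
  rewrite (kf_expand (x := 0) (m0 := 0%MM)) ?mulr0 // => m am.
  rewrite if_same; apply/eqP/negPn/negP => km; apply: h; by exists m.
have mD : mvars m \in D.
  by apply/negPn/negP => mD; rewrite kfI ?eqxx // in km; exact/face_idealX.
have sm := kills_sep Fa pm mD.
exists (mvars m) => //; rewrite -kf_smon //.
by apply: sep_kills; rewrite mvars_smon.
Qed.

(** This is [kap_ker] in degree 0, with the denominators cleared by their product s. *)
Lemma kf_eq0 p : kills F p -> kf F p = 0 ->
  exists (s : S) (a : 'I_n -> S), [/\ s@_0%MM != 0, forall v, kills F (a v) &
    face_ideal D (s * p - \sum_(v in F) 'X_v * a v)].
Proof.
move=> Fp kp.
have [|||||y [yC yE]] := @kap_ker (enum F) 0 (aug (phi p)).
- exact: enum_uniq.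
- by rewrite finset.set_enum.
- by rewrite add0n -cardE; exact: facet_card.
- by rewrite finset.set_enum; exact: kills_coc.
- exact: kp.
rewrite finset.set_enum in yC; rewrite /= finset.set_enum in yE.
have /choice[b bE] v : exists b, y v = aug b by apply/ex0; case: (yC v).
have /choice[f fE] v : exists f : S * S, f.2@_0%MM != 0 /\ b v * phi f.2 = phi f.1.
  by have [a [s h]] := phi_frac (b v); exists (a, s).
pose s := \prod_v (f v).2.
have /choice[a aE] v : exists a, phi a = phi s * b v.
  exists ((f v).1 * \prod_(w | w != v) (f w).2).
  have -> : s = (f v).2 * \prod_(w | w != v) (f w).2 by rewrite /s (bigD1 v).
  rewrite !phiM -(proj2 (fE v)); ring.
exists s, a; split.
- rewrite /s; elim/big_ind: _ => [|p' q' h h'|v _]; first exact: one_const.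
    by rewrite mcoeff0M mulf_neq0.
  by case: (fE v).
- move=> v u uF; apply/phi_ker; apply: aug_eq0; rewrite aug_phiM aE.
  rewrite -[_ * b v]/(phi s *: (b v : A^o)) linearZ -bE scalerA mulrC -scalerA.
  by case: (yC v) => /ann_set/(_ u uF) -> _; rewrite scaler0.
- apply/phi_ker; rewrite rmorphB rmorphM rmorph_sum /=; apply/eqP; rewrite subr_eq0; apply/eqP.
  have -> : phi p = \sum_(v in F) phi 'X_v * b v.
    apply: aug_inj; rewrite linear_sum; apply/eqP; rewrite -subr_eq0; apply/eqP.
    rewrite -[RHS]yE; congr (_ - _); apply: eq_bigr => v _.
    by rewrite -[_ * _]/(phi 'X_v *: (b v : A^o)) linearZ bE.
  rewrite mulr_sumr; apply: eq_bigr => v _.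
  by rewrite phiM aE mulrCA.
Qed.

(** Let t0 be a generator and t an inclusion-minimal separator. Then x_t - c x_t0 has value 0 for a
    suitable c, so a multiple by some s with s(0) <> 0 is a sum of x_v a_v with a_v in Hom(A/P_F,
    A). If t0 were not inside t, the coefficient at x_t would be s(0) on the left; on the right it
    would give a separator t \ v, against minimality. *)
Lemma ex_min_separator : exists t,
  [/\ separates F t, kf F 'X_[smon t] != 0 & forall t', separates F t' -> t \subset t'].
Proof.
have [t0 st0 kt0] := ex_generator.
have tmin t : separates F t -> (forall t', t' \subset t -> separates F t' -> t' = t) -> t0 \subset t.
  move=> st tm; apply/negPn/negP => t0t.
  have Ft m : separates F m -> kills F 'X_[smon m] by move=> sm; apply: sep_kills; rewrite mvars_smon.
  pose c := kf F 'X_[smon t] / kf F 'X_[smon t0].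
  have [|| s [a [s0 Fa h]]] := @kf_eq0 ('X_[smon t] + (- c)%:MP * 'X_[smon t0]).
  - by apply: killsD; [exact: Ft|apply: killsM; exact: Ft].
  - rewrite kfD; [|exact: Ft|by apply: killsM; exact: Ft].
    rewrite kfM; last exact: Ft.
    by rewrite mcoeffC eqxx mulr1 mulNr /c divfK // subrr.
  have := h (smon t); rewrite mvars_smon; case: (st) => tD _ /(_ tD).
  rewrite mcoeffB raddf_sum big1 => [|v vF]; last first.
    rewrite /= mcoeffMU smonE; case: (boolP (v \in t)) => //= vt.
    have -> : (smon t - U_(v))%MM = smon (t :\ v)%SET by rewrite (smonD1 vt) addmC addmK.
    apply: contrapT => /eqP ne; have := kills_sep (Fa v) ne; rewrite mvars_smon.
    move=> /(_ (dD tD (finset.subD1set _ _)))/tm => /(_ (finset.subD1set _ _)) tv.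
    by have := vt; rewrite -tv !inE eqxx.
  rewrite subr0 mulrDr mulrA mcoeffD -{1}[smon t]addm0 mcoeffMX.
  have -> : (s * (- c)%:MP * 'X_[smon t0])@_(smon t) = 0.
    have : face_prime t (s * (- c)%:MP * 'X_[smon t0] : S).
      by apply/face_primeM; right; apply/face_primeX; rewrite mvars_smon.
    by apply; rewrite powersetE mvars_smon.
  by rewrite addr0 => /eqP; rewrite (negbTE s0).
exists t0; split=> // t' st'.
have [t /minsetP[/asboolP st tm] tt'] := @minset_exists _ (fun t => `[< separates F t >]) t' (introT (asboolP _) st').
apply: fintype.subset_trans tt'; apply: tmin => // t'' t''t st''; apply: tm => //.
exact/asboolP.
Qed.

Lemma kf_coef t p : separates F t -> kf F 'X_[smon t] != 0 ->
  (forall t', separates F t' -> t \subset t') -> kills F p ->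
  kf F p = p@_(smon t) * kf F 'X_[smon t].
Proof.
move=> st kt tm Fp; apply: kf_expand => // m pm.
case: eqP => [-> //|ne]; apply/eqP/negPn/negP => km; apply: ne.
have mD : mvars m \in D.
  by apply/negPn/negP => mD; rewrite kfI ?eqxx // in km; exact/face_idealX.
have tsub := tm _ (kills_sep Fp pm mD).
have tm' : (smon t <= m)%MM.
  apply: lepm_trans (lem_smon m); apply/mnm_lepP => i; rewrite !smonE.
  by case: (boolP (i \in t)) => // /(fintype.subsetP tsub) ->.
move: km; rewrite -{1}(submK tm') mpolyXD kfM ?mcoeffX; last by apply: sep_kills; rewrite mvars_smon.
case: ((m - smon t)%MM =P 0%MM) => [m0 _|_]; last by rewrite mul0r eqxx.
by rewrite -[LHS](submK tm') m0 add0m.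
Qed.

End Facet.

(* The generator of Ext^1(A/Q_t, A), Q_t of codimension one, dies over both
   facets F and G through t; the difference of two primitives is an element of
   A which compares the generators of Hom(A/Q_F, A) and Hom(A/Q_G, A). *)
Lemma ridge t v w : v \notin t -> w \notin t -> v != w ->
  (v |: t)%SET \in facets D -> (w |: t)%SET \in facets D ->
  exists (f : S) (k : K), [/\ k != 0, kills (v |: t)%SET ('X_v * f) /\ kills (w |: t)%SET ('X_w * f),
    kf (v |: t)%SET ('X_v * f) = sgn K v t * k, kf (w |: t)%SET ('X_w * f) = - (sgn K w t * k) &
    forall u, u \notin (v |: t)%SET -> u \notin (w |: t)%SET -> face_ideal D ('X_u * f)].
Proof.
move=> vt wt vw Fv Fw.
have dpE u : u \notin t -> (u |: t)%SET \in facets D -> (1 + #|t|)%N = dp.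
  by move=> ut /facet_card; rewrite cardsU1 ut.
have tD : t \in D.
  by case/mem_facets: Fv => h _; apply: dD h _; exact: finset.subsetUr.
have [|||e [eC ke]] := @kap_surj (enum t) 1%N; rewrite ?enum_uniq ?finset.set_enum //.
  by rewrite -cardE (dpE v).
rewrite finset.set_enum in eC; case: (eC) => et de.
have prim u : u \notin t -> (u |: t)%SET \in facets D ->
    exists y : E 0%N, [/\ ann (Q (u |: t)%SET) y, e = del 0%N y & 
      forall s : S, kap (enum (u |: t)%SET) (xv u *: (phi s *: y)) = s@_0%MM * (sgn K u t * kap (enum t) e)].
  move=> ut Fu; have uD : (u |: t)%SET \in D by case/mem_facets: Fu.
  have [||y yt ye] := @face_acyc (u |: t)%SET 1 uD _ e.
  - by rewrite facet_card // add1n => /esym; exact: n_Sn.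
  - by apply: coc_sub eC; exact: finset.subsetUr.
  exists y; split=> // s; have xe : xv u *: e = 0 by move/ann_set: et; apply.
  have dy : del 0%N (xv u *: y) = 0 by rewrite linearZ /= -ye.
  have kl : kap_linear (enum (u |: t)%SET) 0.
    by apply: kap_lin; rewrite ?enum_uniq ?finset.set_enum // -cardE add0n; exact: facet_card.
  case: kl; rewrite finset.set_enum => _ kb _.
  rewrite scalerA mulrC -scalerA kb; last by split=> //; exact: annZ.
  rewrite kap_sign ?sorted_enum ?finset.set_enum ?mem_enum ?inE ?eqxx // -?cardE ?add0n ?facet_card //.
  rewrite rem_enum -ye finset.setU1K //; congr (_ * (_ * _)).
  by rewrite sgnU1 // ltnn.
have [y [yF ye yk]] := prim v vt Fv; have [y' [y'F y'e y'k]] := prim w wt Fw.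
have [b bE] : exists b, y - y' = aug b by apply/ex0; rewrite linearB /= -ye -y'e subrr.
have [f [s [s0 fE]]] := phi_frac b.
have fy : aug (phi f) = phi s *: y - phi s *: y'.
  by rewrite -scalerBr bE -linearZ -fE mulrC.
have Xk u F (z : E 0%N) : u \notin F -> ann (Q F) z -> xv u *: (phi s *: z) = 0.
  by move=> uF /ann_set h; rewrite scalerA mulrC -scalerA h // scaler0.
have wv : w \notin (v |: t)%SET by rewrite !inE negb_or eq_sym vw.
have vw' : v \notin (w |: t)%SET by rewrite !inE negb_or vw.
(* v is outside the other facet, so x_v kills y' and isolates the primitive y; likewise x_w isolates
   y'. *)
have Xv : aug (phi ('X_v * f)) = xv v *: (phi s *: y).
  by rewrite aug_phiM fy scalerBr (Xk v _ y' vw' y'F) subr0.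
have Xw : aug (phi ('X_w * f)) = - (xv w *: (phi s *: y')).
  by rewrite aug_phiM fy scalerBr (Xk w _ y wv yF) sub0r.
have scalC a b' (z : E 0%N) : a *: (b' *: z) = b' *: (a *: z) by rewrite !scalerA mulrC.
have kill F p : (forall u, u \notin F -> xv u *: aug (phi p) = 0) -> kills F p.
  by move=> h u uF; apply/phi_ker; apply: aug_eq0; rewrite aug_phiM h.
have kw : kills (w |: t)%SET ('X_w * f).
  apply: kill => u uF; rewrite Xw scalerN scalC.
  by rewrite (Xk u _ y' uF y'F) scaler0 oppr0.
exists f, (s@_0%MM * kap (enum t) e); split=> //.
- by rewrite mulf_neq0.
- split=> //; apply: kill => u uF; rewrite Xv scalerA mulrC -scalerA.
  by rewrite (Xk u _ y uF yF) scaler0.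
- by rewrite /kf Xv yk mulrCA.
- rewrite /kf Xw -scaleN1r -(rmorphN1 phi).
  have kl : kap_linear (enum (w |: t)%SET) 0.
    apply: kap_lin; rewrite ?enum_uniq ?finset.set_enum // -?cardE ?add0n; last exact: facet_card.
    by case/mem_facets: Fw.
  case: kl; rewrite finset.set_enum => _ kb _; rewrite kb.
    by rewrite mcoeffN mcoeff1 eqxx mulN1r y'k mulrCA.
  have := kills_coc kw; rewrite Xw => /(cocZ (-1)); by rewrite scaleN1r opprK.
- move=> u uv uw; apply/phi_ker; apply: aug_eq0.
  by rewrite aug_phiM fy scalerBr (Xk u _ y uv yF) (Xk u _ y' uw y'F) subrr.
Qed.

(** [T F] is the least separator of F and [c F] the value of [kf F] on its monomial. By [kf_coef],
    the two values in [ridge] are [c] times single coefficients of the same f; comparing them across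
    the ridge matches the separators and makes the signed values cancel. *)
Lemma gorenstein_facets : exists (T : {set 'I_n} -> {set 'I_n}) (c : {set 'I_n} -> K),
  (forall F, F \in facets D -> [/\ #|F| = dp, separates F (T F), c F != 0 &
     forall t, separates F t -> T F \subset t]) /\
  forall t v w, v \notin t -> w \notin t -> v != w ->
    (v |: t)%SET \in facets D -> (w |: t)%SET \in facets D ->
    [/\ v \in T (v |: t)%SET, (T (v |: t) :\ v = T (w |: t) :\ w)%SET,
      sgn K v t * c (v |: t)%SET + sgn K w t * c (w |: t)%SET = 0 &
      forall u, u != v -> u != w -> u \notin t -> (u |: t)%SET \notin D].
Proof.
have /choice[T TE] F : exists t, F \in facets D -> [/\ separates F t, kf F 'X_[smon t] != 0 &
    forall t', separates F t' -> t \subset t'].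
  case: (boolP (F \in facets D)) => FD; last by exists finset.set0.
  by have [t h] := ex_min_separator FD; exists t.
exists T, (fun F => kf F 'X_[smon (T F)]); split=> [F FD|t v w vt wt vw Fv Fw].
  by have [? ? ?] := TE F FD; split=> //; exact: facet_card.
have [f [k [k0 [kv kw] ev ew hu]]] := ridge vt wt vw Fv Fw.
have [sv cv mv] := TE _ Fv; have [sw cw mw] := TE _ Fw.
rewrite (kf_coef Fv sv cv mv kv) in ev; rewrite (kf_coef Fw sw cw mw kw) in ew.
have sk0 u : sgn K u t * k != 0 by rewrite mulf_neq0 // sgn_neq0.
rewrite !mcoeffMU !smonE in ev ew.
have vT : v \in T (v |: t)%SET.
  by apply/negPn/negP => h; move: ev; rewrite (negbTE h) /= mul0r => /esym/eqP; rewrite (negbTE (sk0 v)).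
have wT : w \in T (w |: t)%SET.
  apply/negPn/negP => h; move: ew; rewrite (negbTE h) /= mul0r => /esym/eqP.
  by rewrite oppr_eq0 (negbTE (sk0 w)).
have smB (s : {set 'I_n}) u : u \in s -> (smon s - U_(u))%MM = smon (s :\ u)%SET.
  by move=> us; rewrite (smonD1 us) addmC addmK.
rewrite vT wT /= !smB // in ev ew.
have fv : f@_(smon (T (v |: t) :\ v)%SET) != 0.
  by apply: contraNneq (sk0 v) => h; rewrite -ev h mul0r.
have fw : f@_(smon (T (w |: t) :\ w)%SET) != 0.
  by apply: contraNneq (sk0 w) => h; rewrite -oppr_eq0 -ew h mul0r.
have sub_t u : u \notin t -> (u |: t)%SET \in facets D -> (T (u |: t) :\ u \subset t)%SET.
  move=> ut Fu; have [[TD sT] _ _] := TE _ Fu.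
  apply/fintype.subsetP => x; rewrite !inE => /andP[xu xT]; apply/negPn/negP => xt.
  have /sT : x \notin (u |: t)%SET by rewrite !inE negb_or xu.
  by rewrite (finset.setUidPr _) ?TD // finset.sub1set.
(* A monomial of f divisible neither by v nor by w separates both facets. *)
have cmp u (a : {set 'I_n}) : (u |: t)%SET \in facets D -> u \notin t -> kills (u |: t)%SET ('X_u * f) ->
    (forall t', separates (u |: t)%SET t' -> T (u |: t)%SET \subset t') ->
    a \subset t -> f@_(smon a) != 0 -> (T (u |: t) :\ u \subset a)%SET.
  move=> Fu ut ku mu at_ fa.
  have ua : u \notin a by apply: contra ut; exact: (fintype.subsetP at_).
  have /mu Ta : separates (u |: t)%SET (u |: a)%SET.
    rewrite -(mvars_smon (u |: a)%SET); apply: (kills_sep ku).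
      by rewrite smonU // mcoeffMU mnmDE mnm1E eqxx /= addmC addmK.
    rewrite mvars_smon; case/mem_facets: Fu => uD _; apply: dD uD _; exact: finset.setUS.
  by rewrite finset.subDset.
have TT : (T (v |: t) :\ v = T (w |: t) :\ w)%SET.
  apply/eqP; rewrite finset.eqEsubset; apply/andP; split.
    by apply: cmp => //; exact: sub_t.
  by apply: cmp => //; exact: sub_t.
split=> //.
  rewrite TT in ev fv.
  apply: (mulfI fv); rewrite mulr0 mulrDr !(mulrCA f@__) ev ew mulrN !mulrA !sgn_sqr.
  by rewrite subrr.
(* If u |: t were a face, x_u f, which lies in the ideal, would carry the nonzero coefficient of f
   at T \ v on a face. *)
move=> u uv uw ut; apply/negP => uD; case/negP: fv; apply/eqP.
have u1 : u \notin (v |: t)%SET by rewrite !inE negb_or uv.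
have u2 : u \notin (w |: t)%SET by rewrite !inE negb_or uw.
have := hu u u1 u2 (smon (u |: (T (v |: t) :\ v)))%SET.
have uT : u \notin (T (v |: t) :\ v)%SET.
  by apply: contra ut; apply/fintype.subsetP; exact: sub_t.
rewrite mvars_smon smonU // mcoeffMU mnmDE mnm1E eqxx /= addmC addmK; apply.
by apply: dD uD _; apply: finset.setUS; exact: sub_t.
Qed.

End Residue.

(** * Separating cycles of Gorenstein complexes *)

Section GorensteinIdeals.
Variables (K : fieldType) (n : nat) (D : {set {set 'I_n}}).
Local Notation S := {mpoly K[n]}.
Hypotheses (dD : down_closed D) (D0 : finset.set0 \in D).
Implicit Types (s t F : {set 'I_n}) (u v w : 'I_n).

(* A cycle z of faces containing t, which survives at F because every face
   containing [F :\: t] lies in F. *)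
Definition separating_cycle F t (z : {set 'I_n} -> K) := [/\ t \subset F /\ F \in D,
  forall s, s \in D -> F :\: t \subset s -> s \subset F,
  z F != 0,
  forall s, z s != 0 -> s \in D &
  forall s, t \subset s -> \sum_(w | w \notin s) sgn K w s * z (w |: s)%SET = 0]%SET.

Lemma noetherian_localization (A B : comNzRingType) (P : set A) (h : {rmorphism A -> B}) :
  localization_at P h -> noetherian A -> noetherian B.
Proof.
move=> [hU hF _] hA J hJ; have [J0 JD JM] := hJ.
have [s sE] : exists s : seq A, [set a | J (h a)] = ideal_gen [set` s].
  apply: hA; split=> [|a b /= ha hb|c a /= ha]; rewrite /= ?rmorph0 ?rmorphD ?rmorphM //.
    exact: JD.
  exact: JM.
exists [seq h a | a <- s]; apply/seteqP; split=> [b Jb|b]; last first.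
  apply=> // _ /= /mapP[a as_ ->].
  suff : [set a | J (h a)] a by [].
  by rewrite sE; exact: sub_ideal_gen.
have [a [x [Px bx]]] := hF b; have [c cE] := hU x Px.
have [I0 ID IM] := @ideal_gen_ideal B [set` [seq h a | a <- s]].
rewrite -[b]mulr1 -cE mulrA bx mulrC; apply: (IM).
have : [set a | J (h a)] a by rewrite /= -bx mulrC; exact: JM.
rewrite sE => /(_ [set a | ideal_gen [set` [seq h a | a <- s]] (h a)]); apply.
  split=> [|a' b' /= ha hb|c' a' /= ha]; rewrite /= ?rmorph0 ?rmorphD ?rmorphM //.
    exact: ID.
  exact: IM.
by move=> a' /= a's; apply: sub_ideal_gen; rewrite /= map_f.
Qed.

Lemma gorenstein_cycle : gorenstein_ideal (face_ideal (K := K) D) ->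
  (exists d, forall F, F \in facets D -> #|F| = d) /\
  forall F, F \in facets D -> exists t z, separating_cycle F t z.
Proof.
move=> [Q [q [q_surj q_ker [noQ gQ]]]].
have IE : is_ideal (face_ideal (K := K) D) by exact: face_ideal_ideal.
have I0 p : face_ideal D p -> (p : S)@_0%MM = 0 by apply; rewrite mvars0.
have q_eq (x y : S) : q x = q y -> x@_0%MM = y@_0%MM.
  move=> xy; have : q (x - y) = 0 by rewrite rmorphB /= xy subrr.
  by move=> /q_ker/I0; rewrite mcoeffB => /eqP; rewrite subr_eq0 => /eqP.
(* The maximal ideal of the origin, the one place where the Gorenstein condition is applied. *)
pose P : set Q := [set y | exists2 x : S, x@_0%MM = 0 & q x = y].
have Pq (x : S) : P (q x) <-> x@_0%MM = 0.
  by split=> [[y y0 /q_eq <- //]|x0]; exists x.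
have PI : is_ideal P.
  split; first by exists 0; rewrite ?mcoeff0 ?rmorph0.
    by move=> _ _ [x x0 <-] [y y0 <-]; exists (x + y); rewrite ?mcoeffD ?x0 ?y0 ?addr0 ?rmorphD.
  move=> c _ [x x0 <-]; have [y <-] := q_surj c; exists (y * x); last by rewrite rmorphM.
  by rewrite mcoeff0M x0 mulr0.
have Pmax : maximal_ideal P.
  split=> //.
    by rewrite -(rmorph1 q) => /Pq /eqP; exact/negP/one_const.
  move=> J JI J1 PJ; apply/seteqP; split=> // y Jy; have [x xy] := q_surj y.
  rewrite -xy; apply/Pq; apply/eqP/negPn/negP => x0; apply: J1.
  have Jx0 : J (q (x@_0%MM)%:MP).
    rewrite -[_%:MP](subKr x) rmorphB; apply: idealB; rewrite ?xy //.
    by apply: PJ; apply/Pq; rewrite mcoeffB mcoeffC eqxx mulr1 subrr.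
  have -> : (1 : Q) = q ((x@_0%MM)^-1)%:MP * q (x@_0%MM)%:MP.
    by rewrite -rmorphM -mpolyCM mulVf // rmorph1.
  by case: JI => _ _; exact.
have [B [hB [hloc [E [aug [del [Einj aug_inj ex0 exS Efin]]]]]]] := gQ P Pmax.
have noB := noetherian_localization hloc noQ.
case: hloc => hU hF hK.
pose phi : {rmorphism S -> B} := hB \o q.
have phi_unit (s : S) : s@_0%MM != 0 -> exists b, phi s * b = 1.
  by move=> s0; apply: hU => /Pq /eqP; rewrite (negbTE s0).
have phi_frac b : exists a s : S, s@_0%MM != 0 /\ b * phi s = phi a.
  have [a' [s' [Ps' bE]]] := hF b; have [a aE] := q_surj a'; have [s sE] := q_surj s'.
  exists a, s; rewrite /= sE aE; split=> //; apply/eqP => s0; apply: Ps'; rewrite -sE; exact/Pq.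
have phi_ker (a : S) : phi a = 0 <-> face_ideal D a.
  split=> [/hK[s' [Ps']]|/q_ker qa]; last by rewrite /= qa rmorph0.
  have [s sE] := q_surj s'; rewrite -sE -rmorphM => /q_ker sa.
  apply/face_ideal_facets => // F FD; move/(face_ideal_facets _ dD)/(_ F FD)/face_primeM: sa => [] //.
  move=> sF; case: Ps'; rewrite -sE; apply/Pq; exact: face_prime_const sF.
have [dp [g0 [mac gC gN gG]]] := residue_cohomology Einj aug_inj ex0 exS noB
  (loc_prime_ideal phi_frac finset.set0) (mm1 dD D0 phi_ker) (mmU phi_unit phi_frac) Efin.
have [g gE] : exists g : forall i, E i, g dp = g0.
  exists (fun i => if dp =P i is ReflectT e then ecast i (E i) e g0 else 0).
  by case: eqP => // e; rewrite (eq_axiomK e).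
rewrite -gE in gC gN gG.
have [T [c [Tc ridges]]] := gorenstein_facets dD D0 phi_unit phi_frac phi_ker Einj aug_inj ex0 exS noB mac gC gN gG.
split; first by exists dp => F /Tc[].
move=> F FD; exists (F :\: T F)%SET.
(* The cycle is supported on the facets G with G \ T G = F \ T F. By the ridge relations this class
   is closed under crossing ridges that contain F \ T F. *)
exists (fun s => if (s \in facets D) && (s :\: T s == F :\: T F)%SET then c s else 0).
have [cF sepF cF0 TFm] := Tc F FD.
have facetD s : s \in facets D -> s \in D by case/mem_facets.
have TF : T F \subset F.
  apply/fintype.subsetP => x xT; case: (sepF) => TD h; apply/negPn/negP => /h.
  by rewrite (finset.setUidPr _) ?TD // finset.sub1set.
split.
- by rewrite finset.subsetDl; split=> //; exact: facetD.
- move=> s sD; rewrite finset.setDDr finset.setDv finset.set0U (finset.setIidPr TF) => Ts.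
  apply/fintype.subsetP => x xs; apply/negPn/negP => xF.
  case: sepF => _ /(_ x xF) /negP; apply; apply: dD sD _.
  by rewrite finset.subUset finset.sub1set xs.
- by rewrite FD eqxx.
- by move=> s; case: ifP => [/andP[/facetD]|]; rewrite ?eqxx.
- move=> s As.
  case: (pselect (exists2 v, v \notin s & ((v |: s)%SET \in facets D) && ((v |: s) :\: T (v |: s) == F :\: T F)%SET)); last first.
    move=> h; rewrite big1 // => w ws; case: ifP => hw; last by rewrite mulr0.
    by case: h; exists w.
  case=> v vs /andP[vD /eqP vT].
  have [cv sepv _ Tvm] := Tc _ vD.
  have vTv : v \in T (v |: s)%SET.
    apply: contraT => h; have : v \in ((v |: s) :\: T (v |: s))%SET by rewrite !inE h eqxx.
    by rewrite vT => /(fintype.subsetP As); rewrite (negbTE vs).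
  (* If v |: s were the only facet through s, then s would separate it, although its least separator
     contains v. *)
  have [G GD [sG Gv]] : exists2 G, G \in facets D & (s \subset G) /\ G != (v |: s)%SET.
    apply: contrapT => h.
    have : separates D (v |: s)%SET s.
      split; first by apply: dD (facetD _ vD) _; exact: finset.subsetUr.
      move=> u us; apply/negP => uD; apply: h; have [G GD uG] := ex_facet uD.
      exists G => //; split; first by apply: fintype.subset_trans uG; exact: finset.subsetUr.
      apply: contraNneq us => <-; apply: (fintype.subsetP uG); by rewrite !inE eqxx.
    by move=> /Tvm /fintype.subsetP /(_ v vTv); rewrite (negbTE vs).
  have cs : #|s|.+1 = dp by rewrite -cv cardsU1 vs.
  have [cG _ _ _] := Tc G GD.
  have [w wE] : exists w, (G :\: s)%SET = [set w]%SET.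
    by apply/cards1P; rewrite finset.cardsDS // cG -cs subSnn.
  have ws : w \notin s.
    have : w \in (G :\: s)%SET by rewrite wE inE.
    by rewrite inE => /andP[].
  have GE : G = (w |: s)%SET by rewrite -wE finset.setUC -[LHS](finset.setID G s) (finset.setIidPr sG).
  have wv : w != v by apply: contraNneq Gv => wv; rewrite GE wv.
  have vw : v != w by rewrite eq_sym.
  rewrite GE in GD.
  have [_ TT rel no3] := ridges s v w vs ws vw vD GD.
  have wTw : w \in T (w |: s)%SET by have [] := ridges s w v ws vs wv GD vD.
  have AE : ((w |: s) :\: T (w |: s))%SET = (F :\: T F)%SET.
    rewrite -vT; apply/setP => x; move/setP/(_ x): TT; rewrite !inE.
    case: (eqVneq x v) => [->|xv] /=; first by rewrite vTv (negbTE vs) orbF (negbTE vw) andbF.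
    case: (eqVneq x w) => [->|xw] /= => [|->//]; by rewrite wTw (negbTE ws) andbF.
  rewrite (bigD1 v) //= (bigD1 w) //= ?ws // vD GD vT AE eqxx /= big1 ?addr0 //.
  move=> u /andP[/andP[us uv] uw]; case: ifP => [/andP[/facetD uD _]|_]; last by rewrite mulr0.
  by rewrite (negbTE (no3 u uv uw us)) in uD.
Qed.
End GorensteinIdeals.

(** * The Koszul complex and the regularity *)

Section Koszul.
Variables (K : fieldType) (n : nat).
Local Notation S := {mpoly K[n]}.
Implicit Types (U s F : {set 'I_n}) (u v w : 'I_n) (p : S) (m : 'X_{1..n}).

Definition kx u U : S := sgn K u U *: 'X_u.

(* Elements of the tensor product of S^r with the Koszul complex of the
   variables are functions of the exterior monomial e_U. *)
Definition kd r (om : {set 'I_n} -> 'rV[S]_r) U : 'rV[S]_r :=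
  \sum_(u | u \notin U) kx u U *: om (u |: U)%SET.

Lemma kd_kd r (om : {set 'I_n} -> 'rV[S]_r) U : kd (kd om) U = 0.
Proof.
apply: bd_bd => {}U u v uU vU uv.
rewrite /kx -!scalerAl -!scalerAr !scalerA (mulrC 'X_v) -scaleNr.
by rewrite sgn_anti.
Qed.

Lemma mcoeff_kd r (om : {set 'I_n} -> 'rV[S]_r) U k m :
  (kd om U 0 k)@_m = \sum_(u | (u \notin U) && (m u != 0%N)) sgn K u U * (om (u |: U)%SET 0 k)@_(m - U_(u)).
Proof.
rewrite summxE raddf_sum [RHS]big_mkcondr /=; apply: eq_bigr => u _.
rewrite mxE /kx -scalerAl mcoeffZ mcoeffMU; case: eqP => //=; by rewrite mulr0.
Qed.

Definition min_var u m := (m u != 0%N) && [forall v : 'I_n, (v < u)%N ==> (m v == 0%N)].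

(* The part of p whose smallest variable is x_u, divided by x_u. *)
Definition qmin u p : S := \sum_(m <- msupp p | min_var u m) p@_m *: 'X_[m - U_(u)].

Lemma mcoeff_qmin u p m :
  (qmin u p)@_m = if [forall v : 'I_n, (v < u)%N ==> (m v == 0%N)] then p@_(m + U_(u)) else 0.
Proof.
rewrite /qmin raddf_sum /= big_mkcond /=.
have E m' : (if min_var u m' then (p@_m' *: 'X_[m' - U_(u)])@_m else 0) =
    if m' == (m + U_(u))%MM then (if min_var u m' then p@_m' else 0) else 0.
  case: (boolP (min_var u m')) => [|_]; last by rewrite if_same.
  move=> /andP[mu _]; rewrite mcoeffZ mcoeffX -(eqm_add2r U_(u)) submK ?lep1mP //.
  by case: eqP; rewrite ?mulr1 ?mulr0.
rewrite (eq_bigr _ (fun m' _ => E m')) -big_mkcond /= => {E}.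
have -> : [forall v : 'I_n, (v < u)%N ==> (m v == 0%N)] = min_var u (m + U_(u))%MM.
  rewrite /min_var mnmDE mnm1E eqxx addn1 /=; apply: eq_forallb => v.
  case: (ltnP v u) => //= vu; rewrite mnmDE mnm1E.
  by rewrite (_ : u == v = false) ?addn0 //; apply: gtn_eqF.
have [mp|mp] := boolP ((m + U_(u))%MM \in msupp p); last first.
  rewrite (memN_msupp_eq0 mp) if_same big_seq_cond big1 // => m' /andP[m'p /eqP m'E].
  by rewrite -m'E m'p in mp.
rewrite -big_filter (_ : [seq i <- msupp p | i == (m + U_(u))%MM] = [:: (m + U_(u))%MM]) ?big_seq1 //.
by apply: filter_pred1_uniq.
Qed.

Definition min_elt U : option 'I_n := [pick u in U | [forall v in U, (u <= v)%N]].

Lemma min_eltP U u : u \in U -> (forall v, v \in U -> (u <= v)%N) -> min_elt U = Some u.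
Proof.
move=> uU um; rewrite /min_elt; case: pickP => [w /andP[wU /forall_inP wm]|/(_ u)/=]; last first.
  by rewrite uU /= => /negbT/forall_inPn[v vU]; rewrite um.
by congr Some; apply/val_inj/anti_leq; rewrite /= wm // um.
Qed.

(** The contracting homotopy of the Koszul complex: x^m e_W goes to (x^m / x_a) e_(a |: W) if the
    smallest variable x_a of x^m precedes all of W, and to 0 otherwise. No sign appears, as a comes
    first. *)
Definition khom r (om : {set 'I_n} -> 'rV[S]_r) U : 'rV[S]_r :=
  if min_elt U is Some u then map_mx (qmin u) (om (U :\ u)%SET) else 0.

(** Compare coefficients at U and m, with a the least vertex of U and of the support of m. If a is
    not in U, only the summand u = a survives and returns the coefficient; if a is in U, the cycle
    condition at U \ a and m + a supplies it. The pair without any a is the constant term at the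
    empty set, excluded by hypothesis. *)
Lemma koszul_exact r (om : {set 'I_n} -> 'rV[S]_r) :
  (forall U, kd om U = 0) -> (forall k, (om finset.set0 0 k)@_0%MM = 0) ->
  forall U, kd (khom om) U = om U.
Proof.
move=> cyc om0 U; apply/rowP => k; apply/mpolyP => m; rewrite mcoeff_kd.
have khE (W : {set 'I_n}) v m' : v \in W -> (forall w, w \in W -> (v <= w)%N) ->
    (khom om W 0 k)@_m' =
    if [forall w : 'I_n, (w < v)%N ==> (m' w == 0%N)] then (om (W :\ v)%SET 0 k)@_(m' + U_(v)) else 0.
  by move=> vW vm; rewrite /khom (min_eltP vW vm) mxE mcoeff_qmin.
have [/eqP UM0|] := boolP (U :|: mvars m == finset.set0)%SET.
  move/eqP: UM0; rewrite finset.setU_eq0 => /andP[/eqP U0 /eqP m0].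
  have mz : m = 0%MM.
    apply/mnmP => i; rewrite mnm0E; apply/eqP/negPn/negP => mi.
    have : i \in mvars m by rewrite inE.
    by rewrite m0 finset.in_set0.
  rewrite U0 mz om0 big1 // => u; by rewrite mnm0E eqxx andbF.
case/set0Pn => i0 i0U.
pose a := [arg min_(i < i0 in (U :|: mvars m)%SET) (i : nat)].
have [aU am] : a \in (U :|: mvars m)%SET /\ forall v, v \in (U :|: mvars m)%SET -> (a <= v)%N.
  by rewrite /a; case: arg_minnP.
have amU v : v \in U -> (a <= v)%N by move=> vU; apply: am; rewrite finset.in_setU vU.
have amm v : m v != 0%N -> (a <= v)%N.
  by move=> vm; apply: am; rewrite !inE vm orbT.
case: (boolP (a \in U)) => aU'; last first.
  have ma : m a != 0%N by move: aU; rewrite !inE (negbTE aU').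
  rewrite (bigD1 a) ?aU' ?ma //= sgn_min // mul1r (khE _ a) ?finset.setU11 //; last first.
    by move=> w; rewrite !inE => /orP[/eqP ->|/amU].
  rewrite finset.setU1K // submK ?lep1mP //.
  rewrite (_ : [forall _, _]); last first.
    apply/forallP => w; apply/implyP => wa; rewrite mnmBE.
    by have := contraNT (amm w); rewrite -ltnNge => /(_ wa)/eqP ->.
  rewrite big1 ?addr0 // => u /andP[/andP[uU mu] ua].
  have au : (a < u)%N by rewrite ltn_neqAle amm // andbT eq_sym.
  rewrite /khom; case E : (min_elt _) => [b|]; last by rewrite mxE mcoeff0 mulr0.
  move: E; rewrite /min_elt; case: pickP => // b' /andP[b'U _] [<-] {b}.
  have ab : (a < b')%N.
    move: b'U; rewrite !inE => /orP[/eqP -> //|b'U].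
    rewrite ltn_neqAle amU // andbT; by apply: contraNneq aU' => /val_inj ->.
  rewrite mxE mcoeff_qmin ifF ?mulr0 //; apply/negbTE/forallPn; exists a.
  rewrite ab /= mnmBE mnm1E (_ : u == a = false) ?subn0 //; exact/negbTE.
have := congr1 (fun x : 'rV_r => (x 0 k)@_(m + U_(a))%MM) (cyc (U :\ a)%SET).
rewrite /= mcoeff_kd mxE mcoeff0 (bigD1 a); last by rewrite !inE eqxx mnmDE mnm1E eqxx addn1.
rewrite /= finset.setD1K // addmK sgn_min ?mul1r; last by move=> u; rewrite !inE => /andP[_ /amU].
move/eqP; rewrite addr_eq0 => /eqP ->; rewrite -sumrN; apply: eq_big => u.
  rewrite !inE mnmDE mnm1E; case: (eqVneq u a) => [->|ua]; first by rewrite aU' /= andbF.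
  by rewrite addn0 /= andbT.
move=> /andP[uU mu]; have au : (a < u)%N.
  by rewrite ltn_neqAle amm // andbT; apply: contraNneq uU => /val_inj <-.
have ua : u != a by rewrite -val_eqE /= neq_ltn au orbT.
rewrite (khE _ a) ?finset.setU1r //; last first.
  by move=> w; rewrite !inE => /orP[/eqP ->|/amU //]; exact: ltnW.
rewrite ifT; last first.
  apply/forallP => w; apply/implyP => wa; rewrite mnmBE.
  by have := contraNT (amm w); rewrite -ltnNge => /(_ wa)/eqP ->.
have -> : sgn K u U = - sgn K u (U :\ a)%SET.
  by rewrite -{1}(finset.setD1K aU') sgnU1 ?au // !inE eqxx.
rewrite mulNr; congr (- (_ * _)).
have -> : ((u |: U) :\ a = u |: U :\ a)%SET.
  by apply/setP => x; rewrite !inE; case: (eqVneq x u) => [->|]; rewrite ?ua.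
congr (_@__); apply/mnmP => i; rewrite !(mnmDE, mnmBE, mnm1E).
case: (eqVneq u i) => [<-|_]; last by rewrite !subn0.
by rewrite eq_sym (negbTE ua) !addn0.
Qed.

Lemma pihomogM d e p q : q \is e.-homog ->
  pihomog mdeg d (p * q) = if (e <= d)%N then pihomog mdeg (d - e) p * q else 0.
Proof.
move=> qe; have XE m : pihomog mdeg d ('X_[m] * q) =
    if (e <= d)%N then pihomog mdeg (d - e) 'X_[m] * q else 0.
  have mq : 'X_[m] * q \is (mdeg m + e).-homog by apply: dhomogM => //; rewrite dhomogX.
  rewrite pihomogX /=; case: (leqP e d) => ed; last first.
    by apply: (pihomog_ne0 _ mq); rewrite gtn_eqF // (leq_trans ed) // leq_addl.
  case: eqP => [md|md].
    by rewrite pihomog_dE // -(subnK ed) -md.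
  rewrite mul0r; apply: (pihomog_ne0 _ mq); apply: contra_notN md => /eqP <-.
  by rewrite addnK.
rewrite [in LHS](mpolyE p) mulr_suml raddf_sum /=.
have -> : \sum_(m <- msupp p) pihomog mdeg d (p@_m *: 'X_[m] * q) =
          \sum_(m <- msupp p) p@_m *: (if (e <= d)%N then pihomog mdeg (d - e) 'X_[m] * q else 0).
  by apply: eq_bigr => m _; rewrite -scalerAl linearZ /= XE.
case: ifP => ed; last by rewrite big1 // => m _; rewrite scaler0.
rewrite [in RHS](mpolyE p) raddf_sum /= mulr_suml; apply: eq_bigr => m _.
by rewrite linearZ /= scalerAl.
Qed.

(** The component of degree e in the graded free module whose k-th generator has degree [sh k]. *)
Definition hcomp r (sh : 'I_r -> nat) e (x : 'rV[S]_r) : 'rV[S]_r :=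
  \row_k (if (sh k <= e)%N then pihomog mdeg (e - sh k) (x 0 k) else 0).

Lemma hcomp_mul r r' (sh : 'I_r -> nat) (sh' : 'I_r' -> nat) (M : 'M[S]_(r', r)) e x :
  (forall k l, if (sh l <= sh' k)%N then M k l \is (sh' k - sh l).-homog else M k l == 0) ->
  hcomp sh e (x *m M) = hcomp sh' e x *m M.
Proof.
move=> gM; apply/rowP => l; rewrite !mxE; case: (leqP (sh l) e) => le; last first.
  rewrite big1 // => k _; rewrite mxE; case: ifP => ke; last by rewrite mul0r.
  by have := gM k l; rewrite leqNgt (leq_ltn_trans ke le) => /eqP ->; rewrite mulr0.
rewrite raddf_sum /=; apply: eq_bigr => k _; rewrite mxE.
have := gM k l; case: ifP => [lk Mkl|_ /eqP ->]; last by rewrite !mulr0 raddf0.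
rewrite (pihomogM _ _ Mkl) leq_sub2rE // subnBA // subnK //.
by case: ifP => //; rewrite mul0r.
Qed.

Lemma hcomp_kx r (sh : 'I_r -> nat) e u U (x : 'rV[S]_r) :
  hcomp sh e x = x -> hcomp sh e.+1 (kx u U *: x) = kx u U *: x.
Proof.
move=> hx; apply/rowP => k; have := congr1 (fun y : 'rV_r => y 0 k) hx.
have Xh : kx u U \is 1.-homog by rewrite rpredZ // dhomogX /= mdeg1.
rewrite /= !mxE (mulrC (kx u U)) => <-.
case: (ltngtP (sh k) e.+1) => [|lt|->].
- rewrite ltnS => ke; rewrite ke (pihomogM _ _ Xh) subn_gt0 ltnS ke subnAC subn1 /=.
  by rewrite pihomog_id.
- by rewrite ifF ?mul0r //; apply/negbTE; rewrite -ltnNge; exact: ltnW.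
- by rewrite ltnn mul0r raddf0.
Qed.

Lemma hcomp0 r (sh : 'I_r -> nat) e : hcomp sh e (0 : 'rV[S]_r) = 0.
Proof. by apply/rowP => k; rewrite !mxE raddf0; case: ifP. Qed.

Lemma hcompD r (sh : 'I_r -> nat) e (x y : 'rV[S]_r) : hcomp sh e (x + y) = hcomp sh e x + hcomp sh e y.
Proof. by apply/rowP => k; rewrite !mxE raddfD; case: ifP; rewrite ?addr0. Qed.

Lemma hcomp_id r (sh : 'I_r -> nat) e (x : 'rV[S]_r) : hcomp sh e (hcomp sh e x) = hcomp sh e x.
Proof. by apply/rowP => k; rewrite !mxE; case: (sh k <= e)%N; rewrite ?pihomog_id. Qed.

Lemma kd_mul r r' (om : {set 'I_n} -> 'rV[S]_r) (M : 'M[S]_(r, r')) U :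
  kd (fun V => om V *m M) U = kd om U *m M.
Proof. by rewrite mulmx_suml; apply: eq_bigr => u _; rewrite scalemxAl. Qed.

Lemma kdB r (om et : {set 'I_n} -> 'rV[S]_r) U :
  kd (fun V => om V - et V) U = kd om U - kd et U.
Proof. by rewrite /kd -sumrB; apply: eq_bigr => u _; rewrite scalerBr. Qed.

Section Zigzag.
Variables (I : set S) (FF : free_complex K n).
Hypothesis resF : minimal_graded_free_resolution I FF.
Variables c N : nat.
Hypothesis cN : (c <= N)%N.

(* A Koszul cycle of degree c - i and total degree N with values in the
   i-th syzygy module, which is not a boundary. *)
Definition zigzag i (xi : {set 'I_n} -> 'rV[S]_(frank FF i)) := [/\
  forall U, (#|U| + i != c)%N -> xi U = 0,
  forall U, hcomp (shift (f := FF) (i := i)) (N - #|U|) (xi U) = xi U,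
  forall U, exists x, kd xi U = x *m diff FF i &
  ~ exists et : {set 'I_n} -> 'rV[S]_(frank FF i),
      forall U, exists x, xi U - kd et U = x *m diff FF i].

(** The next class is a homogeneous lift of kd xi along [diff]. If it were kd et modulo the
    following image, xi - et [diff] would be a Koszul cycle, hence a boundary by [koszul_exact], and
    xi would be a boundary modulo the image of [diff]. *)
Lemma zigzag_step i (xi : {set 'I_n} -> 'rV[S]_(frank FF i)) : (i < c)%N ->
  zigzag xi -> exists xi' : {set 'I_n} -> 'rV[S]_(frank FF i.+1), zigzag xi'.
Proof.
case: (resF) => [[_ gr] _ _ ex mi] ic [supp hom cyc ntr].
have /choice[x xE] := cyc.
exists (fun U => if (#|U| + i.+1 == c)%N then hcomp (shift (f := FF) (i := i.+1)) (N - #|U|) (x U) else 0).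
set xi' := (X in zigzag X).
have xi'E U : xi' U *m diff FF i = kd xi U.
  rewrite /xi'; case: eqP => [Uc|/eqP Uc]; last first.
    rewrite mul0mx /kd big1 // => u uU; rewrite supp ?scaler0 // cardsU1 uU add1n addSnnS //.
  rewrite -(hcomp_mul (sh := shift (f := FF) (i := i))); last exact: gr.
  rewrite -xE /kd; apply: (big_ind (fun y => hcomp (shift (f := FF) (i := i)) (N - #|U|) y = y)) => [|a b ha hb|u uU]; first exact: hcomp0.
    by rewrite hcompD ha hb.
  have UN : (#|U| < N)%N by apply: leq_trans cN; rewrite -Uc addnS ltnS leq_addr.
  rewrite -(subnSK UN); apply: hcomp_kx.
  by have := hom (u |: U)%SET; rewrite cardsU1 uU add1n.
split.
- by move=> U; rewrite /xi' => /negbTE ->.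
- by move=> U; rewrite /xi'; case: ifP => _; rewrite ?hcomp_id ?hcomp0.
- move=> U; have /ex[v vE] : kd xi' U *m diff FF i = 0.
    rewrite -kd_mul (_ : (fun V => xi' V *m diff FF i) = kd xi); last exact: funext.
    exact: kd_kd.
  by exists v.
- move=> [et etE]; apply: ntr.
  pose ze U := xi U - et U *m diff FF i.
  have zc U : kd ze U = 0.
    rewrite /ze kdB kd_mul -xi'E -mulmxBl; apply/ex.
    by case: (etE U) => y ->; exists y.
  (* At the empty set xi vanishes because i < c, and minimality removes the constant terms of et
     [diff]. *)
  have z0 k : (ze finset.set0 0 k)@_0%MM = 0.
    rewrite /ze supp ?cards0 ?add0n ?ltn_eqF // sub0r mxE mcoeffN mxE raddf_sum /= big1 ?oppr0 // => l _.
    by rewrite (rmorphM (mcoeff 0%MM)) /= mi mulr0.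
  exists (khom ze) => U; exists (et U).
  by rewrite koszul_exact // /ze opprB addrC subrK.
Qed.

(** At i = c only the component at the empty set is left. By [koszul_exact] some entry has a nonzero
    constant term, and homogeneity of total degree N places that entry on a generator of degree
    N. *)
Lemma zigzag_betti (xi : {set 'I_n} -> 'rV[S]_(frank FF 0)) :
  zigzag xi -> betti FF c N <> 0%N.
Proof.
move=> z0; have : forall i, (i <= c)%N -> exists xi' : {set 'I_n} -> 'rV[S]_(frank FF i), zigzag xi'.
  elim=> [|i IH] ic; first by exists xi.
  by have [xi' h] := IH (ltnW ic); exact: zigzag_step h.
case/(_ c (leqnn c)) => {z0}xi [supp hom cyc ntr] b0; apply: ntr.
exists (khom xi) => U; exists 0; rewrite mul0mx koszul_exact ?subrr // {U}.
  move=> U; rewrite /kd big1 // => u uU; rewrite supp ?scaler0 // cardsU1 uU.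
  by rewrite -[X in _ != X]add0n eqn_add2r.
move=> k; apply/eqP/negPn/negP => xk.
have := congr1 (fun y : 'rV_(frank FF c) => y 0 k) (hom finset.set0).
rewrite mxE cards0 subn0; case: ifP => kN E; last first.
  by move: xk; rewrite -E mcoeff0 eqxx.
have : shift k == N.
  rewrite eqn_leq kN /= -subn_eq0; apply: contraNT xk => ne; apply/eqP.
  rewrite -E; apply: (dhomog_nemf_coeff (pihomogP _ _ _)); by rewrite /= mdeg0 eq_sym.
by move=> kE; have := card0_eq b0 k; rewrite !inE kE.
Qed.
End Zigzag.

End Koszul.

(** * Regularity bounded below by a separating cycle *)

Section RegularityBound.
Variables (K : fieldType) (n : nat) (D : {set {set 'I_n}}).
Local Notation S := {mpoly K[n]}.
Hypothesis dD : down_closed D.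
Implicit Types (s t F G : {set 'I_n}) (u v w : 'I_n).

Definition altsgn G : K := \prod_(v in G) (-1) ^+ v.

Lemma altsgn_neq0 G : altsgn G != 0.
Proof. by apply/prodf_neq0 => v _; rewrite signr_eq0. Qed.

Lemma count_iota_lt k N : (k <= N)%N -> count (fun i => (i < k)%N) (iota 0 N) = k.
Proof.
move=> kN; rewrite -(subnKC kN) iotaD count_cat (eq_in_count (a2 := predT)) => [|x]; last first.
  by rewrite mem_iota /= add0n => ->.
rewrite count_predT size_iota (eq_in_count (a2 := pred0)) ?count_pred0 ?addn0 // => x.
by rewrite mem_iota add0n => /andP[kx _]; rewrite /= ltnNge kx.
Qed.

(** The vertices before u lie either in G or in the complement of u |: G, so the two signs multiply
    to (-1)^u. Thus [altsgn] carries the simplicial boundary to the Koszul differential on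
    complements. *)
Lemma sgn_compl u G : u \notin G ->
  altsgn (u |: G)%SET * sgn K u (~: (u |: G))%SET = altsgn G * sgn K u G.
Proof.
move=> uG; rewrite /altsgn big_setU1 //= -mulrA mulrCA; congr (_ * _).
have uE : nat_of_ord u = (#|[set v in G | (v < u)%N]%SET| + #|[set v in ~: (u |: G) | (v < u)%N]%SET|)%N.
  rewrite -[in LHS](count_iota_lt (ltnW (ltn_ord u))).
  have -> : count (fun i => (i < u)%N) (iota 0 n) = #|[set v : 'I_n | (v < u)%N]%SET|.
    by rewrite cardsE cardE /enum_mem -enumT /= size_filter -val_enum_ord count_map.
  pose A := [set v in G | (v < u)%N]%SET; pose B := [set v in ~: (u |: G) | (v < u)%N]%SET.
  have AB : (A :&: B = finset.set0)%SET.
    by apply/setP => x; rewrite !inE; case: (x \in G); rewrite ?andbF //= orbT /= andbF.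
  rewrite -cardsUI -/A -/B AB cards0 addn0; apply: eq_card => x; rewrite !inE negb_or.
  case: (ltnP x u) => xu; rewrite ?andbF //= !andbT.
  have -> /= : x != u by rewrite -val_eqE /= neq_ltn xu.
  by case: (x \in G).
by rewrite /sgn {1}uE exprD -mulrA -expr2 sqrr_sign mulr1.
Qed.

Lemma regularity_lower F t z (rho : int) : separating_cycle (K := K) D F t z ->
  cm_regularity (face_ideal (K := K) D) rho -> #|F :\: t|%SET%:Z <= rho.
Proof.
move=> [[tF FD] sepF zF zD zcyc] [FF [resF [_ rhoP]]].
pose R := (F :\: t)%SET; pose c := #|~: F|%SET; pose N := (c + #|R|)%N.
have DI : is_ideal (face_ideal (K := K) D) by exact: face_ideal_ideal.
case: (resF) => [[sh0 _] _ img _ _].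
pose xi U : 'rV[S]_(frank FF 0) := if U == (~: F)%SET then const_mx 'X_[smon R] else 0.
suff : zigzag (FF := FF) c N xi.
  move=> /(zigzag_betti resF (leq_addr _ _)) /rhoP.
  by rewrite /N PoszD addrAC subrr add0r.
have RU u : u \notin F -> (u |: R)%SET \notin D.
  move=> uF; apply/negP => h; have /fintype.subsetP/(_ u) := sepF _ h (finset.subsetUr _ _).
  by rewrite !inE eqxx (negbTE uF) => /(_ isT).
have rv1 (x : 'rV[S]_(frank FF 0)) : x = const_mx (x 0 0).
  by apply/rowP => k; rewrite mxE (ord1 k).
split.
- by move=> U; rewrite /xi addn0; have [->|//] := eqVneq U (~: F)%SET; rewrite /c eqxx.
- move=> U; rewrite /xi; case: eqP => [->|_]; last exact: hcomp0.
  apply/rowP => k; rewrite !mxE sh0 leq0n subn0 -/c /N addKn.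
  by rewrite pihomog_dE // dhomogX /= mdeg_smon.
- move=> U; suff /img[x xE] : face_ideal D (kd xi U 0 0) by exists x; rewrite xE -rv1.
  rewrite summxE; apply: ideal_sum => // u uU; rewrite mxE /xi.
  case: eqP => [UF|_]; last by rewrite mxE mulr0; case: DI.
  rewrite mxE -scalerAl -mpolyXD -mul_mpolyC; case: DI => _ _; apply.
  apply/face_idealX; rewrite mvarsD mvars1 mvars_smon; apply: RU.
  by have := finset.setU11 u U; rewrite UF inE.
move=> [et etE].
(* The pairing with z. It kills values in the face ideal, since G \ t is a face when z_G <> 0, and
   Koszul boundaries, since z is a cycle on the faces containing t. On xi it only sees G = F. *)
pose la (om : {set 'I_n} -> 'rV[S]_(frank FF 0)) : K :=
  \sum_(G : {set 'I_n} | t \subset G) altsgn G * z G * (om (~: G)%SET 0 0)@_(smon (G :\: t)%SET).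
have la0 : la (fun U => xi U - kd et U) = 0.
  apply: big1 => G tG; have [x xE] := etE (~: G)%SET.
  have [zG|/zD GD] := eqVneq (z G) 0; first by rewrite zG mulr0 mul0r.
  have : face_ideal D ((xi (~: G)%SET - kd et (~: G)%SET) 0 0).
    by apply/img; exists x; rewrite -xE -rv1.
  by move=> ->; rewrite ?mulr0 // mvars_smon; apply: dD GD _; exact: finset.subsetDl.
have laB : la (fun U => xi U - kd et U) = la xi - la (kd et).
  by rewrite /la -sumrB; apply: eq_bigr => G _; rewrite !mxE mcoeffB mulrBr.
have laxi : la xi = altsgn F * z F.
  rewrite /la (bigD1 F) //= big1 ?addr0.
    by rewrite /xi eqxx mxE mcoeffX eqxx mulr1.
  move=> G /andP[_ GF]; rewrite /xi ifF ?mxE ?mcoeff0 ?mulr0 //.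
  by apply/negbTE; rewrite (inj_eq (@finset.setC_inj _)).
suff lakd : la (kd et) = 0.
  move: la0; rewrite laB laxi lakd subr0 => /eqP; rewrite mulf_eq0 (negbTE zF) orbF.
  exact/negP/altsgn_neq0.
pose h G := (et (~: G)%SET 0 0)@_(smon (G :\: t)%SET).
have -> : la (kd et) = \sum_(G : {set 'I_n} | t \subset G) \sum_(u | u \in (G :\: t)%SET)
    altsgn G * z G * (sgn K u (~: G)%SET * h (G :\ u)%SET).
  apply: eq_bigr => G tG; rewrite mcoeff_kd mulr_sumr; apply: eq_big => u.
    by rewrite !inE negbK smonE !inE; case: (u \in G); case: (u \in t).
  rewrite smonE => /andP[uG uGt]; have {}uGt : u \in (G :\: t)%SET by move: uGt; case: (u \in _).
  congr (_ * (_ * _)); rewrite /h; congr (mcoeff _ (et _ _ _)).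
    by rewrite (smonD1 uGt) addmC addmK; congr smon; apply/setP => x; rewrite !inE andbCA.
  by apply/setP => x; rewrite !inE negb_and negbK.
rewrite (exchange_big_dep predT) //=.
have E u : \sum_(G : {set 'I_n} | (t \subset G) && (u \in (G :\: t)%SET))
      altsgn G * z G * (sgn K u (~: G)%SET * h (G :\ u)%SET) =
    \sum_(G : {set 'I_n} | (t \subset G) && (u \notin G)) altsgn G * h G * (sgn K u G * z (u |: G)%SET).
  rewrite (reindex_onto (fun G => (u |: G)%SET) (fun G => (G :\ u)%SET)) /=; last first.
    by move=> G /andP[_]; rewrite inE => /andP[_ uG]; rewrite finset.setD1K.
  apply: eq_big => G.
    rewrite !inE eqxx andbT; case: (boolP (u \in G)) => uG.
      rewrite andbF; apply/negbTE; rewrite negb_and; apply/orP; right.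
      by apply/eqP => e; move: uG; rewrite -e !inE eqxx.
    rewrite finset.setU1K // eqxx andbT andbT; apply/andP/idP => [[tu ut]|tG].
      apply/fintype.subsetP => x xt; move/fintype.subsetP/(_ x xt): tu; rewrite !inE.
      by case: eqP => // xu; rewrite -xu xt in ut.
    split; first by apply: fintype.subset_trans tG _; exact: finset.subsetUr.
    by apply: contra uG; exact: (fintype.subsetP tG).
  move=> /andP[_ /eqP GE]; have uG : u \notin G by rewrite -GE !inE eqxx.
  rewrite GE; have := sgn_compl uG => e.
  by rewrite mulrACA e [RHS]mulrACA; congr (_ * _); rewrite mulrC.
rewrite (eq_bigr _ (fun u _ => E u)) (exchange_big_dep (fun G : {set 'I_n} => t \subset G)) /=; last first.
  by move=> u G _ /andP[].
apply: big1 => G tG; transitivity (altsgn G * h G * 0); last exact: mulr0.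
by rewrite -{2}(zcyc G tG) mulr_sumr; apply: eq_bigl => u; rewrite tG.
Qed.

End RegularityBound.

(** * Shellable complexes *)

Section SimplicialChains.
Variables (K : fieldType) (n : nat).
Implicit Types (s t F : {set 'I_n}) (u v w : 'I_n) (z : {set 'I_n} -> K).

Definition bd z s : K := \sum_(w | w \notin s) sgn K w s * z (w |: s)%SET.

Definition cone u z s : K := if u \in s then sgn K u s * z (s :\ u)%SET else 0.

Lemma bdbd z s : bd (bd z) s = 0.
Proof.
have := @bd_bd n K K^o (fun v s => sgn K v s) z s; apply=> U u v; exact: sgn_anti.
Qed.

Lemma bdB z z' s : bd (fun t => z t - z' t) s = bd z s - bd z' s.
Proof. by rewrite /bd -sumrB; apply: eq_bigr => w _; rewrite mulrBr. Qed.

Lemma cone_homotopy u z s : bd (cone u z) s + cone u (bd z) s = z s.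
Proof.
have sgnU u' s' : sgn K u' (u' |: s')%SET = sgn K u' s' by rewrite -sgnD1 -[RHS]sgnD1; congr sgn; apply/setP => x; rewrite !inE; case: eqP.
rewrite /cone /bd; case: (boolP (u \in s)) => us; last first.
  rewrite addr0 (bigD1 u) //= finset.setU11 sgnU finset.setU1K // mulrA sgn_sqr mul1r.
  rewrite big1 ?addr0 // => w /andP[ws wu]; rewrite !inE (negbTE us) orbF eq_sym (negbTE wu).
  by rewrite mulr0.
rewrite [X in _ + _ * X](bigD1 u) ?finset.setD11 //= finset.setD1K // mulrDr mulrA sgnD1 sgn_sqr mul1r.
rewrite addrCA -[RHS]addr0; congr (_ + _); apply/eqP; rewrite addr_eq0 mulr_sumr -sumrN; apply/eqP.
apply: eq_big => w.
  by rewrite !inE; case: (eqVneq w u) => [->|]; rewrite ?us ?andbT.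
move=> ws; have wu : w != u by apply: contraNneq ws => ->.
rewrite !inE us orbT.
have -> : ((w |: s) :\ u = w |: (s :\ u))%SET.
  by apply/setP => x; rewrite !inE; case: (eqVneq x w) => [->|]; rewrite ?wu.
rewrite !mulrA -mulNr; congr (_ * _).
have sE : s = (u |: (s :\ u))%SET by rewrite finset.setD1K.
rewrite sgnU1 // [in sgn K w s]sE sgnU1 ?finset.setD11 //.
case: (ltngtP u w) => [lt|lt|/val_inj e]; last by rewrite e eqxx in wu.
- by rewrite mulNr mulrC.
- by rewrite mulrN mulrC.
Qed.

Section Shelling.
Variables (D : {set {set 'I_n}}) (k : nat) (sh : seq {set 'I_n}).
Hypotheses (dD : down_closed D) (shE : sh =i facets D)
  (shk : forall F, F \in facets D -> #|F| = k).
Local Notation sg i := (nth finset.set0 sh i).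

Definition old i t := [exists j : 'I_n.+1 * 'I_(size sh), (j.2 < i)%N && (t \subset sg j.2)].

Lemma oldP i t : (i <= size sh)%N -> reflect (exists2 j, (j < i)%N & t \subset sg j) (old i t).
Proof.
move=> ish; apply: (iffP existsP) => [[[a j] /= /andP[ji tj]]|[j ji tj]]; first by exists j.
by exists (ord0, Ordinal (leq_trans ji ish)); rewrite /= ji.
Qed.

(** In a shelling, the least face of the i-th facet that lies in no earlier facet; the hypothesis
    [shell] says that the new faces are those above it. *)
Definition restriction i := [set v in sg i | old i (sg i :\ v)]%SET.

Hypothesis shell : forall i, (i < size sh)%N -> forall t, t \subset sg i ->
  old i t = ~~ (restriction i \subset t).

Lemma old_sub i t t' : old i t' -> t \subset t' -> old i t.
Proof.
move=> /existsP[j /andP[ji t'j]] tt'; apply/existsP; exists j.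
by rewrite ji (fintype.subset_trans tt' t'j).
Qed.

Lemma oldS i t : (i < size sh)%N -> old i.+1 t = old i t || (t \subset sg i).
Proof.
move=> ish; apply/(oldP _ ish)/orP => [[j]|[/(oldP _ (ltnW ish))[j ji tj]|ti]].
- rewrite ltnS leq_eqVlt => /orP[/eqP ->|ji] tj; [by right|left].
  by apply/(oldP _ (ltnW ish)); exists j.
- by exists j => //; exact: ltnW.
- by exists i.
Qed.

Lemma sg_card i : (i < size sh)%N -> #|sg i| = k.
Proof. by move=> ish; apply: shk; rewrite -shE mem_nth. Qed.

Lemma sum_neq0 (P : pred 'I_n) (f : 'I_n -> K) : \sum_(w | P w) f w != 0 -> exists2 w, P w & f w != 0.
Proof.
move=> h; apply: contrapT => nh; case/eqP: h; apply: big1 => w Pw.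
by apply/eqP/negPn/negP => fw; apply: nh; exists w.
Qed.

(* Relative to the faces containing t, the initial segments of a shelling are
   acyclic below the top dimension. *)
Lemma shelling_acyclic i t z : (i <= size sh)%N ->
  (forall s, z s != 0 -> old i s /\ (#|s| < k)%N) ->
  (forall s, t \subset s -> bd z s = 0) ->
  exists2 y, forall s, y s != 0 -> old i s & forall s, t \subset s -> bd y s = z s.
Proof.
elim: i z => [|i IH] z ish zs zc.
  exists (fun=> 0) => s; first by rewrite eqxx.
  move=> _; rewrite /bd big1 => [|w _]; last by rewrite mulr0.
  apply/esym/eqP/negPn/negP => /zs[/(oldP _ ish)[j]]; by rewrite ltn0.
pose new s := [&& s \subset sg i, ~~ old i s & t \subset s].
have newE s : s \subset sg i -> new s = (restriction i \subset s) && (t \subset s).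
  by move=> si; rewrite /new si shell // negbK.
(* If u is free, new faces containing t stay so when u is added or removed, and coning with u clears
   z on them. Otherwise the only new face containing t is the whole facet, of size k, where z
   vanishes. *)
have [[u ui uRt]|allRt] : (exists2 u, u \in sg i & u \notin (restriction i :|: t)%SET) \/
    (sg i \subset restriction i :|: t)%SET.
- case: (boolP (sg i \subset restriction i :|: t)%SET) => [|/fintype.subsetPn[u]]; first by right.
  by left; exists u.
- pose zn s := if new s then z s else 0.
  pose w1 := cone u zn.
  pose z' s := if t \subset s then z s - bd w1 s else 0.
  have w1s s : w1 s != 0 -> [/\ u \in s, new (s :\ u)%SET & z (s :\ u)%SET != 0].
    rewrite /w1 /cone /zn; case: ifP => us; last by rewrite eqxx.
    by case: ifP => ns; rewrite ?mulr0 ?eqxx // mulf_eq0 negb_or => /andP[].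
  have w1i s : w1 s != 0 -> s \subset sg i.
    case/w1s => us /and3P[si _ _] _; rewrite -(finset.setD1K us).
    by rewrite finset.subUset finset.sub1set ui.
  have new0 s : new s -> bd w1 s = z s.
    move=> ns; have := cone_homotopy u zn s; have -> : zn s = z s by rewrite /zn ns.
    suff -> : cone u (bd zn) s = 0 by rewrite addr0.
    rewrite /cone; case: ifP => // us; suff -> : bd zn (s :\ u)%SET = 0 by rewrite mulr0.
    case/and3P: (ns) => si _ ts.
    have si' : (s :\ u)%SET \subset sg i by apply: fintype.subset_trans si; exact: finset.subsetDl.
    have ns' : new (s :\ u)%SET.
      move: ns; rewrite !newE // => /andP[Rs _].
      move: uRt; rewrite finset.in_setU negb_or => /andP[uR ut].
      by apply/andP; split; rewrite finset.subsetD1 ?Rs ?ts ?uR ?ut.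
    case/and3P: (ns') => _ os' ts'; rewrite -[RHS](zc _ ts'); apply: eq_bigr => w ws.
    congr (_ * _); rewrite /zn; case: ifP => // /negP nw.
    apply/esym/eqP/negPn/negP => /zs[]; rewrite oldS // => /orP[ow|wi] _; last first.
      apply: nw; rewrite /new wi (fintype.subset_trans ts' (finset.subsetUr _ _)) andbT.
      by apply: contra os' => h; apply: old_sub h _; exact: finset.subsetUr.
    by case/negP: os'; apply: old_sub ow _; exact: finset.subsetUr.
  have [||y ys yc] := IH z' (ltnW ish).
  + move=> s; rewrite /z'; case: ifP => ts; last by rewrite eqxx.
    move=> zs0; case: (boolP (new s)) => ns.
      by move: zs0; rewrite new0 // subrr eqxx.
    have osi : s \subset sg i -> old i s.
      by move=> si; apply: contraNT ns => os; rewrite /new si os.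
    have [zs1|zs1] := eqVneq (z s) 0; last first.
      have [] := zs s zs1; rewrite oldS // => /orP[->|/osi ->] -> //.
    move: zs0; rewrite zs1 sub0r oppr_eq0 => /sum_neq0[w ws].
    rewrite mulf_eq0 negb_or => /andP[_ w1n]; have [uw _ zn0] := w1s _ w1n.
    split; first by apply: osi; apply: fintype.subset_trans (w1i _ w1n); exact: finset.subsetUr.
    have [_] := zs _ zn0; rewrite (_ : #|_| = #|s|) //.
    by apply/eqP; rewrite -eqSS -[X in X == _]add1n; have := cardsD1 u (w |: s)%SET; rewrite uw => <-; rewrite cardsU1 ws.
  + move=> s ts; have bz : bd z' s = bd z s - bd (bd w1) s.
      rewrite -bdB; apply: eq_bigr => w _; rewrite /z'.
      by rewrite (fintype.subset_trans ts (finset.subsetUr _ _)).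
    by rewrite bz bdbd zc // subr0.
  exists (fun s => y s + w1 s) => s.
    move=> yw; rewrite oldS //; have [y0|/ys -> //] := eqVneq (y s) 0.
    by move: yw; rewrite y0 add0r => /w1i ->; rewrite orbT.
  move=> ts; have -> : bd (fun s => y s + w1 s) s = bd y s + bd w1 s.
    by rewrite /bd -big_split; apply: eq_bigr => w _; rewrite mulrDr.
  by rewrite yc // /z' ts subrK.
have [||y ys yc] := IH (fun s => if t \subset s then z s else 0) (ltnW ish).
- move=> s; case: ifP => ts; last by rewrite eqxx.
  move=> zn; have [] := zs s zn; rewrite oldS // => /orP[//|si] sk; split=> //.
  rewrite shell //; apply/negP => Rs; have : sg i \subset s.
    by apply: fintype.subset_trans allRt _; rewrite finset.subUset Rs.
  by move/subset_leq_card; rewrite sg_card // leqNgt sk.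
- move=> s ts; rewrite -[RHS](zc s ts); apply: eq_bigr => w _.
  by rewrite (fintype.subset_trans ts (finset.subsetUr _ _)).
exists y => s; first by move=> /ys os; rewrite oldS // os.
by move=> ts; rewrite yc // ts.
Qed.

(** On the faces containing t, the boundary of the last facet F consists of ridges F \ v with v in
    the restriction, all in earlier facets. By [shelling_acyclic] it is the boundary of a chain w
    there, and the cycle is F - w. *)
Lemma shelling_cycle : (0 < size sh)%N ->
  exists F t z, F \in facets D /\ separating_cycle D F t z.
Proof.
move=> sh0; pose i := (size sh).-1.
have ish : (i < size sh)%N by rewrite /i prednK.
pose F := sg i; pose t := (F :\: restriction i)%SET.
have FD : F \in facets D by rewrite -shE mem_nth.
have RF : restriction i \subset F by apply/fintype.subsetP => v; rewrite inE => /andP[].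
have FtR : (F :\: t)%SET = restriction i.
  by rewrite finset.setDDr finset.setDv finset.set0U (finset.setIidPr RF).
have oldF : ~~ old i F by rewrite shell // negbK.
have oldD s : old i s -> s \in D.
  move=> /(oldP _ (ltnW ish))[j ji sj]; apply: dD sj.
  by have /mem_facets[] : sg j \in facets D by rewrite -shE mem_nth // (ltn_trans ji).
pose z0 s : K := if s == F then 1 else 0.
pose y s : K := if t \subset s then bd z0 s else 0.
have [||w ws wc] := @shelling_acyclic i t y (ltnW ish).
- move=> s; rewrite /y; case: ifP => ts; last by rewrite eqxx.
  move=> /sum_neq0[v vs]; rewrite mulf_eq0 negb_or => /andP[_].
  rewrite /z0; case: ifP => [/eqP vF _|_]; last by rewrite eqxx.
  have sE : s = (F :\ v)%SET by rewrite -vF finset.setU1K.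
  have vF' : v \in F by rewrite -vF finset.setU11.
  split; last by rewrite -(sg_card ish) -/F -vF cardsU1 vs.
  have : v \in restriction i.
    apply: contraT => vR; have : v \in t by rewrite finset.in_setD vR.
    by move/(fintype.subsetP ts); rewrite (negbTE vs).
  by rewrite inE sE => /andP[].
- move=> s ts; rewrite -[RHS](bdbd z0 s); apply: eq_bigr => v _.
  by rewrite /y (fintype.subset_trans ts (finset.subsetUr _ _)).
exists F, t, (fun s => z0 s - w s); split=> //; split.
- by rewrite finset.subsetDl; split=> //; case/mem_facets: FD.
- move=> s sD; rewrite FtR => Rs; have [G GD sG] := ex_facet sD.
  move: (GD); rewrite -shE => /(nthP finset.set0)[j jsh jG].
  have : (j <= i)%N by rewrite /i -ltnS prednK.
  rewrite leq_eqVlt => /orP[/eqP ji|ji]; first by rewrite /F -ji jG.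
  have : old i (restriction i).
    by apply/(oldP _ (ltnW ish)); exists j => //; rewrite jG; exact: fintype.subset_trans sG.
  by rewrite shell // fintype.subxx.
- rewrite /z0 eqxx; suff -> : w F = 0 by rewrite subr0 oner_neq0.
  by apply/eqP/negPn/negP => /ws; rewrite (negbTE oldF).
- move=> s; rewrite /z0; case: (s =P F) => [-> _|_]; first by case/mem_facets: FD.
  by rewrite sub0r oppr_eq0 => /ws/oldD.
- move=> s ts; rewrite -[LHS]/(bd (fun s => z0 s - w s) s) bdB wc // /y ts subrr //.
Qed.

End Shelling.
End SimplicialChains.

Lemma shellable_cycle (K : fieldType) (n : nat) (D : {set {set 'I_n}}) :
  down_closed D -> shellable_complex D ->
  (exists d, forall F, F \in facets D -> #|F| = d) /\
  exists F t z, F \in facets D /\ separating_cycle (K := K) D F t z.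
Proof.
move=> dD [d [[D0 pD] [sh [_ shE shP]]]].
have [F0 F0D] : exists F, F \in facets D.
  have /set0Pn[s sD] : D != finset.set0 by apply/eqP.
  by have [F FD _] := ex_facet sD; exists F.
have shk F : F \in facets D -> #|F| = #|F0|.
  move=> FD; have := pD F FD; rewrite -(pD F0 F0D) /face_dim => /addIr.
  by case.
split; first by exists #|F0|.
have sh0 : (0 < size sh)%N by rewrite -shE in F0D; case: (sh) F0D.
apply: (@shelling_cycle K n D #|F0| sh dD shE shk) => // i ish t ti.
set sgi := nth finset.set0 sh i in ti *.
have FD : sgi \in facets D by rewrite -shE mem_nth.
have ish' := ltnW ish.
apply/idP/idP => [ot|].
  have i0 : (0 < i)%N.
    by rewrite lt0n; apply: contraTneq ot => ->; apply/negP => /existsP[j] /andP[].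
  have [|Xn0 Xp] := shP i; first by rewrite i0.
  set X := (_ :&: _)%SET in Xn0 Xp.
  have XE s : s \in X = (s \subset sgi) && old sh i s.
    rewrite !inE; case: (boolP (s \subset sgi)) => si; rewrite ?andbF // andbT.
    have sD : s \in D by apply: dD si; case/mem_facets: FD.
    rewrite sD /=; apply/bigcupP/(oldP _ ish') => [[j _]|[j ji sj]].
      by rewrite inE => /andP[_ sj]; exists j.
    by exists (Ordinal ji) => //; rewrite inE sD.
  have tX : t \in X by rewrite XE ti.
  (* By purity a maximal old face r above t is a ridge of the facet; its missing vertex is in the
     restriction but not in t. *)
  have [r rX tr] := ex_facet tX.
  have /mem_facets[] := rX; rewrite XE => /andP[rsg ro] _.
  have cr : #|sgi| = #|r|.+1.
    have := Xp r rX; rewrite -(pD _ FD) /face_dim => /addIr e.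
    by apply/eqP; rewrite -eqz_nat -addn1 PoszD e subrK.
  have [v vE] : exists v, (sgi :\: r)%SET = [set v]%SET.
    by apply/cards1P; rewrite finset.cardsDS // cr subSnn.
  have : v \in (sgi :\: r)%SET by rewrite vE inE.
  rewrite inE => /andP[vr vs]; apply/negP => /fintype.subsetP/(_ v) h.
  have /h vt : v \in restriction sh i.
    rewrite inE vs /= (_ : (_ :\ v)%SET = r) // -vE finset.setDDr finset.setDv finset.set0U.
    exact/finset.setIidPr.
  by rewrite (fintype.subsetP tr _ vt) in vr.
case/fintype.subsetPn => v; rewrite inE => /andP[vs ov] vt.
by apply: old_sub ov _; rewrite finset.subsetD1 ti.
Qed.

(** * Hilbert functions and multiplicities *)

Section RelativeBases.
Variables (K : fieldType) (n : nat).
Local Notation S := {mpoly K[n]}.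
Implicit Types (V W : set S) (p q f : S).

Definition lin_closed W := W 0 /\ forall a p q, W p -> W q -> W (a *: p + q).

Lemma lin_closedD W p q : lin_closed W -> W p -> W q -> W (p + q).
Proof. by case=> _ h Wp Wq; have := h 1 p q Wp Wq; rewrite scale1r. Qed.

Lemma lin_closedZ W a p : lin_closed W -> W p -> W (a *: p).
Proof. by case=> W0 h Wp; have := h a p 0 Wp W0; rewrite addr0. Qed.

Lemma lin_closedN W p : lin_closed W -> W p -> W (- p).
Proof. by move=> hW Wp; rewrite -scaleN1r; exact: lin_closedZ. Qed.

Lemma lin_closedB W p q : lin_closed W -> W p -> W q -> W (p - q).
Proof. by move=> hW Wp Wq; apply: lin_closedD => //; exact: lin_closedN. Qed.

Lemma lin_closed_sum W (T : Type) (r : seq T) (P : pred T) (f : T -> S) :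
  lin_closed W -> (forall i, P i -> W (f i)) -> W (\sum_(i <- r | P i) f i).
Proof.
move=> hW h; apply: big_ind => //; first by case: hW.
by move=> p q; exact: lin_closedD.
Qed.

Lemma ideal_lin_closed (I : set S) : is_ideal I -> lin_closed I.
Proof.
case=> I0 ID IM; split=> // a p q Ip Iq; apply: ID => //.
by rewrite -mul_mpolyC; exact: IM.
Qed.

Definition indep_mod W (T : finType) (b : T -> S) :=
  forall c : T -> K, W (\sum_i c i *: b i) -> forall i, c i = 0.

Definition span_mod V W (T : finType) (b : T -> S) :=
  forall v, V v -> exists c : T -> K, W (v - \sum_i c i *: b i).

Lemma steinitz V W (T T' : finType) (b : T -> S) (b' : T' -> S) : lin_closed W ->
  (forall i, V (b' i)) -> indep_mod W b' -> span_mod V W b -> (#|T'| <= #|T|)%N.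
Proof.
move=> hW Vb' ind sp; rewrite leqNgt; apply/negP => lt.
have /choice[a aE] i : exists c : T -> K, W (b' i - \sum_j c j *: b j) by exact: sp.
pose A : 'M[K]_(#|T'|, #|T|) := \matrix_(i, j) a (enum_val i) (enum_val j).
have : kermx A != 0.
  rewrite -mxrank_eq0 -lt0n mxrank_ker subn_gt0.
  exact: leq_ltn_trans (rank_leq_col A) lt.
case/matrix0Pn => k [l kl].
have kA : row k (kermx A) *m A = 0 by rewrite -row_mul mulmx_ker row0.
have := ind (fun i => kermx A k (enum_rank i)) _ (enum_val l).
rewrite enum_valK => h; move/eqP: kl; apply; apply: h.
rewrite (_ : \sum_i _ = \sum_i kermx A k (enum_rank i) *: (b' i - \sum_j a i j *: b j)).
  by apply: lin_closed_sum => // i _; exact: lin_closedZ.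
apply/eqP; rewrite -subr_eq0 -sumrB; apply/eqP.
transitivity (\sum_i \sum_j (kermx A k (enum_rank i) * a i j) *: b j).
  apply: eq_bigr => i _; rewrite scalerBr opprB addrCA subrr addr0 scaler_sumr.
  by apply: eq_bigr => j _; rewrite scalerA.
rewrite exchange_big big1 // => j _; rewrite -scaler_suml.
have := congr1 (fun M : 'rV_#|T| => M 0 (enum_rank j)) kA; rewrite !mxE => e.
suff -> : \sum_i kermx A k (enum_rank i) * a i j = 0 by rewrite scale0r.
rewrite -[RHS]e (reindex (@enum_val T' predT)) /=; last exact/onW_bij/enum_val_bij.
apply: eq_bigr => i _; by rewrite !mxE enum_valK enum_rankK.
Qed.

Lemma dim_modE V W (T : finType) (b : T -> S) : lin_closed W ->
  (forall i, V (b i)) -> indep_mod W b -> span_mod V W b -> dim_mod V W #|T|.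
Proof.
move=> hW Vb ind sp; exists (fun i => b (enum_val i)); split=> // v Vv.
have [c cE] := sp v Vv.
have rE (x : {ffun 'I_#|T| -> K}) :
    \sum_i x i *: b (enum_val i) = \sum_i x (enum_rank i) *: b i.
  rewrite [RHS](reindex (@enum_val T predT)) /=; last exact/onW_bij/enum_val_bij.
  by apply: eq_bigr => i _; rewrite enum_valK.
exists [ffun i => c (enum_val i)]; split.
  rewrite rE; under eq_bigr do rewrite ffunE enum_rankK; exact: cE.
move=> x xE; apply/ffunP => i; rewrite ffunE.
have := ind (fun i => c i - x (enum_rank i)) _ (enum_val i); rewrite enum_valK => h.
apply/eqP; rewrite -subr_eq0 h //.
rewrite rE in xE; have := lin_closedB hW xE cE; congr W.
rewrite opprB addrC addrA subrK -sumrB; apply: eq_bigr => j _; by rewrite scalerBl.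
Qed.

Lemma dim_modP V W k : V 0 -> lin_closed W -> dim_mod V W k ->
  exists b : 'I_k -> S, [/\ forall i, V (b i), indep_mod W b & span_mod V W b].
Proof.
move=> V0 hW [b [Vb bE]]; exists b; split=> // [c cW i|v /bE[c [cE _]]]; last by exists c.
have [c0 [_ uni]] := bE 0 V0.
have e1 := uni [ffun=> 0]; have e2 := uni [ffun j => - c j].
have : [ffun j => - c j] = [ffun=> 0] :> {ffun 'I_k -> K}.
  rewrite -e1 ?e2 //; rewrite sub0r; apply: lin_closedN => //.
    rewrite (_ : \sum_i _ = - (\sum_i c i *: b i)); first exact: lin_closedN.
    by rewrite -sumrN; apply: eq_bigr => j _; rewrite ffunE scaleNr.
  by rewrite big1 => [|j _]; [case: hW|rewrite ffunE scale0r].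
by move/ffunP/(_ i); rewrite !ffunE => /eqP; rewrite oppr_eq0 => /eqP.
Qed.

Lemma dim_mod_uniq V W k k' : V 0 -> lin_closed W -> dim_mod V W k -> dim_mod V W k' -> k = k'.
Proof.
move=> V0 hW /(dim_modP V0 hW)[b [Vb bi bs]] /(dim_modP V0 hW)[b' [Vb' b'i b's]].
apply/eqP; rewrite eqn_leq; apply/andP; split.
  by have := steinitz hW Vb bi b's; rewrite !card_ord.
by have := steinitz hW Vb' b'i bs; rewrite !card_ord.
Qed.

(* V has dimension at most the size of a family spanning it modulo W0 <= W. *)
Lemma dim_mod_exists V W W0 (T : finType) (b0 : T -> S) :
  lin_closed V -> lin_closed W -> W0 `<=` W -> span_mod V W0 b0 ->
  exists k, dim_mod V W k.
Proof.
move=> hV hW W0W sp0.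
have sp : span_mod V W b0 by move=> v /sp0[c cE]; exists c; exact: W0W.
pose P k := `[< exists b : 'I_k -> S, (forall i, V (b i)) /\ indep_mod W b >].
have P0 : exists k, P k.
  by exists 0%N; apply/asboolP; exists (fun=> 0); split=> [[]|c _ []].
have Pm k : P k -> (k <= #|T|)%N.
  by move=> /asboolP[b [Vb bi]]; have := steinitz hW Vb bi sp; rewrite card_ord.
have [k /asboolP[b [Vb bi]] km] := ex_maxnP P0 Pm.
exists k; rewrite -[k]card_ord; apply: (@dim_modE V W _ b) => // v Vv.
apply: contrapT => nv.
suff Pk : P k.+1 by have := km _ Pk; rewrite ltnn.
apply/asboolP.
exists (fun i => if unlift ord_max i is Some j then b j else v).
split=> [i|c]; first by case: unlift.
rewrite big_ord_recr /= unlift_none => cW.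
have bE : \sum_(i < k) c (widen_ord (leqnSn k) i) *:
      (if unlift ord_max (widen_ord (leqnSn k) i) is Some j then b j else v) =
    \sum_(i < k) c (widen_ord (leqnSn k) i) *: b i.
  apply: eq_bigr => i _; have -> : widen_ord (leqnSn k) i = lift ord_max i.
    by apply: val_inj; rewrite /= /bump leqNgt ltn_ord.
  by rewrite liftK.
rewrite bE in cW.
have [c0|c0] := eqVneq (c ord_max) 0.
  rewrite c0 scale0r addr0 in cW => i.
  case: (unliftP ord_max i) => [j ->|-> //].
  have := bi (fun i => c (widen_ord (leqnSn k) i)) cW j; congr (c _ = 0).
  by apply: val_inj; rewrite /= /bump leqNgt ltn_ord.
case: nv; exists (fun i => - (c ord_max)^-1 * c (widen_ord (leqnSn k) i)).
have := lin_closedZ (c ord_max)^-1 hW cW; congr W.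
rewrite scalerDr scalerA mulVf // scale1r addrC; congr (_ + _).
rewrite scaler_sumr -sumrN; apply: eq_bigr => i _.
by rewrite scalerA mulNr scaleNr opprK.
Qed.

Lemma deg_leP t p : deg_le t p <-> forall m, p@_m != 0 -> (mdeg m <= t)%N.
Proof.
rewrite /deg_le /=; split=> [pt m pm|h].
  by rewrite -ltnS; apply: leq_trans pt; apply: msize_mdeg_lt; rewrite mcoeff_msupp.
rewrite msizeE; apply/bigmax_leqP_seq => m mp _.
by rewrite ltnS h // -mcoeff_msupp.
Qed.

Lemma deg_le_lin t : lin_closed (@deg_le K n t).
Proof.
split=> [|a p q /deg_leP hp /deg_leP hq]; first by apply/deg_leP => m; rewrite mcoeff0 eqxx.
apply/deg_leP => m; rewrite mcoeffD mcoeffZ.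
have [pm|/hp //] := eqVneq (p@_m) 0; rewrite pm mulr0 add0r; exact: hq.
Qed.

Lemma hilbert_funE (J : set S) t k : is_ideal J -> dim_mod (deg_le t) J k -> hilbert_fun J t = k.
Proof.
move=> /ideal_lin_closed hJ hk; rewrite /hilbert_fun; case: xgetP => [k' _|/(_ k)//].
move=> /= hk'; apply: dim_mod_uniq hk' hk => //; by case: (deg_le_lin t).
Qed.

Lemma face_basis (D : {set {set 'I_n}}) t :
  let b (m : {m : 'X_{1..n < t.+1} | mvars m \in D}) : S := 'X_[val m] in
  [/\ forall m, deg_le t (b m), indep_mod (face_ideal D) b & span_mod (deg_le t) (face_ideal D) b].
Proof.
move=> b.
have bc (c : _ -> K) (m : {m : 'X_{1..n < t.+1} | mvars m \in D}) : (\sum_i c i *: b i)@_(val m) = c m.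
  rewrite raddf_sum (bigD1 m) //= big1 ?addr0.
    by rewrite mcoeffZ mcoeffX eqxx mulr1.
  move=> i im; rewrite mcoeffZ mcoeffX; case: eqP => [e|]; last by rewrite mulr0.
  by move: im; rewrite -val_eqE -val_eqE /= e eqxx.
split=> [m|c cI m|v /deg_leP vt].
- apply/deg_leP => m'; rewrite mcoeffX; case: (_ =P m') => [<- _|_]; last by rewrite eqxx.
  by rewrite -ltnS bmdeg.
- by rewrite -bc; apply: cI; exact: (valP m).
exists (fun m => v@_(bmnm (val m))) => m mD; rewrite mcoeffB; apply/eqP; rewrite subr_eq0; apply/eqP.
have [vm|vm] := eqVneq (v@_m) 0.
  rewrite vm raddf_sum big1 // => i _; rewrite /= mcoeffZ mcoeffX.
  by case: eqP => [->|]; rewrite ?vm ?mul0r ?mulr0.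
have mt : (mdeg m < t.+1)%N by rewrite ltnS vt.
exact/esym/(bc (fun m => v@_(bmnm (val m))) (exist _ (BMultinom mt) mD)).
Qed.

Lemma hilbert_ex (J : set S) t : is_ideal J -> dim_mod (deg_le t) J (hilbert_fun J t).
Proof.
(* The face ideal of the full power set is 0, so this says that finitely many monomials span the
   polynomials of degree at most t. *)
move=> hJ; have [_ _ sp] := face_basis finset.setT t.
have [|k hk] := @dim_mod_exists (deg_le t) J (face_ideal finset.setT) _ _ (deg_le_lin t) (ideal_lin_closed hJ) _ sp.
  move=> p pT; suff -> : p = 0 by case: hJ.
  by apply/mpolyP => m; rewrite mcoeff0 pT // inE.
by rewrite (hilbert_funE hJ hk).
Qed.

Lemma hilbert_basis (J : set S) t : is_ideal J -> exists b : 'I_(hilbert_fun J t) -> S,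
  [/\ forall i, deg_le t (b i), indep_mod J b & span_mod (deg_le t) J b].
Proof.
move=> hJ; apply: dim_modP (hilbert_ex t hJ); last exact: ideal_lin_closed.
by case: (deg_le_lin t).
Qed.

Lemma hilbert_leq (J : set S) t (T : finType) (b : T -> S) : is_ideal J ->
  (forall i, deg_le t (b i)) -> indep_mod J b -> (#|T| <= hilbert_fun J t)%N.
Proof.
move=> hJ hb bi; have [b' [_ _ sp]] := hilbert_basis t hJ.
by have := steinitz (ideal_lin_closed hJ) hb bi sp; rewrite card_ord.
Qed.

Lemma hilbert_mono (J J' : set S) t t' : is_ideal J -> is_ideal J' -> J `<=` J' -> (t <= t')%N ->
  (hilbert_fun J' t <= hilbert_fun J t')%N.
Proof.
move=> hJ hJ' JJ' tt'; have [b [hb bi _]] := hilbert_basis t hJ'.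
rewrite -{1}[hilbert_fun J' t]card_ord; apply: (hilbert_leq hJ (b := b)) => [i|c /JJ'/bi //].
by apply/deg_leP => m; move/deg_leP: (hb i) => h /h mt; apply: leq_trans tt'.
Qed.

Lemma hilbert_gt0 (J : set S) t : is_ideal J -> ~ J 1 -> (0 < hilbert_fun J t)%N.
Proof.
move=> hJ J1; rewrite -(card_ord 1); apply: (hilbert_leq hJ (b := fun=> 1)) => [i|c].
  by rewrite /deg_le /= msize1.
rewrite big_ord1 => cJ i; rewrite (ord1 i); apply/eqP/negPn/negP => c0; apply: J1.
by have := lin_closedZ (c ord0)^-1 (ideal_lin_closed hJ) cJ; rewrite scalerA mulVf // scale1r.
Qed.

Lemma deg_leM t a p : deg_le t p -> deg_le (t + (msize a).+1) (a * p).
Proof.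
rewrite /deg_le /= => pt; apply: leq_trans (msizeM_le _ _) _.
by rewrite addnS ltnS addnC -addSn leq_add2r.
Qed.

(** Multiplication by a is injective modulo the prime P and lands in Q. So a times a basis modulo P,
    joined to a basis modulo Q, is independent modulo P. *)
Lemma hilbert_prime_step (P Q : set S) a t : prime_ideal P -> is_ideal Q -> P `<=` Q ->
  Q a -> ~ P a ->
  (hilbert_fun Q (t + (msize a).+1) + hilbert_fun P t <= hilbert_fun P (t + (msize a).+1))%N.
Proof.
move=> [hP _ Pp] hQ PQ Qa Pa.
have [c [hc ci _]] := hilbert_basis (t + (msize a).+1) hQ; have [b [hb bi _]] := hilbert_basis t hP.
set k := hilbert_fun Q _ in c hc ci *; set l := hilbert_fun P t in b hb bi *.
have -> : (k + l)%N = #|{: 'I_k + 'I_l}| by rewrite card_sum !card_ord.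
pose f (i : 'I_k + 'I_l) := match i with inl i => c i | inr j => a * b j end.
apply: (hilbert_leq hP (b := f)) => [[i|j]|x]; [exact: hc|exact/deg_leM|].
rewrite big_sumType /= => xP.
have aE : \sum_j x (inr j) *: (a * b j) = a * \sum_j x (inr j) *: b j.
  by rewrite mulr_sumr; apply: eq_bigr => j _; rewrite scalerAr.
rewrite aE in xP.
have xl i : x (inl i) = 0.
  apply: (ci (fun i => x (inl i))).
  rewrite -[X in Q X](addrK (a * \sum_j x (inr j) *: b j)).
  by apply: idealB => //; [exact: PQ|exact: ideal_mulr].
have : P (a * \sum_j x (inr j) *: b j).
  by rewrite big1 ?add0r // in xP => i _; rewrite xl scale0r.
case/Pp => // /bi xr; case=> [i|j]; [exact: xl|exact: xr].
Qed.

(* The exact sequence 0 -> (S/(I : f))(-e) -> S/I -> S/(I, f) -> 0. *)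
Lemma hilbert_add_form (D D' : {set {set 'I_n}}) f e t : down_closed D -> down_closed D' ->
  f \is e.-homog -> (forall g, face_ideal D (g * f) <-> face_ideal D' g) ->
  (hilbert_fun (ideal_gen (face_ideal D `|` [set f])) t +
    (if (e <= t)%N then hilbert_fun (face_ideal (K := K) D') (t - e)%N else 0) =
   hilbert_fun (face_ideal (K := K) D) t)%N.
Proof.
move=> dD dD' fe colE; set J := ideal_gen _.
have hD := face_ideal_ideal K dD; have hD' := face_ideal_ideal K dD'.
have hJ : is_ideal J by exact: ideal_gen_ideal.
have DJ : face_ideal D `<=` J by move=> p pD; apply: sub_ideal_gen; left.
have Jf : J f by apply: sub_ideal_gen; right.
have JE p : J p -> exists i g, face_ideal D i /\ p = i + g * f.
  move=> /(_ [set p | exists i g, face_ideal D i /\ p = i + g * f]); apply.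
    split; first by exists 0, 0; rewrite mul0r addr0; split=> //; case: hD.
    - move=> _ _ [i [g [iD ->]]] [i' [g' [i'D ->]]]; exists (i + i'), (g + g').
      by rewrite mulrDl addrACA; split=> //; case: hD => _ h _; exact: h.
    - move=> c _ [i [g [iD ->]]]; exists (c * i), (c * g).
      by rewrite mulrDr mulrA; split=> //; case: hD => _ _; exact.
  move=> p' [p'D|->]; first by exists p', 0; rewrite mul0r addr0.
  by exists 0, 1; rewrite mul1r add0r; split=> //; case: hD.
pose tr k p : S := mrestr (fun m => (mdeg m <= k)%N) p.
have trD k p : face_ideal D p -> face_ideal D (tr k p).
  by move=> pD m mD; rewrite mcoeff_mrestr pD // if_same.
have tr_le k p : deg_le k (tr k p).
  by apply/deg_leP => m; rewrite mcoeff_mrestr; case: ifP; rewrite ?eqxx.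
have trE k p : deg_le k p -> tr k p = p.
  move=> /deg_leP pk; apply/mpolyP => m; rewrite mcoeff_mrestr; case: ifP => // mk.
  by apply/esym/eqP/negPn/negP => /pk; rewrite mk.
have degM p m : (forall m1, p@_m1 != 0 -> (mdeg m1 + e)%N != mdeg m) -> (p * f)@_m = 0.
  move=> h; apply: memN_msupp_eq0; apply/negP => /msuppM_le/allpairsP[[m1 m2]] /= [m1p m2f mE].
  have := h m1; rewrite -mcoeff_msupp m1p => /(_ isT).
  by move/dhomogP: fe => /(_ _ m2f) /= m2e; rewrite mE mdegD m2e eqxx.
have trM g : tr t (g * f) = if (e <= t)%N then tr (t - e)%N g * f else 0.
  apply/mpolyP => m; rewrite mcoeff_mrestr; case: ifP => [mt|/negbT]; last first.
    rewrite -ltnNge => tm; case: ifP => et; last by rewrite mcoeff0.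
    rewrite degM // => m1; rewrite mcoeff_mrestr; case: ifP => [m1t _|]; last by rewrite eqxx.
    by rewrite ltn_eqF // (leq_ltn_trans _ tm) // -(subnK et) leq_add2r.
  case: ifP => [et|/negbT]; last first.
    rewrite -ltnNge => et; rewrite mcoeff0 degM // => m1 _.
    by rewrite gtn_eqF // (leq_ltn_trans mt) // (leq_trans et) // leq_addl.
  apply/eqP; rewrite -subr_eq0 -mcoeffB -mulrBl degM // => m1.
  rewrite mcoeffB mcoeff_mrestr; case: ifP => [|/negbT]; first by rewrite subrr eqxx.
  rewrite -ltnNge => m1t _; rewrite gtn_eqF // (leq_ltn_trans mt) //.
  by rewrite -{1}(subnK et) ltn_add2r.
have [c [hc ci csp]] := hilbert_basis t hJ.
pose l := if (e <= t)%N then hilbert_fun (face_ideal (K := K) D') (t - e)%N else 0%N.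
have [b [hb bi bsp]] : exists b : 'I_l -> S, [/\ forall i, (e <= t)%N /\ deg_le (t - e)%N (b i),
     indep_mod (face_ideal D') b & forall g, (e <= t)%N -> deg_le (t - e)%N g ->
      exists y : 'I_l -> K, face_ideal D' (g - \sum_i y i *: b i)].
  rewrite /l; case: ifP => et; last by exists (fun=> 0); split=> // [[]|y _ []].
  by have [b [hb bi bsp]] := hilbert_basis (t - e)%N hD'; exists b; split=> // g _; exact: bsp.
rewrite -/l; apply/esym; apply: hilbert_funE => //.
set k := hilbert_fun J t in c hc ci csp *.
have -> : (k + l)%N = #|{: 'I_k + 'I_l}| by rewrite card_sum !card_ord.
pose h (i : 'I_k + 'I_l) := match i with inl i => c i | inr j => b j * f end.
have hE (x : 'I_k + 'I_l -> K) : \sum_i x i *: h i = \sum_i x (inl i) *: c i + (\sum_j x (inr j) *: b j) * f.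
  rewrite big_sumType /=; congr (_ + _); rewrite mulr_suml.
  by apply: eq_bigr => j _; rewrite scalerAl.
apply: (dim_modE (b := h)); first exact: ideal_lin_closed.
- move=> [i|j]; first exact: hc.
  have [et bj] := hb j; rewrite /= -(trE _ _ bj).
  have := trM (b j); rewrite et => <-; exact: tr_le.
- move=> x; rewrite hE => xD.
  have xl i : x (inl i) = 0.
    apply: (ci (fun i => x (inl i))).
    rewrite -[X in J X](addrK ((\sum_j x (inr j) *: b j) * f)).
    apply: (idealB hJ); first exact: DJ.
    by rewrite mulrC; exact: (ideal_mulr _ hJ Jf).
  have : face_ideal D ((\sum_j x (inr j) *: b j) * f).
    by rewrite big1 ?add0r // in xD => i _; rewrite xl scale0r.
  by move=> /colE /bi xr; case=> [i|j]; [exact: xl|exact: xr].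
move=> v vt; have [x /JE[i [g [iD iE]]]] := csp v vt.
have vE : v - \sum_i x i *: c i = tr t i + tr t (g * f).
  rewrite -[LHS](trE t).
    by rewrite iE /tr; apply/mpolyP => m; rewrite mcoeffD !mcoeff_mrestr mcoeffD; case: ifP; rewrite ?addr0.
  apply: lin_closedB => //; first exact: deg_le_lin.
  by apply: lin_closed_sum => // [|i' _]; [|apply: lin_closedZ]; try exact: deg_le_lin.
have [y yE] : exists y : 'I_l -> K, face_ideal D (tr t (g * f) - (\sum_j y j *: b j) * f).
  rewrite trM; case: ifP => et; last first.
    by exists (fun=> 0); rewrite big1 ?mul0r ?subrr => [|j _]; [case: hD|rewrite scale0r].
  have [y yE] := bsp _ et (tr_le (t - e)%N g); exists y.
  by rewrite -mulrBl; apply/colE.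
exists (fun i => match i with inl i => x i | inr j => y j end); rewrite hE opprD addrA vE /=.
by rewrite -addrA; case: hD => _ hh _; apply: hh => //; exact: trD.
Qed.

End RelativeBases.

(** * Hilbert functions of face ideals and growth along chains of primes *)

Section FaceCount.
Variables (K : fieldType) (n : nat).
Local Notation S := {mpoly K[n]}.
Implicit Types (s : {set 'I_n}) (D : {set {set 'I_n}}).

(** Pascal's rule: after division by x_v the support is either still s or s without v. *)
Lemma count_mvars s t : #|[set m : 'X_{1..n < t.+1} | mvars m == s]%SET| = 'C(t, #|s|).
Proof.
elim: t s => [|t IH] s.
  have -> : [set m : 'X_{1..n < 1} | mvars m == s]%SET = (if s == finset.set0 then [set bm0] else finset.set0)%SET.
    apply/setP => m; rewrite inE; have m0 : bmnm m = 0%MM.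
      by apply/eqP; rewrite -mdeg_eq0 -leqn0 -ltnS bmdeg.
    rewrite m0 mvars0 eq_sym; case: ifP => _; rewrite inE // -val_eqE /= m0 eqxx //.
  case: eqP => [->|/eqP s0]; first by rewrite cards1 cards0 bin0.
  by rewrite cards0 bin_small // card_gt0.
have [->|[v vs]] := set_0Vmem s.
  rewrite cards0 bin0 -[RHS](cards1 (bm0 : 'X_{1..n < t.+2})); apply: eq_card => m; rewrite !inE.
  apply/eqP/eqP => [m0|->]; last by rewrite mvars0.
  apply: val_inj; apply/mnmP => i; rewrite mnm0E; apply/eqP/negPn/negP => mi.
  have : i \in mvars m by rewrite inE.
  by rewrite m0 finset.in_set0.
have cs : #|s| = #|(s :\ v)%SET|.+1 by rewrite (cardsD1 v) vs.
rewrite cs binS -cs -!IH.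
have gP (m : 'X_{1..n < t.+1}) : (mdeg (U_(v) + m)%MM < t.+2)%N by rewrite mdegD mdeg1 add1n ltnS bmdeg.
pose g m := BMultinom (gP m).
have gI : injective g.
  by move=> m m' /(congr1 (fun x => bmnm x)) /= /addmI e; apply: val_inj.
have -> : [set m : 'X_{1..n < t.+2} | mvars m == s]%SET =
    [set g m | m in [set m : 'X_{1..n < t.+1} | (mvars m == s) || (mvars m == (s :\ v)%SET)]]%SET.
  apply/setP => m; rewrite inE; apply/eqP/imsetP => [ms|[m']].
    have mv : (U_(v) <= m)%MM.
      by rewrite lep1mP; move: vs; rewrite -ms inE.
    have dm : (mdeg (m - U_(v))%MM < t.+1)%N.
      have := bmdeg m; rewrite -{1}(submK mv) mdegD mdeg1 addn1 //.
    exists (BMultinom dm); last by apply: val_inj; rewrite /= addmC submK.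
    rewrite inE /=; case: (boolP (v \in mvars (m - U_(v))%MM)) => vm; apply/orP; [left|right].
      apply/eqP; rewrite -ms -{2}(submK mv) mvarsD mvars1.
      by apply/esym/finset.setUidPl; rewrite finset.sub1set.
    apply/eqP; rewrite -ms -{2}(submK mv) mvarsD mvars1; apply/setP => x; rewrite !inE.
    by case: (eqVneq x v) => [->|_]; rewrite ?orbF //; move: vm; rewrite inE => /negbTE.
  rewrite inE => h ->; rewrite /= mvarsD mvars1; case/orP: h => /eqP ->.
    by apply/finset.setUidPr; rewrite finset.sub1set.
  by rewrite finset.setD1K.
rewrite card_imset // -cardsUI [X in (_ + X)%N](_ : _ = 0%N) ?addn0; last first.
  apply/eqP; rewrite cards_eq0; apply/eqP/setP => m; rewrite !inE.
  apply/negP => /andP[/eqP -> /eqP e]; have := setD11 v s.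
  by rewrite -e vs.
by apply: eq_card => m; rewrite !inE.
Qed.

Definition face_poly D t := (\sum_(s in D) 'C(t, #|s|))%N.

Lemma hilbert_face D t : down_closed D -> hilbert_fun (face_ideal (K := K) D) t = face_poly D t.
Proof.
move=> dD; have [hb bi bs] := face_basis K D t.
rewrite (hilbert_funE (face_ideal_ideal K dD)
  (dim_modE (ideal_lin_closed (face_ideal_ideal K dD)) hb bi bs)).
rewrite card_sig -sum1_card (partition_big (fun m : 'X_{1..n < t.+1} => mvars m) (fun s => s \in D)) //=.
apply: eq_bigr => s sD; rewrite -count_mvars -sum1_card; apply: eq_bigl => m.
by rewrite !inE; case: eqP => [->|]; rewrite ?sD ?andbF.
Qed.

Lemma leq_exp_base k a b : (a <= b)%N -> (a ^ k <= b ^ k)%N.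
Proof. by case: k => // k; rewrite leq_exp2r. Qed.

Definition growth (J : set S) g := exists C t0, forall t, (t0 <= t)%N -> (hilbert_fun J t <= C * t.+1 ^ g)%N.

(** Iterating [hilbert_prime_step] gives k H_Q(t) <= H_P(t + k e). With k = t + 1 the growth
    exponent drops by one; for g = 0, k = C + 1 contradicts H_Q > 0. *)
Lemma growth_step (P Q : set S) g : prime_ideal P -> is_ideal Q -> ~ Q 1 -> P `<` Q ->
  growth P g -> (0 < g)%N /\ growth Q g.-1.
Proof.
move=> hP hQ Q1 [PQ nQP] [C [t0 HC]]; have [P1 _ _] := hP.
have [a Qa Pa] : exists2 a, Q a & ~ P a.
  by apply: contrapT => h; apply: nQP => a Qa; apply: contrapT => Pa; apply: h; exists a.
pose e := (msize a).+1.
have step t : (hilbert_fun Q (t + e) + hilbert_fun P t <= hilbert_fun P (t + e))%N.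
  exact: hilbert_prime_step.
have sum_step t k : (k * hilbert_fun Q t <= hilbert_fun P (t + k * e))%N.
  elim: k => [|k IH]; first by rewrite mul0n.
  rewrite mulSn; apply: leq_trans (_ : hilbert_fun Q (t + k * e + e) + hilbert_fun P (t + k * e) <= _)%N.
    by apply: leq_add => //; apply: hilbert_mono => //; rewrite -addnA leq_addr.
  by rewrite mulSn [(e + _)%N]addnC addnA step.
case: g HC => [|g] HC.
  have := leq_trans (sum_step t0 C.+1) (HC _ (leq_addr _ _)).
  rewrite expn0 muln1 => h; have := hilbert_gt0 t0 hQ Q1.
  by move=> Q0; have := leq_trans (leq_pmulr C.+1 Q0) h; rewrite ltnn.
split=> //; exists (C * e.+1 ^ g.+1)%N, t0 => t tt /=.
have := leq_trans (sum_step t t.+1) (HC _ (leq_trans tt (leq_addr _ _))).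
have le1 : ((t + t.+1 * e).+1 <= t.+1 * e.+1)%N by rewrite mulnS addSn.
move=> h; have {h} h := leq_trans h (leq_mul (leqnn C) (leq_exp_base g.+1 le1)).
rewrite -(leq_pmul2l (ltn0Sn t)); apply: leq_trans h _.
by rewrite expnMn (expnS t.+1) !mulnA [(C * t.+1)%N]mulnC -!mulnA [(t.+1 ^ g * _)%N]mulnC leqnn.
Qed.

Lemma growth_sub (J J' : set S) g : is_ideal J -> is_ideal J' -> J `<=` J' -> growth J g -> growth J' g.
Proof.
move=> hJ hJ' JJ' [C [t0 h]]; exists C, t0 => t /h; apply: leq_trans; exact: hilbert_mono.
Qed.

Lemma growth_chain (J : set S) g k : is_ideal J -> growth J g -> prime_chain J k -> (k <= g)%N.
Proof.
move=> hJ gJ [p [pP pS]]; rewrite leqNgt; apply/negP => gk.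
have pI i : (i <= k)%N -> is_ideal (p i) by move=> /pP[[]].
have : forall i, (i <= g)%N -> growth (p i) (g - i)%N.
  elim=> [|i IH] ig.
    by rewrite subn0; case: (pP 0%N isT) => [[p0 _ _] Jp0]; exact: growth_sub gJ.
  have ik : (i < k)%N by apply: leq_trans ig (ltnW gk).
  have [hP _] := pP i (ltnW ik); have [[hQ Q1 _] _] := pP i.+1 ik.
  have [_] := growth_step hP hQ Q1 (pS i ik) (IH (ltnW ig)); by rewrite subnS.
move=> /(_ g (leqnn g)); rewrite subnn => gg.
have [hP _] := pP g (ltnW gk); have [[hQ Q1 _] _] := pP g.+1 gk.
by have [] := growth_step hP hQ Q1 (pS g gk) gg.
Qed.

(** Deleting the vertices of s one at a time enlarges the prime strictly. This is the lower bound
    for dimensions, matched by [growth_chain]. *)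
Lemma face_prime_chain (J : set S) s : J `<=` face_prime s -> prime_chain J #|s|.
Proof.
move=> Js; pose d i : {set 'I_n} := [set x in drop i (enum s)]%SET.
have ds i : d i \subset s.
  by apply/fintype.subsetP => x; rewrite inE => /mem_drop; rewrite mem_enum.
exists (fun i => face_prime (d i)); split=> i ik.
  split; first exact: face_prime_prime.
  by apply: subset_trans Js _; apply/face_prime_subset.
have iE : (i < size (enum s))%N by rewrite -cardE.
have [x0 _] : exists x0 : 'I_n, true by move: iE; case: (enum s) => // x0; exists x0.
split.
  apply/face_prime_subset/fintype.subsetP => x; rewrite !inE (drop_nth x0 iE) inE => ->.
  by rewrite orbT.
move=> /face_prime_subset/fintype.subsetP/(_ (nth x0 (enum s) i)); rewrite !inE.
have := drop_uniq i (enum_uniq s); rewrite (drop_nth x0 iE) /= => /andP[ni _].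
by rewrite mem_head (negbTE ni) => /(_ isT).
Qed.

End FaceCount.

(** * Limits of normalized binomial coefficients *)

Section Asymptotics.
Implicit Types (u v : nat -> rat) (l : rat).

(* Convergence with error O(1/t): unlike [converges], trivially stable under products. *)
Definition conv1 u l := exists C t0, forall t, (t0 <= t)%N -> `|u t - l| * t%:R <= C.

Lemma conv1_ext u v l t1 : (forall t, (t1 <= t)%N -> u t = v t) -> conv1 u l -> conv1 v l.
Proof.
move=> uv [C [t0 h]]; exists C, (maxn t0 t1) => t; rewrite geq_max => /andP[/h + /uv <-] //.
Qed.

Lemma conv1_cst l : conv1 (fun=> l) l.
Proof. by exists 0, 0%N => t _; rewrite subrr normr0 mul0r. Qed.

Lemma conv1D u v l m : conv1 u l -> conv1 v m -> conv1 (fun t => u t + v t) (l + m).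
Proof.
move=> [C [t0 h]] [C' [t0' h']]; exists (C + C'), (maxn t0 t0') => t.
rewrite geq_max => /andP[/h a /h' b]; apply: le_trans (lerD a b).
by rewrite -mulrDl ler_wpM2r // opprD addrACA ler_normD.
Qed.

Lemma conv1M u v l m : conv1 u l -> conv1 v m -> conv1 (fun t => u t * v t) (l * m).
Proof.
move=> [C [t0 h]] [C' [t0' h']]; exists ((`|l| + `|C|) * C' + `|m| * C), (maxn 1 (maxn t0 t0')) => t.
rewrite !geq_max => /andP[t1 /andP[/h a /h' b]].
have T1 : 1 <= t%:R :> rat by rewrite ler1n.
have -> : u t * v t - l * m = u t * (v t - m) + m * (u t - l) by ring.
apply: le_trans (ler_wpM2r _ (ler_normD _ _)) _ => //.
rewrite mulrDl !normrM -!mulrA; apply: lerD; last by apply: ler_wpM2l.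
apply: ler_pM => //; first by rewrite mulr_ge0.
rewrite -[u t](subrK l) addrC; apply: le_trans (ler_normD _ _) _; rewrite lerD2l.
apply: le_trans (_ : `|u t - l| * t%:R <= _); first by rewrite ler_peMr.
exact: le_trans a (ler_norm _).
Qed.

Lemma conv1Z a u l : conv1 u l -> conv1 (fun t => a * u t) (a * l).
Proof. by apply: conv1M; exact: conv1_cst. Qed.

Lemma conv1N u l : conv1 u l -> conv1 (fun t => - u t) (- l).
Proof.
by move=> [C [t0 h]]; exists C, t0 => t /h; rewrite -opprD normrN.
Qed.

Lemma conv1_sum (T : Type) (r : seq T) (P : pred T) (u : T -> nat -> rat) (l : T -> rat) :
  (forall i, P i -> conv1 (u i) (l i)) ->
  conv1 (fun t => \sum_(i <- r | P i) u i t) (\sum_(i <- r | P i) l i).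
Proof.
move=> h; elim: r => [|i r IH].
  by rewrite big_nil; apply: (conv1_ext (t1 := 0%N)) (conv1_cst 0) => t _; rewrite big_nil.
rewrite big_cons; case: ifP => Pi; last by apply: (conv1_ext (t1 := 0%N)) IH => t _; rewrite big_cons Pi.
by apply: (conv1_ext (t1 := 0%N)) (conv1D (h _ Pi) IH) => t _; rewrite big_cons Pi.
Qed.

Lemma conv1_inv : conv1 (fun t => t%:R^-1) 0.
Proof.
exists 1, 1%N => t t1; rewrite subr0 ger0_norm ?invr_ge0 // mulVf //.
by rewrite pnatr_eq0 -lt0n.
Qed.

Lemma conv1X u l k : conv1 u l -> conv1 (fun t => u t ^+ k) (l ^+ k).
Proof.
move=> h; elim: k => [|k IH]; first by apply: conv1_cst.
rewrite exprS; apply: (conv1_ext (t1 := 0%N)) (conv1M h IH) => t _; by rewrite exprS.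
Qed.

Lemma conv1_converges u l : conv1 u l -> converges u l.
Proof.
move=> [C [t0 h]] e e0; pose T := Num.bound (`|C| / e).
exists (maxn T.+1 t0) => t; rewrite geq_max => /andP[tT /h a].
have t1 : 0 < t%:R :> rat by rewrite ltr0n (leq_ltn_trans _ tT).
rewrite -(ltr_pM2r t1); apply: le_lt_trans a _; apply: le_lt_trans (ler_norm _) _.
rewrite -ltr_pdivrMl // mulrC; apply: lt_trans (_ : T%:R < _); last by rewrite ltr_nat.
by apply: archi_boundP; rewrite divr_ge0 // ltW.
Qed.

Lemma converges_uniq u l l' : converges u l -> converges u l' -> l = l'.
Proof.
move=> hl hl'; apply/eqP/negPn/negP => ne.
have e0 : 0 < `|l - l'| / 2 by rewrite divr_gt0 // normr_gt0 subr_eq0.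
have [N hN] := hl _ e0; have [N' hN'] := hl' _ e0.
have a := hN (maxn N N') (leq_maxl _ _); have b := hN' (maxn N N') (leq_maxr _ _).
have := ler_distD (u (maxn N N')) l l'; rewrite [`|l - u _|]distrC => c.
have := ltrD a b; rewrite -splitr => d.
by have := le_lt_trans c d; rewrite ltxx.
Qed.

Lemma conv1_bounded u l : conv1 u l -> exists (B : nat) t0, forall t, (t0 <= t)%N -> u t <= B%:R.
Proof.
move=> [C [t0 h]]; exists (Num.bound (`|l| + `|C|)), (maxn 1 t0) => t; rewrite geq_max => /andP[t1 /h a].
apply: ltW; apply: le_lt_trans (archi_boundP _); last by rewrite addr_ge0.
rewrite -[u t](subrK l) addrC; apply: lerD; first exact: ler_norm.
apply: le_trans (ler_norm _) _; apply: le_trans (_ : `|u t - l| * t%:R <= _).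
  by rewrite ler_peMr // ler1n.
exact: le_trans a (ler_norm _).
Qed.

Lemma conv1_ffact a k : conv1 (fun t => (((t - a) ^_ k)%N)%:R / t%:R ^+ k) 1.
Proof.
elim: k => [|k IH].
  by apply: (conv1_ext (t1 := 0%N)) (conv1_cst 1) => t _; rewrite ffactn0 expr0 divr1.
have lin : conv1 (fun t => 1 - (a + k)%:R * t%:R^-1) 1.
  rewrite [X in conv1 _ X](_ : 1 = 1 - (a + k)%:R * 0); last by rewrite mulr0 subr0.
  apply: conv1D; first exact: conv1_cst.
  by apply: conv1N; apply: conv1Z; exact: conv1_inv.
rewrite -[X in conv1 _ X]mulr1; apply: (conv1_ext (t1 := (a + k).+1)) (conv1M IH lin) => t tk; have t0 : t%:R != 0 :> rat by rewrite pnatr_eq0 -lt0n (leq_ltn_trans _ tk).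
rewrite ffactnSr natrM -subnDA natrB; last exact: ltnW.
by rewrite exprSr; field; rewrite t0 expf_neq0.
Qed.

Lemma conv1_bin a k d : (k <= d)%N ->
  conv1 (fun t => d`!%:R * ('C(t - a, k)%:R / t%:R ^+ d)) (k == d)%:R.
Proof.
move=> kd; have fk j : j`!%:R != 0 :> rat by rewrite pnatr_eq0 -lt0n fact_gt0.
have h := conv1Z (d`!%:R / k`!%:R) (conv1M (conv1_ffact a k) (conv1X (d - k) conv1_inv)).
have e : (d`!%:R / k`!%:R) * (1 * 0 ^+ (d - k)) = (k == d)%:R :> rat.
  rewrite mul1r expr0n subn_eq0; case: eqP => [->|kd']; first by rewrite leqnn mulr1 divff.
  by rewrite leqNgt ltn_neqAle kd andbT; move/eqP: kd' => -> /=; rewrite mulr0.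
rewrite e in h; apply: (conv1_ext (t1 := 1%N)) h => t t1.
have t0 : t%:R != 0 :> rat by rewrite pnatr_eq0 -lt0n.
have -> : t%:R ^+ d = t%:R ^+ (d - k) * t%:R ^+ k :> rat by rewrite -exprD subnK.
rewrite -bin_ffact natrM exprVn.
by field; rewrite ?fk ?expf_neq0.
Qed.

(** The difference telescopes into e binomials ['C(t - j, g)], each with normalized limit 1. *)
Lemma conv1_binB e g :
  conv1 (fun t => g`!%:R * (('C(t, g.+1)%:R - 'C(t - e, g.+1)%:R) / t%:R ^+ g)) e%:R.
Proof.
elim: e => [|e IH].
  by apply: (conv1_ext (t1 := 0%N)) (conv1_cst 0) => t _; rewrite subn0 subrr mul0r mulr0.
have h := conv1_bin e.+1 (leqnn g); rewrite eqxx in h.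
rewrite -natr1; apply: (conv1_ext (t1 := e.+1)) (conv1D IH h) => t te.
rewrite -mulrDr -mulrDl; congr (_ * (_ / _)).
have -> : (t - e = (t - e.+1).+1)%N by rewrite subnSK.
by rewrite binS natrD; ring.
Qed.

End Asymptotics.

Lemma nat_maxE (X : set nat) m : X m -> (forall k, X k -> (k <= m)%N) -> nat_max X = m.
Proof.
move=> Xm mX; rewrite /nat_max; case: xgetP => [k _ [Xk kX]|/(_ m)/= h]; last by case: h.
by apply/eqP; rewrite eqn_leq mX // kX.
Qed.

Lemma nat_max_le (X : set nat) g : (forall k, X k -> (k <= g)%N) -> (nat_max X <= g)%N.
Proof. by move=> gX; rewrite /nat_max; case: xgetP => // k _ [/gX]. Qed.

Lemma nat_max_ub (X : set nat) g k : (forall k, X k -> (k <= g)%N) -> X k -> (k <= nat_max X)%N.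
Proof.
move=> gX Xk; have P0 : exists k, `[< X k >] by exists k; apply/asboolP.
have Pm j : `[< X j >] -> (j <= g)%N by move=> /asboolP/gX.
have [m /asboolP Xm mm] := ex_maxnP P0 Pm.
have mX j : X j -> (j <= m)%N by move=> Xj; apply: mm; exact/asboolP.
by rewrite (nat_maxE Xm mX) mX.
Qed.

Section Multiplicity.
Variables (K : fieldType) (n : nat).
Local Notation S := {mpoly K[n]}.
Implicit Types (J : set S) (D : {set {set 'I_n}}).

(** The normalized coefficient of t^g in the Hilbert function; it is the multiplicity once a chain
    of g + 1 primes shows that the dimension is g. *)
Definition lead J g (L : nat) := conv1 (fun t => g`!%:R * ((hilbert_fun J t)%:R / t%:R ^+ g)) L%:R.

Lemma lead_growth J g L : lead J g L -> growth J g.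
Proof.
move=> /conv1_bounded[B [t0 h]]; exists B, (maxn 1 t0) => t; rewrite geq_max => /andP[t1 /h].
have tg : 0 < t%:R ^+ g :> rat by rewrite exprn_gt0 // ltr0n.
rewrite mulrA ler_pdivrMr // -natrX -!natrM ler_nat => hB.
apply: leq_trans (leq_pmull _ (fact_gt0 g)) _; apply: leq_trans hB _.
by rewrite leq_mul // leq_exp_base.
Qed.

Lemma lead_krull_le J g L : is_ideal J -> lead J g L -> (krull_dim J <= g)%N.
Proof. by move=> hJ /lead_growth gJ; apply: nat_max_le => k; exact: growth_chain. Qed.

Lemma lead_krull J g L : is_ideal J -> lead J g L -> prime_chain J g -> krull_dim J = g.
Proof. by move=> hJ /lead_growth gJ ch; apply: nat_maxE => // k; exact: growth_chain. Qed.

Lemma lead_multiplicity J g L : is_ideal J -> lead J g L -> prime_chain J g -> multiplicity J = L.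
Proof.
move=> hJ ld ch; rewrite /multiplicity (lead_krull hJ ld ch) /=.
have cL := conv1_converges ld.
case: xgetP => [e _ /= /(converges_uniq cL)/eqP|/(_ L)//].
by rewrite eqr_nat => /eqP.
Qed.

(* If the dimension falls short of g, the defining sequence diverges and the
   multiplicity is the default value 0. *)
Lemma lead_multiplicity_le J g L : is_ideal J -> lead J g L -> (0 < L)%N -> (multiplicity J <= L)%N.
Proof.
move=> hJ ld L0; have cL := conv1_converges ld; have := lead_krull_le hJ ld.
rewrite /multiplicity; set d := krull_dim J; rewrite leq_eqVlt => /orP[/eqP ->|dg].
  case: xgetP => // e _ /= /(converges_uniq cL)/eqP.
  by rewrite eqr_nat => /eqP ->.
case: xgetP => // e _ /= ce; exfalso.
have [t0 ht] := ce 1 ltr01; have fk j : j`!%:R != 0 :> rat by rewrite pnatr_eq0 -lt0n fact_gt0.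
pose w t := d`!%:R * ((hilbert_fun J t)%:R / t%:R ^+ d) : rat.
have wb t : (t0 <= t)%N -> `|w t| <= e%:R + 1.
  move=> /ht /ltW h; rewrite -[w t](subrK e%:R) addrC.
  by apply: le_trans (ler_normD _ _) _; rewrite normr_nat lerD2l.
have : conv1 (fun t => g`!%:R * ((hilbert_fun J t)%:R / t%:R ^+ g)) 0.
  have z : conv1 (fun t => w t * t%:R^-1) 0.
    exists (e%:R + 1), (maxn 1 t0) => t; rewrite geq_max => /andP[t1 /wb].
    have tn : t%:R != 0 :> rat by rewrite pnatr_eq0 -lt0n.
    by rewrite subr0 (normrM (w t) (t%:R^-1)) normfV normr_nat -mulrA mulVf // mulr1.
  have := conv1Z (g`!%:R / d`!%:R) (conv1M z (conv1X (g - d.+1) conv1_inv)).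
  rewrite mul0r mulr0; apply: (conv1_ext (t1 := 1%N)) => t t1.
  have tn : t%:R != 0 :> rat by rewrite pnatr_eq0 -lt0n.
  have -> : t%:R ^+ g = t%:R * t%:R ^+ d * t%:R ^+ (g - d.+1) :> rat by rewrite -exprS -exprD subnKC.
  have te : t%:R ^+ d != 0 :> rat by rewrite expf_neq0.
  have te' : t%:R ^+ (g - d.+1) != 0 :> rat by rewrite expf_neq0.
  rewrite /w exprVn; move: (fk d) te te' tn.
  move: (d`!%:R : rat) (g`!%:R : rat) (t%:R : rat) (t%:R ^+ d : rat) (t%:R ^+ (g - d.+1) : rat) ((hilbert_fun J t)%:R : rat).
  by move=> x y r p p' h xn pn pn' rn; field; rewrite xn pn pn' rn.
move/conv1_converges/(converges_uniq cL)/eqP; rewrite pnatr_eq0; by case: (L) L0.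
Qed.

Definition faces_dim D k : {set {set 'I_n}} := [set s in D | #|s| == k]%SET.

Lemma conv1_face_poly a D d : (forall s, s \in D -> (#|s| <= d)%N) ->
  conv1 (fun t => d`!%:R * ((face_poly D (t - a))%:R / t%:R ^+ d)) #|faces_dim D d|%:R.
Proof.
move=> hD; have -> : #|faces_dim D d|%:R = \sum_(s in D) (#|s| == d)%:R :> rat.
  rewrite -natr_sum -sum1_card; congr _%:R; rewrite -big_mkcondr /=.
  by apply: eq_bigl => s; rewrite inE.
have h : conv1 (fun t => \sum_(s in D) d`!%:R * ('C(t - a, #|s|)%:R / t%:R ^+ d))
    (\sum_(s in D) (#|s| == d)%:R).
  by apply: conv1_sum => s /hD; exact: conv1_bin.
apply: (conv1_ext (t1 := 0%N)) h => t _.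
by rewrite /face_poly natr_sum mulr_suml mulr_sumr.
Qed.

End Multiplicity.

(** * Adding a form to a face ideal *)

Section AddForm.
Variables (K : fieldType) (n : nat).
Local Notation S := {mpoly K[n]}.
Implicit Types (D : {set {set 'I_n}}) (f g : S).

Definition avoid D f : {set {set 'I_n}} :=
  [set s : {set 'I_n} | [exists F : {set 'I_n}, [&& F \in facets D, ~~ `[< face_prime F f >] & s \subset F]]]%SET.

Lemma mem_avoid D f s :
  s \in avoid D f <-> exists F, [/\ F \in facets D, ~ face_prime F f & s \subset F].
Proof.
rewrite inE; split=> [/existsP[F /and3P[FD /asboolP Ff sF]]|[F [FD /asboolPn Ff sF]]]; first by exists F.
by apply/existsP; exists F; rewrite FD Ff.
Qed.

Lemma avoid_down D f : down_closed (avoid D f).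
Proof.
move=> s t /mem_avoid[F [FD Ff sF]] ts; apply/mem_avoid; exists F; split=> //.
exact: fintype.subset_trans ts sF.
Qed.

Lemma avoid_sub D f s : down_closed D -> s \in avoid D f -> s \in D.
Proof. by move=> dD /mem_avoid[F [/mem_facets[FD _] _ sF]]; exact: dD FD sF. Qed.

Lemma mem_avoid_facet D f F : F \in facets D -> F \in avoid D f <-> ~ face_prime F f.
Proof.
move=> FD; split=> [/mem_avoid[G [GD Gf FG]]|Ff]; last first.
  by apply/mem_avoid; exists F; split.
have [_ Fmax] := iffLR (mem_facets _ _) FD; have [GD' _] := iffLR (mem_facets _ _) GD.
by rewrite -(Fmax _ GD' FG).
Qed.

Lemma colon_avoid D f g : down_closed D ->
  face_ideal D (g * f) <-> face_ideal (avoid D f) g.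
Proof.
move=> dD; split=> [gfD m /mem_avoid[F [FD Ff mF]]|gD].
  have := iffLR (face_ideal_facets _ dD) gfD F FD.
  case/(face_primeM F) => // Fg; apply: Fg; by rewrite inE.
apply/face_ideal_facets => // F FD; have [_ _ pF] := face_prime_prime K F.
have [hF _ _] := face_prime_prime K F.
have [Ff|Ff] := pselect (face_prime F f); first by case: hF => _ _; exact.
apply: (ideal_mulr f hF) => m; rewrite inE => mF; apply: gD.
by apply: (avoid_down (s := F)) mF; exact/mem_avoid_facet.
Qed.

Lemma not_face_ideal D f : down_closed D ->
  ~ face_ideal D f <-> exists2 F, F \in facets D & ~ face_prime F f.
Proof.
move=> dD; rewrite (face_ideal_facets _ dD); split=> [h|[F FD Ff] /(_ F FD)//].
by apply: contrapT => h'; apply: h => F FD; apply: contrapT => Ff; apply: h'; exists F.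
Qed.

(** The colon ideal belongs to the subcomplex [avoid D f]; if f lies in the prime of a facet F, this
    facet is lost and x_F enters the colon. *)
Lemma colon_neq D f : down_closed D ->
  colon (face_ideal D) f <> face_ideal D <-> exists2 F, F \in facets D & face_prime F f.
Proof.
move=> dD; have -> : colon (face_ideal D) f = face_ideal (avoid D f).
  by apply/seteqP; split=> g /(colon_avoid f g dD).
split=> [h|[F FD Ff] e].
  apply: contrapT => h'; apply: h; congr face_ideal; apply/setP => s; apply/idP/idP.
    exact: avoid_sub.
  move=> /ex_facet[F FD sF]; apply/mem_avoid; exists F; split=> // Ff.
  by apply: h'; exists F.
have [FD' _] := iffLR (mem_facets _ _) FD.
have : face_ideal (avoid D f) ('X_[smon F] : S).
  apply/face_idealX; rewrite mvars_smon; apply/negP => /(mem_avoid_facet f FD).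
  exact.
by rewrite e => /face_idealX; rewrite mvars_smon FD'.
Qed.

Lemma zero_div_formsP D t f : down_closed D -> zero_div_forms (face_ideal D) t f <->
  [/\ f \is t.-homog, exists2 F, F \in facets D & ~ face_prime F f &
      exists2 F, F \in facets D & face_prime F f].
Proof.
move=> dD; split=> [[h /not_face_ideal h1 /(colon_neq _ dD) h2]|[h h1 h2]]; split=> //.
- exact: h1.
- exact/not_face_ideal.
- exact/colon_neq.
Qed.

Section Top.
Variables (D : {set {set 'I_n}}) (d : nat).
Hypotheses (dD : down_closed D) (Dd : forall s, s \in D -> (#|s| <= d)%N).

Local Notation top := (faces_dim D d).
Local Notation ideal_add f := (ideal_gen (face_ideal D `|` [set f])).
Definition vanishing_facets f : {set {set 'I_n}} := [set F in faces_dim D d | `[< face_prime F f >]]%SET.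

Lemma vanishing_facetsP f F : F \in vanishing_facets f <-> F \in top /\ face_prime F f.
Proof. by rewrite inE; split=> [/andP[? /asboolP]|[? /asboolP ?]]; rewrite // andbC; apply/andP. Qed.

Lemma top_facet F : F \in top -> F \in facets D.
Proof.
rewrite inE => /andP[FD /eqP cF]; apply/mem_facets; split=> // t tD Ft.
by apply/esym/eqP; rewrite eqEcard Ft cF Dd.
Qed.

Lemma is_ideal_add f : is_ideal (ideal_add f).
Proof. exact: ideal_gen_ideal. Qed.

Lemma ideal_add_prime f s : s \in D -> face_prime s f -> ideal_add f `<=` face_prime s.
Proof.
move=> sD sf p /(_ (face_prime s)); apply; first by case: (face_prime_prime K s).
by move=> q [qD|->] // m; rewrite inE => ms; apply: qD; exact: dD sD ms.
Qed.

Lemma hilbert_ideal_add f e t : f \is e.-homog -> (e <= t)%N ->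
  (hilbert_fun (ideal_add f) t + face_poly (avoid D f) (t - e) = face_poly D t)%N.
Proof.
move=> fe et; have := hilbert_add_form t dD (avoid_down (D := D) (f := f)) fe (fun g => colon_avoid f g dD).
by rewrite et !hilbert_face //; exact: avoid_down.
Qed.

Lemma avoid_top f : (faces_dim (avoid D f) d = top :\: vanishing_facets f)%SET.
Proof.
apply/setP => s; rewrite finset.in_setD; apply/idP/andP => [|[ns sT]].
  rewrite inE => /andP[sA cs]; have sT : s \in top by rewrite inE cs andbT (avoid_sub dD sA).
  split=> //; apply/negP => /vanishing_facetsP[_]; exact/(mem_avoid_facet f (top_facet sT)).
rewrite inE; apply/andP; split; last by move: sT; rewrite inE => /andP[].
by apply/(mem_avoid_facet f (top_facet sT)) => sf; move/negP: ns; apply; apply/vanishing_facetsP.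
Qed.

Lemma lead_face_ideal : lead (face_ideal (K := K) D) d #|top|.
Proof.
apply: (conv1_ext (t1 := 0%N)) (conv1_face_poly 0 Dd) => t _.
by rewrite subn0 hilbert_face.
Qed.

Lemma lead_ideal_add_top f e : f \is e.-homog -> lead (ideal_add f) d #|vanishing_facets f|.
Proof.
move=> fe; have Ad s : s \in avoid D f -> (#|s| <= d)%N by move=> /(avoid_sub dD)/Dd.
rewrite /lead; have -> : #|vanishing_facets f|%:R = #|top|%:R - #|faces_dim (avoid D f) d|%:R :> rat.
  rewrite avoid_top cardsD (finset.setIidPr _); last by apply/fintype.subsetP => s /vanishing_facetsP[].
  rewrite natrB; first by ring.
  by apply/subset_leq_card/fintype.subsetP => s /vanishing_facetsP[].
apply: (conv1_ext (t1 := e)) (conv1D (conv1_face_poly 0 Dd) (conv1N (conv1_face_poly e Ad))) => t et.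
by rewrite subn0 -(hilbert_ideal_add fe et) natrD -mulrBr -mulrBl addrK.
Qed.

Lemma multiplicity_ideal_add_top f e : f \is e.-homog -> vanishing_facets f != finset.set0 ->
  multiplicity (ideal_add f) = #|vanishing_facets f|.
Proof.
move=> fe /set0Pn[F /vanishing_facetsP[FT Ff]].
apply: lead_multiplicity (is_ideal_add f) (lead_ideal_add_top fe) _.
move: FT; rewrite inE => /andP[FD /eqP <-]; apply: face_prime_chain.
exact: ideal_add_prime.
Qed.

Lemma krull_dim_face_ideal : top != finset.set0 -> krull_dim (face_ideal (K := K) D) = d.
Proof.
move=> /set0Pn[F]; rewrite inE => /andP[FD /eqP cF].
apply: lead_krull (face_ideal_ideal K dD) lead_face_ideal _.
rewrite -cF; apply: face_prime_chain; apply: face_idealS.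
by apply/fintype.subsetP => s; rewrite inE; exact: dD.
Qed.

Lemma multiplicity_face_ideal : top != finset.set0 -> multiplicity (face_ideal (K := K) D) = #|top|.
Proof.
move=> /set0Pn[F]; rewrite inE => /andP[FD /eqP cF].
apply: lead_multiplicity (face_ideal_ideal K dD) lead_face_ideal _.
rewrite -cF; apply: face_prime_chain; apply: face_idealS.
by apply/fintype.subsetP => s; rewrite inE; exact: dD.
Qed.

End Top.

Lemma face_poly_split D (g t : nat) : (forall s, s \in D -> (#|s| <= g.+1)%N) ->
  face_poly D t = (#|faces_dim D g.+1| * 'C(t, g.+1) + face_poly [set s in D | #|s| <= g]%N%SET t)%N.
Proof.
move=> Dg; rewrite /face_poly (bigID (fun s : {set 'I_n} => #|s| == g.+1)) /=; congr (_ + _)%N.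
  rewrite -sum1_card big_distrl /=; apply: eq_big => [s|s /andP[_ /eqP ->]]; first by rewrite inE.
  by rewrite mul1n.
apply: eq_bigl => s; rewrite inE; case: (boolP (s \in D)) => //= /Dg.
by rewrite leq_eqVlt ltnS; case: eqP => //= -> _; rewrite ltnn.
Qed.

Section Regular.
Variables (D : {set {set 'I_n}}) (g : nat) (f : S) (e : nat).
Hypotheses (dD : down_closed D) (Dg : forall s, s \in D -> (#|s| <= g.+1)%N).
Hypotheses (fe : f \is e.-homog) (f0 : vanishing_facets D g.+1 f = finset.set0).

Local Notation low A := ([set s in A | #|(s : {set 'I_n})| <= g]%N%SET).
Local Notation ideal_add f := (ideal_gen (face_ideal D `|` [set f])).
Let A := avoid D f.
(** The coefficient of t^g / g! in H_D(t) - H_D'(t - e), D' being [avoid D f]. Faces of size g + 1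
    all survive in D', and each contributes e by [conv1_binB]; the faces of size g missing from D'
    give the rest. *)
Let Nf := (#|faces_dim D g.+1| * e + (#|faces_dim (low D) g| - #|faces_dim (low A) g|))%N.

Lemma lead_ideal_add_regular : lead (ideal_add f) g Nf.
Proof.
have Ag s : s \in A -> (#|s| <= g.+1)%N by move=> /(avoid_sub dD)/Dg.
have AD : faces_dim A g.+1 = faces_dim D g.+1 by rewrite (avoid_top dD Dg) f0 finset.setD0.
have lowg (B : {set {set 'I_n}}) s : s \in low B -> (#|s| <= g)%N by rewrite inE => /andP[].
have sub : faces_dim (low A) g \subset faces_dim (low D) g.
  by apply/fintype.subsetP => s; rewrite /faces_dim finset.in_set [s \in low A]finset.in_set => /andP[/andP[/(avoid_sub dD) sD sg] cs]; rewrite !inE sD sg.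
rewrite /lead natrD natrM natrB ?subset_leq_card //.
have h := conv1D (conv1Z #|faces_dim D g.+1|%:R (conv1_binB e g))
  (conv1D (conv1_face_poly 0 (@lowg D)) (conv1N (conv1_face_poly e (@lowg A)))).
apply: (conv1_ext (t1 := e)) h => t et; rewrite subn0.
have := hilbert_ideal_add dD fe et; rewrite !(face_poly_split _ Dg) (face_poly_split _ Ag) AD.
move/(congr1 (fun x => x%:R : rat)); rewrite !natrD !natrM => H.
rewrite -[(hilbert_fun _ t)%:R](addrK (#|faces_dim D g.+1|%:R * 'C(t - e, g.+1)%:R + (face_poly (low A) (t - e))%:R)) H.
by ring.
Qed.

(** A crude bound, uniform in f, which guarantees that the maximum in [min_dist] exists. *)
Lemma multiplicity_ideal_add_le : (0 < e)%N -> faces_dim D g.+1 != finset.set0 ->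
  (multiplicity (ideal_add f) <= #|faces_dim D g.+1| * e + #|{set 'I_n}|)%N.
Proof.
rewrite -card_gt0 => e0 T0.
apply: leq_trans (lead_multiplicity_le (is_ideal_add _ _) lead_ideal_add_regular _) _.
  by rewrite addn_gt0 muln_gt0 T0 e0.
by rewrite leq_add2l; apply: leq_trans (leq_subr _ _) (max_card _).
Qed.

(** The face s gives a chain of g + 1 primes, so the dimension is exactly g and the leading
    coefficient is the multiplicity. *)
Lemma multiplicity_ideal_add_ge s : s \in D -> #|s| = g -> face_prime s f ->
  (#|faces_dim D g.+1| * e <= multiplicity (ideal_add f))%N.
Proof.
move=> sD cs sf; have ch : prime_chain (ideal_add f) g.
  by rewrite -cs; apply: face_prime_chain; exact: ideal_add_prime.
by rewrite (lead_multiplicity (is_ideal_add _ _) lead_ideal_add_regular ch) leq_addr.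
Qed.

End Regular.

End AddForm.

(** * The minimum distance function *)

Section MinDist.
Variables (K : fieldType) (n : nat).
Local Notation S := {mpoly K[n]}.
Implicit Types (D : {set {set 'I_n}}) (f : S).

Lemma mvars_smonX (R : {set 'I_n}) v k : v \in R -> mvars (smon R + U_(v) *+ k)%MM = R.
Proof.
move=> vR; apply/setP => i; rewrite -[in RHS](mvars_smon R) !inE mnmDE mulmnE mnm1E.
have [<-|_] := eqVneq v i; last by rewrite mul0n addn0.
have : v \in mvars (smon R) by rewrite mvars_smon.
by rewrite inE mul1n addn_eq0 negb_and => ->.
Qed.

Lemma mdeg_smonX (R : {set 'I_n}) v t : (#|R| <= t)%N -> mdeg (smon R + U_(v) *+ (t - #|R|))%MM = t.
Proof. by move=> Rt; rewrite mdegD mdeg_smon mdegMn mdeg1 mul1n subnKC. Qed.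

Lemma regularity_index_stable (I : set S) k l : (forall t, (k <= t)%N -> min_dist I t = l) ->
  (exists r, regularity_index I r) /\ forall r, regularity_index I r -> (r <= k)%N.
Proof.
move=> h; have cl : converges (fun t => (min_dist I t)%:~R) l%:~R.
  by move=> e e0; exists k => t /h ->; rewrite subrr normr0.
split=> [|r [l' [cl' _]]]; last first.
  by apply; rewrite h //; apply/eqP; rewrite -(eqr_int rat) (converges_uniq cl cl').
have ex : exists s, min_dist I s == l by exists k; rewrite h.
have [r /eqP rl rmin] := ex_minnP ex.
by exists r, l; split=> // s /eqP; exact: rmin.
Qed.

Section Faces.
Variables (D : {set {set 'I_n}}) (d : nat).
Hypotheses (dD : down_closed D) (Dd : forall s, s \in D -> (#|s| <= d)%N).
Local Notation I := (face_ideal (K := K) D).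
Local Notation top := (faces_dim D d).
Hypothesis top0 : top != finset.set0.

Lemma min_dist_separator (F R : {set 'I_n}) t :
  (forall G, G \in facets D -> #|G| = d) -> F \in facets D -> R \subset F ->
  (forall G, G \in facets D -> R \subset G -> G = F) -> (#|R| <= t)%N -> min_dist I t = 1.
Proof.
move=> pD FD RF Rsep Rt.
have topE : top = facets D.
  apply/setP => G; apply/idP/idP => [/(top_facet Dd)//|GD].
  by have [GD' _] := iffLR (mem_facets _ _) GD; rewrite inE GD' pD /=.
have zdP f : zero_div_forms I t f ->
    multiplicity (ideal_gen (I `|` [set f])) = #|vanishing_facets D d f| /\ (0 < #|vanishing_facets D d f| < #|top|)%N.
  move=> /(zero_div_formsP _ _ dD)[ft [G GD Gf] [G' GD' Gf']].
  have k0 : vanishing_facets D d f != finset.set0.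
    by apply/set0Pn; exists G'; apply/vanishing_facetsP; rewrite topE.
  rewrite (multiplicity_ideal_add_top dD Dd ft) // card_gt0 k0; split=> //.
  apply: proper_card; apply/fintype.properP; split.
    by apply/fintype.subsetP => s /vanishing_facetsP[].
  by exists G; [rewrite topE|apply/negP => /vanishing_facetsP[]].
have FT : F \in top by rewrite topE.
rewrite /min_dist (multiplicity_face_ideal K dD Dd top0).
(* If F is the only facet, no form is admissible and the value is the multiplicity 1. *)
have [tF|/fintype.subsetPn[G GT GF]] := boolP (top \subset [set F]%SET).
  have tE : #|top| = 1%N.
    by apply/eqP; rewrite eqn_leq card_gt0 top0 andbT -(cards1 F) subset_leq_card.
  case: asboolP => [[f /zdP[_ /andP[k0]]]|_]; last by rewrite tE.
  by rewrite tE ltnS leqNgt k0.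
have GF' : G != F by move: GF; rewrite inE.
have GD : G \in facets D by rewrite -topE.
(* An empty R would lie in G as well. A vertex of R is needed to pad x_R to degree t without
   changing its support. *)
have [v vR] : exists v, v \in R.
  apply/set0Pn/negP => /eqP R0; move/eqP: GF'; apply; apply: Rsep => //.
  by rewrite R0 finset.sub0set.
pose m := (smon R + U_(v) *+ (t - #|R|))%MM.
have mR : mvars m = R by exact: mvars_smonX.
have md : mdeg m = t by exact: mdeg_smonX.
pose f : S := 'X_[m].
have fP s : face_prime s f <-> ~~ (R \subset s) by rewrite -mR; exact: face_primeX.
have fz : zero_div_forms I t f.
  apply/(zero_div_formsP _ _ dD); split; first by rewrite -md dhomogX.
    by exists F => // /fP; rewrite RF.
  by exists G => //; apply/fP/negP => /(Rsep _ GD)/eqP; rewrite (negbTE GF').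
have kf : vanishing_facets D d f = (top :\ F)%SET.
  apply/setP => H; rewrite in_setD1; apply/idP/andP => [/vanishing_facetsP[HT /fP RH]|[HF HT]].
    by split=> //; apply: contraNneq RH => ->.
  by apply/vanishing_facetsP; split=> //; apply/fP/negP => /(Rsep _ (top_facet Dd HT))/eqP; rewrite (negbTE HF).
have kc : #|top| = #|vanishing_facets D d f|.+1 by rewrite kf [LHS](cardsD1 F) FT.
have [fm _] := zdP f fz.
rewrite (nat_maxE (m := #|vanishing_facets D d f|)) => [||_ [h /zdP[-> /andP[_ +]] <-]].
- by case: asboolP => [_|[]]; [rewrite kc; lia|exists f].
- by exists f.
- by rewrite kc ltnS.
Qed.

(** The form f_t sums, over the faces F of size d, one monomial of degree t with support F. It lies
    in the prime of every smaller face, hence of G, and in no prime of a face of size d; so it is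
    admissible, and its multiplicity is at least t. *)
Lemma min_dist_unstable G r : G \in facets D -> (#|G| < d)%N -> ~ regularity_index I r.
Proof.
move=> GD Gd; have d0 : (0 < d)%N by exact: leq_ltn_trans Gd.
have dE : d = d.-1.+1 by rewrite prednK.
have [i0 _] : exists i : 'I_n, true.
  have /set0Pn[F] := top0; rewrite inE => /andP[_ /eqP cF].
  have /set0Pn[i _] : F != finset.set0 by rewrite -card_gt0 cF.
  by exists i.
pose v (F : {set 'I_n}) := odflt i0 [pick i in F].
have vF F : F \in top -> v F \in F.
  rewrite inE => /andP[_ /eqP cF]; rewrite /v; case: pickP => //= F0.
  by move: d0; rewrite -cF card_gt0 => /set0Pn[i iF]; have := F0 i; rewrite /= iF.
have cT F : F \in top -> #|F| = d by rewrite inE => /andP[_ /eqP].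
pose m t F := (smon F + U_(v F) *+ (t - #|F|))%MM.
have mv t F : F \in top -> mvars (m t F) = F by move=> FT; apply: mvars_smonX; exact: vF.
pose f t : S := \sum_(F in top) 'X_[m t F].
have fP t (s : {set 'I_n}) : (#|s| < d)%N -> face_prime s (f t).
  move=> sd; have [hs _ _] := face_prime_prime K s; apply: ideal_sum => // F FT.
  apply/face_primeX; rewrite mv //; apply: contraL sd => /subset_leq_card.
  by rewrite cT // -leqNgt.
have fN t F : F \in top -> ~ face_prime F (f t).
  move=> FT /(_ (m t F)); rewrite inE mv // => /(_ (fintype.subxx _))/eqP.
  rewrite /f (bigD1 F) //= mcoeffD mcoeffX eqxx raddf_sum big1 ?addr0 ?oner_eq0 // => H /andP[HT HF].
  rewrite /= mcoeffX; case: eqP => // e; move/eqP: HF; case.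
  by rewrite -(mv t H HT) e mv.
have fh t : (d <= t)%N -> f t \is t.-homog.
  move=> dt; apply: rpred_sum => F FT; rewrite -{2}(@mdeg_smonX F (v F) t) ?dhomogX //.
  by rewrite cT.
have Dg s : s \in D -> (#|s| <= d.-1.+1)%N by rewrite -dE; exact: Dd.
have vanish0 (h : S) : vanishing_facets D d h = finset.set0 -> vanishing_facets D d.-1.+1 h = finset.set0 by rewrite -dE.
have zf t : (d <= t)%N -> zero_div_forms I t (f t).
  move=> dt; apply/(zero_div_formsP _ _ dD); split; first exact: fh.
    by have /set0Pn[F FT] := top0; exists F; [exact: top_facet FT|exact: fN].
  by exists G => //; exact: fP.
have fge t : (d <= t)%N -> (t <= multiplicity (ideal_gen (I `|` [set f t])))%N.
  move=> dt; have /set0Pn[F FT] := top0; have := cardsD1 (v F) F; rewrite vF // cT // add1n => cF.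
  have FvD : (F :\ v F)%SET \in D.
    by have [FD _] := iffLR (mem_facets _ _) (top_facet Dd FT); apply: dD FD (subsetDl _ _).
  have k0 : vanishing_facets D d (f t) = finset.set0.
    apply/setP => H; rewrite finset.in_set0; apply/negP => /vanishing_facetsP[HT]; exact: fN.
  have c1 : #|(F :\ v F)%SET| = d.-1 by rewrite cF.
  apply: leq_trans (multiplicity_ideal_add_ge dD Dg (fh t dt) (vanish0 _ k0) FvD c1 _).
    by rewrite -dE leq_pmull // card_gt0.
  by apply: fP; rewrite cF.
have fle t h : (d <= t)%N -> zero_div_forms I t h ->
    (multiplicity (ideal_gen (I `|` [set h])) <= #|top| * t + #|{set 'I_n}|)%N.
  move=> dt /(zero_div_formsP _ _ dD)[ht _ _].
  have [k0|k0] := eqVneq (vanishing_facets D d h) finset.set0.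
    have := multiplicity_ideal_add_le dD Dg ht (vanish0 _ k0) (leq_trans d0 dt).
    by rewrite -dE; apply.
  rewrite (multiplicity_ideal_add_top dD Dd ht k0); apply: leq_trans (max_card _) (leq_addl _ _).
have md t : (d <= t)%N -> min_dist I t <= #|top|%:Z - t%:Z.
  move=> dt; rewrite /min_dist; case: asboolP => [_|[]]; last by exists (f t); exact: zf.
  rewrite (multiplicity_face_ideal K dD Dd top0) lerD2l lerN2 lez_nat; apply: leq_trans (fge t dt) _.
  (* Without an upper bound [nat_max] could be its default 0 instead of a maximum. *)
  apply: (nat_max_ub (g := (#|top| * t + #|{set 'I_n}|)%N)); last by exists (f t) => //; exact: zf.
  by move=> _ [h hz <-]; exact: fle.
move=> [l [/(_ 1 ltr01)[N hN] _ _]].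
(* Large enough to push #|top| - t below l - 1, while the limit l demands a distance below 1. *)
pose t := (N + d + #|top| + `|l|.+1)%N.
have dt : (d <= t)%N by rewrite /t; lia.
have /hN : (N <= t)%N by rewrite /t; lia.
have := md t dt; rewrite -rmorphB -intr_norm -[1]/(1%:~R) ltr_int /t; lia.
Qed.

End Faces.

End MinDist.

(** * Bounds for the regularity index *)

Section FaceIdealRegularity.
Variables (K : fieldType) (n : nat) (D : {set {set 'I_n}}).
Local Notation S := {mpoly K[n]}.
Hypotheses (dD : down_closed D) (D0 : finset.set0 \in D).
Local Notation I := (face_ideal (K := K) D).

Lemma ex_top : exists2 d, faces_dim D d != finset.set0 & forall s, s \in D -> (#|s| <= d)%N.
Proof.
have [F FD Fmax] := arg_maxnP (fun s : {set 'I_n} => #|s|) D0.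
by exists #|F| => //; apply/set0Pn; exists F; rewrite inE eqxx andbT.
Qed.

Lemma pure_dim d : (forall F, F \in facets D -> #|F| = d) ->
  faces_dim D d != finset.set0 /\ forall s, s \in D -> (#|s| <= d)%N.
Proof.
move=> pD; split=> [|s /ex_facet[F FD /subset_leq_card]]; last by rewrite (pD F FD).
have [F FD _] := ex_facet D0; apply/set0Pn; exists F; rewrite inE (pD F FD) eqxx andbT.
by have [] := iffLR (mem_facets _ _) FD.
Qed.

Lemma pure_regularity_index d (F R : {set 'I_n}) :
  (forall G, G \in facets D -> #|G| = d) -> F \in facets D -> R \subset F ->
  (forall G, G \in facets D -> R \subset G -> G = F) ->
  (exists r, regularity_index I r) /\ forall r, regularity_index I r -> (r <= #|R|)%N.
Proof.
move=> pD FD RF Rsep; have [top0 Dd] := pure_dim pD.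
by apply: (@regularity_index_stable _ _ _ _ 1) => t; exact: (min_dist_separator K dD Dd top0 pD FD RF).
Qed.

Lemma pure_regularity_index_dim d : (forall F, F \in facets D -> #|F| = d) ->
  (exists r, regularity_index I r) /\ forall r, regularity_index I r -> (r <= krull_dim I)%N.
Proof.
move=> pD; have [top0 Dd] := pure_dim pD; have [F FD _] := ex_facet D0.
rewrite (krull_dim_face_ideal K dD Dd top0) -(pD F FD).
apply: (pure_regularity_index pD FD (fintype.subxx _)) => G GD FG.
by have [_ h] := iffLR (mem_facets _ _) FD; apply: h FG; have [] := iffLR (mem_facets _ _) GD.
Qed.

Lemma regularity_index_dim r : regularity_index I r -> (r <= krull_dim I)%N.
Proof.
have [d top0 Dd] := ex_top.
have [pD|npD] := pselect (forall F, F \in facets D -> #|F| = d).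
  by have [_] := pure_regularity_index_dim pD; apply.
have [G GD Gd] : exists2 G, G \in facets D & #|G| <> d.
  by apply: contrapT => h; apply: npD => F FD; apply: contrapT => Fd; apply: h; exists F.
have [GD' _] := iffLR (mem_facets _ _) GD.
have /(min_dist_unstable dD Dd top0 GD (K := K) (r := r)) : (#|G| < d)%N.
  by rewrite ltn_neqAle Dd // andbT; apply/eqP.
by [].
Qed.

(** The vertices whose variables lie outside a prime Q containing I form a face. If Q is inside P_F,
    this face contains the facet F, hence equals it. *)
Lemma facet_minimal_prime F : F \in facets D -> minimal_prime I (face_prime F).
Proof.
move=> FD; have [FD' Fmax] := iffLR (mem_facets _ _) FD.
split; first exact: face_prime_prime.
  by apply: face_idealS; apply/fintype.subsetP => s; rewrite inE; exact: dD.
move=> Q [hQ Q1 Qp] IQ QF; apply/seteqP; split=> //.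
pose U : {set 'I_n} := [set i | ~~ `[< Q 'X_i >]]%SET.
have QX (s : {set 'I_n}) : Q (sqfree_monomial K s) -> exists2 i, i \in s & Q 'X_i.
  rewrite /sqfree_monomial; elim/big_rec: _ => [/Q1//|i x si IH /Qp[Qi|/IH//]].
  by exists i.
have UD : U \in D.
  apply: contrapT => /negP UD; have : Q (sqfree_monomial K U).
    by apply: IQ; rewrite sqfree_monomialE; apply/face_idealX; rewrite mvars_smon.
  by move=> /QX[i]; rewrite inE => /asboolPn.
have FU : F \subset U.
  apply/fintype.subsetP => i iF; rewrite inE; apply/asboolPn => /QF/face_primeX.
  by rewrite mvars1 finset.sub1set iF.
have UF := Fmax U UD FU.
move=> p pF; rewrite [p]mpolyE; apply: ideal_sum => // m _; rewrite -mul_mpolyC.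
have [mF|mF] := boolP (mvars m \subset F).
  by rewrite (pF m) ?inE // mpolyC0 mul0r; case: hQ.
have [_ _] := hQ; apply; have /fintype.subsetPn[i im iF] := mF.
have mi : (U_(i) <= m)%MM by rewrite lep1mP; move: im; rewrite inE.
rewrite -(submK mi) mpolyXD; have [_ _] := hQ; apply.
by move: iF; rewrite -UF inE negbK => /asboolP.
Qed.

Lemma unmixed_pure : unmixed I -> forall F, F \in facets D -> #|F| = krull_dim I.
Proof.
move=> uI F FD; rewrite -(uI _ (facet_minimal_prime FD)); apply/esym.
apply: (krull_dim_face_ideal K (@powerset_down _ F)).
  by move=> s; rewrite inE => /subset_leq_card.
by apply/set0Pn; exists F; rewrite inE eqxx inE fintype.subxx.
Qed.

Lemma separating_cycle_regularity_index d (F t : {set 'I_n}) z :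
  (forall G, G \in facets D -> #|G| = d) -> F \in facets D -> separating_cycle (K := K) D F t z ->
  exists r, regularity_index I r /\ forall rho, cm_regularity I rho -> r%:Z <= rho.
Proof.
move=> pD FD sc; have [[tF _] FtF _ _ _] := sc.
have [] := pure_regularity_index pD FD (subsetDl F t) _.
  move=> G /mem_facets[GD Gmax] FtG; apply/esym/Gmax; first by have [] := iffLR (mem_facets _ _) FD.
  exact: FtF.
move=> [r hr] rle; exists r; split=> // rho /(regularity_lower dD sc).
by apply: le_trans; rewrite lez_nat; exact: rle.
Qed.

End FaceIdealRegularity.

Lemma faces_of_stanley_reisner (K : fieldType) n (D : {set {set 'I_n}}) :
  down_closed D -> faces_of (stanley_reisner (K := K) D) = D.
Proof.
move=> dD; apply/setP => s; apply/idP/idP => [/mem_faces_of h|sD].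
  apply: contrapT => /negP sD; apply: h; apply: sub_ideal_gen; exists s; last exact: sqfree_monomialE.
  by rewrite /= inE.
apply/mem_faces_of => /(_ (face_ideal D)) h.
have /face_idealX : face_ideal D ('X_[smon s] : {mpoly K[n]}).
  apply: h; first exact: face_ideal_ideal.
  move=> _ [t /= tD <-]; rewrite sqfree_monomialE; apply/face_idealX.
  by move: tD; rewrite inE mvars_smon.
by rewrite mvars_smon sD.
Qed.

Theorem theorem3 (K : fieldType) (n : nat) (I : set {mpoly K[n]})
    (hI : sqfree_monomial_ideal I)
    (hI0 : exists2 f, I f & f != 0)
    (hI1 : ~ I 1) :
  [/\ (* r_I <= dim (S/I), whenever r_I is defined *)
      forall r : nat, regularity_index I r -> (r <= krull_dim I)%N,
      (* r_I is defined at least for I unmixed *)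
      unmixed I -> exists r : nat, regularity_index I r &
      shellable_ideal I \/ gorenstein_ideal I ->
        exists r : nat, regularity_index I r /\
          forall rho : int, cm_regularity I rho -> r%:Z <= rho].
Proof.
have [dD IE] := sqfree_face_ideal hI; have D0 : finset.set0 \in faces_of I.
  by apply/mem_faces_of; rewrite -sqfree_monomialE /sqfree_monomial big_set0.
move: (faces_of I) dD IE D0 => D dD -> D0 {hI hI0 hI1}; split.
- by move=> r; exact: regularity_index_dim.
- by move=> uI; have [] := pure_regularity_index_dim K dD D0 (unmixed_pure dD uI).
case=> [[D' [[cD' _] shD' ID]]|].
  have DE : D = D' by rewrite -(faces_of_stanley_reisner K cD') -ID faces_of_face_ideal.
  rewrite -DE in shD'; have [[d pD] [F [t [z [FD sc]]]]] := shellable_cycle K dD shD'.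
  exact: (separating_cycle_regularity_index dD D0 pD FD sc).
move=> /(gorenstein_cycle dD D0)[[d pD] cyc].
have [F FD _] := ex_facet D0; have [t [z sc]] := cyc F FD.
exact: (separating_cycle_regularity_index dD D0 pD FD sc).
Qed.
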